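(* Let $T>0$ and $d\in\mathbb{N}^*$, and suppose that the coefficients $b,b_\varepsilon,\sigma,\sigma_\varepsilon$ satisfy assumption (A) (stated in the context) with constants $K_1,K_2,\Lambda,\kappa,\gamma$. Then for every $q\in(4d,+\infty]$ there exist constants $C=C(q)\ge 1$ and $c\in(0,1]$, where $C$ depends only on $q$, $T$, $d$ and $K_1,K_2,\Lambda,\kappa,\gamma$, and $c$ depends only on $d,K_1,K_2,\Lambda,\kappa,\gamma$ (in particular neither depends on $\varepsilon$, and $c$ does not depend on $T$), such that for all $0<t\le T$ and all $((x,y),(x',y'))\in(\mathbb{R}^{2d})^2$, $$|(p-p_\varepsilon)(t,(x,y),(x',y'))|\le C\,\Delta_{\varepsilon,\gamma,q}\,\hat p_{c,K}(t,(x,y),(x',y')),$$ where $p(t,(x,y),(\cdot,\cdot))$ and $p_\varepsilon(t,(x,y),(\cdot,\cdot))$ are the transition densities at time $t$ of $$dX_t=b(X_t,Y_t)\,dt+\sigma(X_t,Y_t)\,dW_t,\qquad dY_t=X_t\,dt,$$ $$dX^{(\varepsilon)}_t=b_\varepsilon(X^{(\varepsilon)}_t,Y^{(\varepsilon)}_t)\,dt+\sigma_\varepsilon(X^{(\varepsilon)}_t,Y^{(\varepsilon)}_t)\,dW_t,\qquad dY^{(\varepsilon)}_t=X^{(\varepsilon)}_t\,dt,$$ respectively, started from $(x,y)$ at time $0$, and, for $c>0$, $$\hat p_{c,K}(t,(x,y),(x',y')):=\frac{c^{d}3^{d/2}}{(2\pi t^2)^{d}}\exp\left(-c\left[\frac{|x'-x|^2}{4t}+3\,\frac{|y'-y-(x+x')t/2|^2}{t^3}\right]\right).$$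 Moreover, $\hat p_{c,K}$ enjoys the semigroup property: for all $0<s<t\le T$, $$\int_{\mathbb{R}^{2d}}\hat p_{c,K}(s,(x,y),(w,z))\,\hat p_{c,K}(t-s,(w,z),(x',y'))\,dw\,dz=\hat p_{c,K}(t,(x,y),(x',y')).$$
   Context: $W$ is a $d$-dimensional Brownian motion on some filtered probability space. The parameter $\varepsilon>0$ is fixed; $b,b_\varepsilon:\mathbb{R}^{2d}\to\mathbb{R}^d$ and $\sigma,\sigma_\varepsilon:\mathbb{R}^{2d}\to\mathbb{R}^d\otimes\mathbb{R}^d$ ($d\times d$ matrices). Assumption (A) means that the following three conditions hold, with constants not depending on $\varepsilon$. (A1) Boundedness: $b,b_\varepsilon,\sigma,\sigma_\varepsilon$ are measurable, $\sup|b|+\sup|b_\varepsilon|\le K_1$ and $\sup|\sigma|+\sup|\sigma_\varepsilon|\le K_2$, suprema over $\mathbb{R}^{2d}$. (A2) Uniform ellipticity: with $a:=\sigma\sigma^*$ and $a_\varepsilon:=\sigma_\varepsilon\sigma_\varepsilon^*$, there is $\Lambda\ge1$ such that for all $(x,y,\xi)\in(\mathbb{R}^d)^3$, $\Lambda^{-1}|\xi|^2\le\langle a(x,y)\xi,\xi\rangle\le\Lambda|\xi|^2$ and $\Lambda^{-1}|\xi|^2\le\langle a_\varepsilon(x,y)\xi,\xi\rangle\le\Lambda|\xi|^2$. (A3) Hölder continuity: for some $\gamma\in(0,1]$ and $\kappa<\infty$, for all $(x,y),(x',y')\in\mathbb{R}^{2d}$, $|\sigma(x,y)-\sigma(x',y')|+|\sigma_\varepsilon(x,y)-\sigma_\varepsilon(x',y')|\le\kappa(|x-x'|+|y-y'|)^\gamma$.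 Under (A) both equations admit a unique weak solution, which has a density at each time $t\in(0,T]$. Error quantities: for $q\in(1,+\infty]$, $\Delta_{\varepsilon,b,q}:=\|b-b_\varepsilon\|_{L^q(\mathbb{R}^{2d})}$; $\Delta_{\varepsilon,\sigma,\gamma}:=|\sigma-\sigma_\varepsilon|_\gamma$, where $|f|_\gamma:=\sup_{\xi}|f(\xi)|+\sup_{\xi\ne\xi'}\frac{|f(\xi)-f(\xi')|}{|\xi-\xi'|^\gamma}$ over $\xi,\xi'\in\mathbb{R}^{2d}$; and $\Delta_{\varepsilon,\gamma,q}:=\Delta_{\varepsilon,\sigma,\gamma}+\Delta_{\varepsilon,b,q}$. Version of the densities: $p$ is the version given by the absolutely convergent series $p=\sum_{r\ge0}\tilde p\otimes H^{(r)}$, defined as follows. Let $R_s=\begin{pmatrix}I_d&0\\ sI_d&I_d\end{pmatrix}$ and $B=\begin{pmatrix}I_d\\ 0\end{pmatrix}$. Then $\tilde p(t,(x,y),(x',y'))$ is the value at $(x',y')$ of the Gaussian density on $\mathbb{R}^{2d}$ with mean $R_t\begin{pmatrix}x\\ y\end{pmatrix}$ and covariance $C_t=\int_0^tR_{t-u}B\,a(x',y'-x'(t-u))\,B^*R_{t-u}^*\,du$. The kernel is $$H(t,(x,y),(x',y'))=\tfrac12\mathrm{Tr}\big([a(x,y)-a(x',y'-x't)]D_x^2\tilde p(t,(x,y),(x',y'))\big)+\langle b(x,y),D_x\tilde p(t,(x,y),(x',y'))\rangle.$$ The convolution is $f\otimes g(t,(x,y),(x',y'))=\int_0^tdu\int_{\mathbb{R}^{2d}}f(u,(x,y),(w,z))g(t-u,(w,z),(x',y'))\,dw\,dz$,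 with $\tilde p\otimes H^{(0)}=\tilde p$, $H^{(1)}=H$ and $H^{(r)}=H\otimes H^{(r-1)}$ for $r\ge2$. The density $p_\varepsilon$ is given by the same construction with $(b_\varepsilon,\sigma_\varepsilon)$ in place of $(b,\sigma)$. The function $\hat p_{c,K}(t,(x,y),(\cdot,\cdot))$ is the density at time $t$ of $\left(x+\frac{\sqrt2W_t}{c^{1/2}},\ y+\int_0^t\big(x+\frac{\sqrt2W_s}{c^{1/2}}\big)ds\right)$. *)

(* Defs.v *)
From HB Require Import structures.
From mathcomp Require Import all_boot all_order all_algebra.
From mathcomp Require Import all_classical all_reals all_analysis.

Set Implicit Arguments.
Unset Strict Implicit.
Unset Printing Implicit Defensive.

Import Order.TTheory GRing.Theory Num.Theory.
Import numFieldNormedType.Exports.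

Local Open Scope classical_set_scope.
Local Open Scope ring_scope.

Definition measure_matrix_display : measure_display. Proof. exact. Qed.

Section measurable_matrix.
Context {R : realType} {m n : nat}.

(* The product sigma-algebra, i.e. the Borel one. *)
Definition mx_cylinders : set (set 'M[R]_(m, n)) :=
  [set A | exists i j (B : set R),
    measurable B /\ A = (fun M : 'M[R]_(m, n) => M i j) @^-1` B].

HB.instance Definition _ := @isMeasurable.Build measure_matrix_display
  'M[R]_(m, n) <<s mx_cylinders >> (@sigma_algebra0 _ setT mx_cylinders)
  (@sigma_algebraC _ mx_cylinders) (@sigma_algebra_bigcup _ setT mx_cylinders).

Lemma measurable_mx_entry i j :
  measurable_fun [set: 'M[R]_(m, n)] (fun M => M i j).
Proof.
by move=> _ B mB; rewrite setTI; apply: sub_sigma_algebra; exists i, j, B.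
Qed.

Lemma measurable_fun_mxP d (T : measurableType d) (f : T -> 'M[R]_(m, n)) :
  (forall i j, measurable_fun setT (fun x => f x i j)) ->
  measurable_fun setT f.
Proof.
move=> mf; apply: (measurability mx_cylinders) => //.
move=> _ [_ [i [j [B [mB ->]]]] <-].
exact: (mf i j measurableT B mB).
Qed.

End measurable_matrix.

Section lebesgue_vector.
Context {R : realType}.

Definition cV_cons n (p : measurableTypeR R * 'cV[R]_n) : 'cV[R]_n.+1 :=
  col_mx (p.1%:M : 'cV_1) p.2.

Lemma cV_cons0 n p : @cV_cons n p ord0 ord0 = p.1.
Proof.
have -> : ord0 = lshift n (ord0 : 'I_1) by apply: val_inj.
by apply: (etrans (col_mxEu _ _ _ _)); rewrite mxE.
Qed.

Lemma cV_consS n p i : @cV_cons n p (lift ord0 i) ord0 = p.2 i ord0.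
Proof.
have -> : lift ord0 i = rshift 1 i by apply: val_inj.
exact: col_mxEd.
Qed.

Lemma measurable_cV_cons n : measurable_fun setT (@cV_cons n).
Proof.
apply: measurable_fun_mxP => i j; rewrite (ord1 j).
case: (unliftP ord0 i) => [k|] ->.
- under eq_fun do rewrite cV_consS.
  by apply: (measurableT_comp (measurable_mx_entry k ord0)).
- under eq_fun do rewrite cV_cons0.
  exact: measurable_fst.
Qed.

HB.instance Definition _ n :=
  isMeasurableFun.Build _ _ _ _ (@cV_cons n) (@measurable_cV_cons n).

Lemma measurable_cV_uncons n :
  measurable_fun setT (fun v : 'cV[R]_n.+1 =>
    (v ord0 ord0, \col_i v (lift ord0 i) ord0) : measurableTypeR R * 'cV[R]_n).
Proof.
apply: measurable_fun_pair; first exact: measurable_mx_entry.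
apply: measurable_fun_mxP => i j; rewrite (ord1 j) /=.
under eq_fun do rewrite mxE.
exact: measurable_mx_entry.
Qed.

Lemma cV_consK n :
  cancel (@cV_cons n) (fun v => (v ord0 ord0, \col_i v (lift ord0 i) ord0)).
Proof.
case=> x v; congr pair; first exact: cV_cons0.
by apply/colP => i; rewrite mxE cV_consS.
Qed.

Section step.
Local Open Scope ereal_scope.
Variables (n : nat) (m : {sigma_finite_measure set 'cV[R]_n -> \bar R}).

Definition lebesgue_cV_step : set 'cV[R]_n.+1 -> \bar R :=
  pushforward (lebesgue_measure \x m) (@cV_cons n).

Let step0 : lebesgue_cV_step set0 = 0. Proof. exact: measure0. Qed.
Let step_ge0 A : 0 <= lebesgue_cV_step A. Proof. exact: measure_ge0. Qed.
Let step_additive : semi_sigma_additive lebesgue_cV_step.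
Proof. exact: measure_semi_sigma_additive. Qed.

HB.instance Definition _ := isMeasure.Build _ _ _ lebesgue_cV_step
  step0 step_ge0 step_additive.

Let step_sigma_finite : sigma_finite setT lebesgue_cV_step.
Proof.
have /sigma_finiteP[F [TF ndF Foo]] := sigma_finiteT (@lebesgue_measure R).
have /sigma_finiteP[G [TG ndG Goo]] := sigma_finiteT m.
pose g (v : 'cV[R]_n.+1) : (measurableTypeR R * 'cV[R]_n)%type :=
  (v ord0 ord0, \col_i v (lift ord0 i) ord0).
exists (fun k => g @^-1` (F k `*` G k)).
  rewrite -preimage_bigcup -[LHS](preimage_setT g); congr (g @^-1` _).
  rewrite -setXTT TF TG predeqE => -[x y]; split.
    move=> [/= [i _ Fix] [k _ Gky]]; exists (maxn i k) => //; split.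
    - by move: x Fix; exact/subsetPset/ndF/leq_maxl.
    - by move: y Gky; exact/subsetPset/ndG/leq_maxr.
  by move=> [i _ []/= ? ?]; split; exists i.
move=> k; have [mF Fk] := Foo k; have [mG Gk] := Goo k; split.
  rewrite -[X in measurable X]setTI.
  by apply: measurable_cV_uncons => //; exact: measurableX.
rewrite /lebesgue_cV_step /pushforward -comp_preimage.
have -> : g \o @cV_cons n = id by apply/funext => p; exact: cV_consK.
by rewrite preimage_id product_measure1E// lte_mul_pinfty// ge0_fin_numE.
Qed.

HB.instance Definition _ := Measure_isSigmaFinite.Build _ _ _ lebesgue_cV_step
  step_sigma_finite.

End step.

(* Lebesgue measure on R^n, built coordinate by coordinate. *)
Fixpoint lebesgue_cV n : {sigma_finite_measure set 'cV[R]_n -> \bar R} :=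
  match n with
  | 0 => \d_(0 : 'cV[R]_0)
  | k.+1 => lebesgue_cV_step (lebesgue_cV k)
  end.

End lebesgue_vector.

Section euclidean.
Context {R : realType}.

(* Euclidean norm of a vector, Frobenius norm of a matrix; the library's
   norm on ['M[R]_(m, n)] is the maximum norm. *)
Definition mx_enorm m n (A : 'M[R]_(m, n)) : R :=
  Num.sqrt (\sum_i \sum_j A i j ^+ 2).

Definition dotv n (u v : 'cV[R]_n) : R := \sum_i u i ord0 * v i ord0.

Definition gaussian_pdf n (m : 'cV[R]_n) (C : 'M[R]_n) (v : 'cV[R]_n) : R :=
  expR (- ((v - m)^T *m invmx C *m (v - m)) ord0 ord0 / 2)
  / Num.sqrt ((2 * pi) ^+ n * \det C).

End euclidean.

Section phase_space.
Context {R : realType} {d : nat}.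
Local Notation V := ('cV[R]_d * 'cV[R]_d)%type.

(* Lebesgue measure on R^{2d}, a point of which is a pair (x, y). *)
Definition leb2 : {measure set V -> \bar R} :=
  (lebesgue_cV d \x lebesgue_cV d)%E.

Definition pair_enorm (z : V) : R :=
  Num.sqrt (mx_enorm z.1 ^+ 2 + mx_enorm z.2 ^+ 2).

Definition sup_enorm m n (f : V -> 'M[R]_(m, n)) : \bar R :=
  ereal_sup [set (mx_enorm (f z))%:E | z in [set: V]].

Definition holder_norm m n (gamma : R) (f : V -> 'M[R]_(m, n)) : \bar R :=
  (sup_enorm f +
   ereal_sup [set r | exists z z' : V, z != z' /\
     r = (mx_enorm (f z - f z') /
          pair_enorm (z.1 - z'.1, z.2 - z'.2) `^ gamma)%:E])%E.

Definition Lq_enorm m n (q : \bar R) (f : V -> 'M[R]_(m, n)) : \bar R :=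
  Lnorm leb2 q (fun z => (mx_enorm (f z))%:E).

Definition diffusion_mx (sigma : V -> 'M[R]_d) (z : V) : 'M[R]_d :=
  sigma z *m (sigma z)^T.

Definition uniformly_elliptic (Lambda : R) (a : V -> 'M[R]_d) :=
  forall z (xi : 'cV[R]_d),
    Lambda^-1 * mx_enorm xi ^+ 2 <= dotv (a z *m xi) xi <=
    Lambda * mx_enorm xi ^+ 2.

Record assumption_A (K1 K2 Lambda kappa gamma : R)
    (b b_eps : V -> 'cV[R]_d) (sigma sigma_eps : V -> 'M[R]_d) : Prop := {
  A_measurable : [/\ measurable_fun setT b, measurable_fun setT b_eps,
    measurable_fun setT sigma & measurable_fun setT sigma_eps] ;
  A_drift_bounded : (sup_enorm b + sup_enorm b_eps <= K1%:E)%E ;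
  A_diffusion_bounded : (sup_enorm sigma + sup_enorm sigma_eps <= K2%:E)%E ;
  A_Lambda_ge1 : 1 <= Lambda ;
  A_elliptic : uniformly_elliptic Lambda (diffusion_mx sigma) ;
  A_elliptic_eps : uniformly_elliptic Lambda (diffusion_mx sigma_eps) ;
  A_gamma : 0 < gamma <= 1 ;
  A_holder : forall z z' : V,
    mx_enorm (sigma z - sigma z') + mx_enorm (sigma_eps z - sigma_eps z') <=
    kappa * (mx_enorm (z.1 - z'.1) + mx_enorm (z.2 - z'.2)) `^ gamma
}.

End phase_space.

Section stochastic_calculus.
Context {R : realType} {d : nat} {disp : measure_display}
  {Omega : measurableType disp} (P : probability Omega R).

Definition filtration (F : R -> set (set Omega)) :=
  (forall t, 0 <= t -> sigma_algebra setT (F t) /\ F t `<=` measurable) /\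
  (forall s t, 0 <= s -> s <= t -> F s `<=` F t).

Definition measurable_wrt (G : set (set Omega)) m n
    (f : Omega -> 'M[R]_(m, n)) :=
  forall A, measurable A -> G (f @^-1` A).

(* [bm_increment] says both that the increment on [s, t] is independent of
   [F s] and that its law is N(0, (t - s) I). *)
Record brownian_motion (F : R -> set (set Omega))
    (W : R -> Omega -> 'cV[R]_d) : Prop := {
  bm_start : forall w, W 0 w = 0 ;
  bm_adapted : forall t, 0 <= t -> measurable_wrt (F t) (W t) ;
  bm_continuous : forall w,
    {within `[0, +oo[%classic, continuous (fun t : R => W t w)} ;
  bm_increment : forall s t, 0 <= s -> s < t ->
    forall (A : set Omega) (B : set 'cV[R]_d), F s A -> measurable B ->
    P (A `&` (fun w => W t w - W s w) @^-1` B) =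
    (P A * \int[lebesgue_cV d]_(v in B)
             (gaussian_pdf 0 ((t - s)%:M) v)%:E)%E
}.

Record simple_process (F : R -> set (set Omega)) (t : R) := {
  sp_size : nat ;
  sp_time : nat -> R ;
  sp_coef : nat -> Omega -> 'M[R]_d ;
  sp_time0 : sp_time 0%N = 0 ;
  sp_time_last : sp_time sp_size = t ;
  sp_time_mono : forall k, (k < sp_size)%N -> sp_time k <= sp_time k.+1 ;
  sp_adapted : forall k, (k < sp_size)%N ->
    measurable_wrt (F (sp_time k)) (sp_coef k) ;
  sp_bounded : exists M : R, forall k w, (k < sp_size)%N ->
    mx_enorm (sp_coef k w) <= M
}.

Definition sp_value F t (S : simple_process F t) (s : R) (w : Omega)
    : 'M[R]_d :=
  \sum_(k < sp_size S | sp_time S k < s <= sp_time S k.+1) sp_coef S k w.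

Definition sp_integral F t (W : R -> Omega -> 'cV[R]_d)
    (S : simple_process F t) (w : Omega) : 'cV[R]_d :=
  \sum_(k < sp_size S)
    sp_coef S k w *m (W (sp_time S k.+1) w - W (sp_time S k) w).

(* I is (a version of) the Ito integral of H against W over [0, t]: the L^2
   limit of the integrals of simple processes that approximate H in
   L^2(dP x ds). *)
Definition is_ito_integral (F : R -> set (set Omega))
    (W : R -> Omega -> 'cV[R]_d) (t : R) (H : R -> Omega -> 'M[R]_d)
    (I : Omega -> 'cV[R]_d) :=
  exists S : nat -> simple_process F t,
    (fun k => \int[P]_w \int[lebesgue_measure]_(s in `[0%R, t]%classic)
       (mx_enorm (sp_value (S k) s w - H s w) ^+ 2)%:E)%E @ \oo --> 0%E /\
    (fun k => \int[P]_w
       (mx_enorm (sp_integral W (S k) w - I w) ^+ 2)%:E)%E @ \oo --> 0%E.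

Definition time_integral n (t : R) (f : R -> 'cV[R]_n) : 'cV[R]_n :=
  \col_i \int[lebesgue_measure]_(s in `[0, t]%classic) f s i ord0.

(* Weak solution on [0, T], started from z, of
   dX = b(X, Y) dt + sigma(X, Y) dW,  dY = X dt. *)
Record weak_solution (T : R) (b : 'cV[R]_d * 'cV[R]_d -> 'cV[R]_d)
    (sigma : 'cV[R]_d * 'cV[R]_d -> 'M[R]_d) (z : 'cV[R]_d * 'cV[R]_d)
    (F : R -> set (set Omega)) (W X Y : R -> Omega -> 'cV[R]_d) : Prop := {
  ws_filtration : filtration F ;
  ws_brownian : brownian_motion F W ;
  ws_adapted : forall t, 0 <= t <= T ->
    measurable_wrt (F t) (X t) /\ measurable_wrt (F t) (Y t) ;
  ws_continuous : forall w,
    {within `[0, T]%classic, continuous (fun t : R => X t w)} /\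
    {within `[0, T]%classic, continuous (fun t : R => Y t w)} ;
  ws_X : forall t, 0 <= t <= T ->
    is_ito_integral F W t (fun s w => sigma (X s w, Y s w))
      (fun w => X t w - z.1 - time_integral t (fun s => b (X s w, Y s w))) ;
  ws_Y : forall t, 0 <= t <= T ->
    {ae P, forall w, Y t w = z.2 + time_integral t (fun s => X s w)}
}.

End stochastic_calculus.

Section densities.
Context {R : realType} {d : nat}.
Local Notation V := ('cV[R]_d * 'cV[R]_d)%type.

(* For every starting point and every weak solution on [0, T], p gives the
   density at each time t <= T. *)
Definition transition_density (T : R) (b : V -> 'cV[R]_d)
    (sigma : V -> 'M[R]_d) (p : R -> V -> V -> R) :=
  forall (z : V) (disp : measure_display) (Omega : measurableType disp)
    (P : probability Omega R) (F : R -> set (set Omega))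
    (W X Y : R -> Omega -> 'cV[R]_d),
  weak_solution P T b sigma z F W X Y ->
  forall t, 0 < t <= T -> forall A : set V, measurable A ->
    P [set w | A (X t w, Y t w)] = (\int[leb2]_(z' in A) (p t z z')%:E)%E.

Definition resolvent_mx (s : R) : 'M[R]_(d + d) :=
  block_mx 1%:M 0 s%:M 1%:M.

Definition noise_mx : 'M[R]_(d + d, d) := col_mx 1%:M 0.

(* The point (x', y' - x' s) at which the frozen coefficients are read. *)
Definition backward_flow (s : R) (z' : V) : V := (z'.1, z'.2 - s *: z'.1).

Definition frozen_cov (a : V -> 'M[R]_d) (t : R) (z' : V) : 'M[R]_(d + d) :=
  \matrix_(i, j) \int[lebesgue_measure]_(u in `[0, t]%classic)
    (resolvent_mx (t - u) *m noise_mx *m a (backward_flow (t - u) z')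
      *m noise_mx^T *m (resolvent_mx (t - u))^T) i j.

(* Gaussian in z' for a frozen a only: the covariance itself depends on z'. *)
Definition frozen_density (a : V -> 'M[R]_d) (t : R) (z z' : V) : R :=
  gaussian_pdf (resolvent_mx t *m col_mx z.1 z.2) (frozen_cov a t z')
    (col_mx z'.1 z'.2).

Definition partial_x (i : 'I_d) (f : V -> R) (z : V) : R :=
  'D_(delta_mx i ord0) (fun x : 'cV[R]_d => f (x, z.2)) z.1.

Definition grad_x (f : V -> R) (z : V) : 'cV[R]_d := \col_i partial_x i f z.

Definition hess_x (f : V -> R) (z : V) : 'M[R]_d :=
  \matrix_(i, j) partial_x i (partial_x j f) z.

Definition parametrix_kernel (b : V -> 'cV[R]_d) (a : V -> 'M[R]_d)
    (t : R) (z z' : V) : R :=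
  2^-1 * \tr ((a z - a (backward_flow t z')) *m
              hess_x (fun w => frozen_density a t w z') z)
  + dotv (b z) (grad_x (fun w => frozen_density a t w z') z).

Definition time_space_conv (f g : R -> V -> V -> R) (t : R) (z z' : V) : R :=
  \int[lebesgue_measure]_(u in `[0, t]%classic)
    \int[leb2]_w (f u z w * g (t - u) w z').

(* The r-th term of the series; [iter k (conv H) H] is H^{(k+1)}. *)
Definition parametrix_term (b : V -> 'cV[R]_d) (a : V -> 'M[R]_d) (r : nat)
    : R -> V -> V -> R :=
  let H := parametrix_kernel b a in
  if r is k.+1 then
    time_space_conv (frozen_density a) (iter k (time_space_conv H) H)
  else frozen_density a.

(* A total function: the limit of the partial sums, arbitrary if there is
   none. *)
Definition parametrix_density (b : V -> 'cV[R]_d) (sigma : V -> 'M[R]_d)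
    (t : R) (z z' : V) : R :=
  limn (series (fun r => parametrix_term b (diffusion_mx sigma) r t z z')).

(* The density at time t of (x + sqrt(2/c) W_t,
   y + int_0^t (x + sqrt(2/c) W_s) ds), where z = (x, y). *)
Definition kolmogorov_density (c t : R) (z z' : V) : R :=
  c ^+ d * 3 `^ (d%:R / 2) / (2 * pi * t ^+ 2) ^+ d *
  expR (- c * (mx_enorm (z'.1 - z.1) ^+ 2 / (4 * t) +
    3 * (mx_enorm (z'.2 - z.2 - (t / 2) *: (z.1 + z'.1)) ^+ 2 / t ^+ 3))).

End densities.

(* Main.v *)
(* Let G be the Kolmogorov kernel, p~ the frozen density, H the parametrix kernel
   and H_r its iterates.  After the scaling diag(t^(-1/2), t^(-3/2)) the
   covariance of p~ is a uniformly elliptic matrix, linear in a.  Hence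
   |p~| <= K G and |H| <= K t^(th-1) G, and changing the coefficients changes p~
   and the second order part of H by at most the same bounds times Delta.

   The first order part of H changes by the unbounded factor |b - b_eps|(z), so
   the H_r are not compared pointwise.  Since the q'-th power of G is a multiple
   of a Kolmogorov kernel, Hoelder's inequality and the semigroup property give
     int G(s,z,w) |b - b_eps|(w) t^(-1/2) G(t,w,z') dw
       <= C Delta (s^(th-1) + t^(th-1)) G(s+t,z,z'),   th <= 1/2 - 2d/q,
   and an induction on r controls the averages
     int G(s,z,w) |H_r - H_(eps,r)|(t,w,z') dw.
   In this induction the weight exp(l t), for l large, makes each convolution
   contract by a factor 1/2, so the series of the differences is dominated by a
   geometric one. *)

Require Import Defs.
From HB Require Import structures.
From mathcomp Require Import all_boot all_order all_algebra.
From mathcomp Require Import all_classical all_reals all_analysis.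
From mathcomp Require Import ring lra perm measurable_realfun ess_sup_inf.

Set Implicit Arguments.
Unset Strict Implicit.
Unset Printing Implicit Defensive.

Import Order.TTheory GRing.Theory Num.Theory.
Import numFieldNormedType.Exports.

Local Open Scope classical_set_scope.
Local Open Scope ring_scope.

(** * The Kolmogorov kernel *)

Lemma eqr_le {R : numDomainType} (x y : R) : x = y -> x <= y.
Proof. by move=> ->. Qed.

Section measurable_operations.
Context {R : realType}.

Lemma measurable_inv : measurable_fun setT (fun x : R => x^-1).
Proof.
(* The square makes the base of [powR] nonnegative; the factor [x] restores the sign and the value 0
   at 0. *)
have -> : (fun x : R => x^-1) = (fun x => x * (x ^+ 2) `^ (-1)).
  apply/funext => x; rewrite powR_inv1 ?sqr_ge0//.
  by have [->|x0] := eqVneq x 0; [rewrite invr0 mul0r|field].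
apply: measurable_funM => //.
by apply: (measurableT_comp (measurable_powR _)); apply: measurable_funX.
Qed.

Lemma measurable_sqrt : measurable_fun setT (@Num.sqrt R).
Proof.
(* [Num.sqrt] vanishes on negative numbers, which the maximum reproduces. *)
have -> : @Num.sqrt R = (fun x => Num.max x 0 `^ 2^-1).
  apply/funext => x; rewrite powR12_sqrt ?le_max ?lexx ?orbT//.
  by have [x0|x0] := leP x 0 => //; rewrite ler0_sqrtr// sqrtr0.
apply: (measurableT_comp (measurable_powR _)).
exact: measurable_maxr.
Qed.

Lemma measurable_powR_comp d (T : measurableType d) (g : T -> R) a :
  measurable_fun setT g -> measurable_fun setT (fun x => g x `^ a).
Proof. exact: (measurableT_comp (measurable_powR a)). Qed.

End measurable_operations.

Ltac measurability := repeat first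
  [ assumption | exact: measurable_cst | exact: measurable_id
  | apply: measurable_funM | apply: measurable_funB | apply: measurable_funD
  | apply: measurable_funN
  | apply: measurable_funX | apply: (measurableT_comp measurable_inv)
  | apply: (measurableT_comp (@measurable_expR _))
  | apply: (measurableT_comp measurable_sqrt)
  | apply: measurable_powR_comp ].

(** * Gaussian integrals and the semigroup property in dimension one *)

Section gaussian_integrals.
Context {R : realType}.
Local Notation mu := (@lebesgue_measure R).

(** Up to a constant the integrand is the normal density of variance [1 / (2 a)], of total mass
    1. *)
Lemma integral_gaussian (a m : R) : 0 < a ->
  (\int[mu]_x (expR (- (a * (x - m) ^+ 2)))%:E = (Num.sqrt (pi / a))%:E)%E.
Proof.
move=> a0.
pose s := Num.sqrt ((2 * a)^-1).
have a20 : 0 < (2 * a)^-1 by rewrite invr_gt0 mulr_gt0.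
have s0 : s != 0 by rewrite gt_eqF// sqrtr_gt0.
have s2 : s ^+ 2 = (2 * a)^-1 by rewrite sqr_sqrtr// ltW.
have an0 : a != 0 by rewrite gt_eqF.
have E x : expR (- (a * (x - m) ^+ 2)) = Num.sqrt (pi / a) * normal_pdf m s x.
  rewrite normal_pdfE// /normal_peak /normal_fun s2.
  have -> : (2 * a)^-1 * pi *+ 2 = pi / a by rewrite -mulr_natr; field.
  rewrite mulVKf; last by rewrite gt_eqF// sqrtr_gt0 divr_gt0// pi_gt0.
  by congr expR; rewrite -mulr_natr; field.
under eq_integral do rewrite E EFinM.
rewrite ge0_integralZl_EFin//.
- by rewrite integral_normal_pdf mule1.
- by move=> x _; rewrite lee_fin normal_pdf_ge0.
- by apply/measurable_EFinP; exact: measurable_normal_pdf.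
Qed.

Lemma integral_gaussian2 (a b m k : R) : 0 < a + b ->
  (\int[mu]_x (expR (- (a * (x - m) ^+ 2)) * expR (- (b * (x - k) ^+ 2)))%:E =
   (Num.sqrt (pi / (a + b)) * expR (- (a * b / (a + b) * (m - k) ^+ 2)))%:E)%E.
Proof.
move=> ab; have abn0 : a + b != 0 by rewrite gt_eqF.
(* The square is completed at the weighted mean of [m] and [k]. *)
have E x : expR (- (a * (x - m) ^+ 2)) * expR (- (b * (x - k) ^+ 2)) =
    expR (- (a * b / (a + b) * (m - k) ^+ 2)) *
    expR (- ((a + b) * (x - (a * m + b * k) / (a + b)) ^+ 2)).
  by rewrite -!expRD; congr expR; field.
under eq_integral do rewrite E EFinM.
rewrite ge0_integralZl_EFin//.
- by rewrite integral_gaussian// -EFinM mulrC.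
- apply/measurable_EFinP; apply: measurableT_comp => //.
  by apply: measurableT_comp => //; apply: measurable_funM => //;
    apply: measurable_funX; exact: measurable_funB.
Qed.

(** The kernel is a product of these over the coordinates, which reduces its semigroup property to
    scalars. *)
Definition kolmogorov1 (c t x y x' y' : R) : R :=
  c * Num.sqrt 3 / (2 * pi * t ^+ 2) *
  expR (- c * ((x' - x) ^+ 2 / (4 * t) +
    3 * ((y' - y - t / 2 * (x + x')) ^+ 2 / t ^+ 3))).

Lemma kolmogorov1_ge0 c t x y x' y' : 0 <= c -> 0 <= kolmogorov1 c t x y x' y'.
Proof.
move=> c0; rewrite mulr_ge0 ?expR_ge0// divr_ge0//.
  by rewrite mulr_ge0// sqrtr_ge0.
by rewrite mulr_ge0 ?sqr_ge0// mulr_ge0// pi_ge0.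
Qed.

(** The position is integrated first: for a fixed intermediate velocity [w] both factors are
    Gaussian in [z], with variances proportional to [s^3] and [r^3], and the variances add up. *)
Lemma integral_kolmogorov1_y c s r x y w x' y' : 0 < c -> 0 < s -> 0 < r ->
  (\int[mu]_z (kolmogorov1 c s x y w z * kolmogorov1 c r w z x' y')%:E =
  (c * Num.sqrt 3 / (2 * pi * s ^+ 2) * (c * Num.sqrt 3 / (2 * pi * r ^+ 2)) *
   Num.sqrt (pi / (3 * c / s ^+ 3 + 3 * c / r ^+ 3)) *
   expR (- c * ((w - x) ^+ 2 / (4 * s) + (x' - w) ^+ 2 / (4 * r) +
     3 / (s ^+ 3 + r ^+ 3) *
     (y' - y - s / 2 * (x + w) - r / 2 * (w + x')) ^+ 2)))%:E)%E.
Proof.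
move=> c0 s0 r0.
have sn0 : s != 0 by rewrite gt_eqF. have rn0 : r != 0 by rewrite gt_eqF.
have cn0 : c != 0 by rewrite gt_eqF.
have s30 : 0 < s ^+ 3 by rewrite exprn_gt0.
have r30 : 0 < r ^+ 3 by rewrite exprn_gt0.
have srn0 : s ^+ 3 + r ^+ 3 != 0 by rewrite gt_eqF// addr_gt0.
have al0 : 0 < 3 * c / s ^+ 3 by rewrite divr_gt0// mulr_gt0.
have be0 : 0 < 3 * c / r ^+ 3 by rewrite divr_gt0// mulr_gt0.
have E z : kolmogorov1 c s x y w z * kolmogorov1 c r w z x' y' =
    c * Num.sqrt 3 / (2 * pi * s ^+ 2) * (c * Num.sqrt 3 / (2 * pi * r ^+ 2)) *
    expR (- c * ((w - x) ^+ 2 / (4 * s) + (x' - w) ^+ 2 / (4 * r))) *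
    (expR (- (3 * c / s ^+ 3 * (z - (y + s / 2 * (x + w))) ^+ 2)) *
     expR (- (3 * c / r ^+ 3 * (z - (y' - r / 2 * (w + x'))) ^+ 2))).
  rewrite /kolmogorov1 mulrACA -[RHS]mulrA; congr (_ * _).
  rewrite -!expRD; congr expR; by field; rewrite sn0 rn0.
under eq_integral do rewrite E EFinM.
rewrite ge0_integralZl_EFin//; last first.
- by rewrite mulr_ge0 ?expR_ge0// mulr_ge0// divr_ge0 ?mulr_ge0 ?sqrtr_ge0 ?pi_ge0 ?exprn_ge0// ltW.
- apply/measurable_EFinP; apply: measurable_funM; apply: measurableT_comp => //;
  by apply: measurableT_comp => //; apply: measurable_funM => //;
    apply: measurable_funX; exact: measurable_funB.
rewrite integral_gaussian2 ?addr_gt0// -EFinM; congr EFin.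
rewrite mulrACA; congr (_ * _); rewrite -expRD; congr expR.
have -> : 3 * c / s ^+ 3 + 3 * c / r ^+ 3 =
    3 * c * (s ^+ 3 + r ^+ 3) / (s ^+ 3 * r ^+ 3) by field; rewrite sn0 rn0.
by field; rewrite sn0 rn0 cn0 srn0.
Qed.


Lemma measurable_kolmogorov1 d (T : measurableType d) c (t x y x' y' : T -> R) :
  measurable_fun setT t -> measurable_fun setT x -> measurable_fun setT y ->
  measurable_fun setT x' -> measurable_fun setT y' ->
  measurable_fun setT
    (fun w => kolmogorov1 c (t w) (x w) (y w) (x' w) (y' w)).
Proof.
move=> mt mx my mx' my'; rewrite /kolmogorov1; by measurability.
Qed.

Lemma kolmogorov1_semigroup c s r x y x' y' : 0 < c -> 0 < s -> 0 < r ->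
  (\int[mu]_w \int[mu]_z
    (kolmogorov1 c s x y w z * kolmogorov1 c r w z x' y')%:E =
  (kolmogorov1 c (s + r) x y x' y')%:E)%E.
Proof.
move=> c0 s0 r0.
under eq_integral do rewrite integral_kolmogorov1_y//.
have sn0 : s != 0 by rewrite gt_eqF. have rn0 : r != 0 by rewrite gt_eqF.
have cn0 : c != 0 by rewrite gt_eqF.
have s30 : 0 < s ^+ 3 by rewrite exprn_gt0.
have r30 : 0 < r ^+ 3 by rewrite exprn_gt0.
have srn0 : s ^+ 3 + r ^+ 3 != 0 by rewrite gt_eqF// addr_gt0.
have srn0' : s + r != 0 by rewrite gt_eqF// addr_gt0.
have q0 : 0 < s ^+ 2 - s * r + r ^+ 2.
  rewrite (_ : _ - _ + _ = (s - r) ^+ 2 + s * r); last by ring.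
  by rewrite ltr_wpDl ?sqr_ge0// mulr_gt0.
have qn0 : s ^+ 2 - s * r + r ^+ 2 != 0 by rewrite gt_eqF.
have srE : s ^+ 3 + r ^+ 3 = (s + r) * (s ^+ 2 - s * r + r ^+ 2) by ring.
(* What remains is Gaussian in the intermediate velocity: [a] is the coefficient of its square,
   simplified by [srE], and [m] is the vertex. *)
pose a := (s + r) ^+ 3 / (4 * s * r * (s ^+ 2 - s * r + r ^+ 2)).
have sr0 : 0 < s + r by rewrite addr_gt0.
have a0 : 0 < a by rewrite divr_gt0 ?mulr_gt0 ?exprn_gt0.
pose D := y' - y - (s + r) * x - r / 2 * (x' - x).
pose b := (x' - x) / (2 * r) + 3 * D / (s ^+ 2 - s * r + r ^+ 2).
pose m := x + b / (2 * a).
(* Completion of the square in coordinates centred at the start: [X = w - x], [Z = x' - x], and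
   [F = D], the position displacement corrected for transport. *)
have sq (X Z F : R) : X ^+ 2 / (4 * s) + (Z - X) ^+ 2 / (4 * r) +
    3 / (s ^+ 3 + r ^+ 3) * (F - (s + r) / 2 * X) ^+ 2 =
    Z ^+ 2 / (4 * (s + r)) + 3 * ((F - s / 2 * Z) ^+ 2 / (s + r) ^+ 3) +
    a * (X - (Z / (2 * r) + 3 * F / (s ^+ 2 - s * r + r ^+ 2)) / (2 * a)) ^+ 2.
  by rewrite srE /a; field; rewrite ?sn0 ?rn0 ?srn0' ?qn0.
have E w : expR (- c * ((w - x) ^+ 2 / (4 * s) + (x' - w) ^+ 2 / (4 * r) +
     3 / (s ^+ 3 + r ^+ 3) *
     (y' - y - s / 2 * (x + w) - r / 2 * (w + x')) ^+ 2)) =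
   expR (- c * ((x' - x) ^+ 2 / (4 * (s + r)) +
    3 * ((y' - y - (s + r) / 2 * (x + x')) ^+ 2 / (s + r) ^+ 3))) *
   expR (- (c * a * (w - m) ^+ 2)).
  rewrite -expRD (_ : - (c * a * _) = - c * (a * (w - m) ^+ 2)); last by ring.
  rewrite -mulrDr; congr (expR (_ * _)).
  have -> : x' - w = x' - x - (w - x) by ring.
  have -> : y' - y - s / 2 * (x + w) - r / 2 * (w + x') =
    D - (s + r) / 2 * (w - x) by rewrite /D; field.
  rewrite sq; congr (_ + 3 * (_ ^+ 2 / _) + _); first by rewrite /D; field.
  by congr (_ * _ ^+ 2); rewrite /m opprD addrA.
under eq_integral do rewrite E [_ * (_ * expR (- (_ * (_ - m) ^+ 2)))]mulrA EFinM.
rewrite ge0_integralZl_EFin//; last 2 first.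
- by apply/measurable_EFinP; measurability.
- rewrite mulr_ge0 ?expR_ge0// mulr_ge0 ?sqrtr_ge0//.
  by rewrite mulr_ge0// divr_ge0 ?mulr_ge0 ?sqrtr_ge0 ?pi_ge0 ?exprn_ge0// ltW.
rewrite (integral_gaussian m (mulr_gt0 c0 a0)) -EFinM; congr EFin.
rewrite /kolmogorov1 mulrAC; congr (_ * _).
have pin0 : pi != 0 :> R by rewrite gt_eqF// pi_gt0.
(* The root of 3 becomes a variable with [s3 ^+ 2 = 3], which [field] can handle; the product of the
   two Gaussian normalisations is then a perfect square and its root disappears. *)
have [s3 s3E] : exists s3, s3 = Num.sqrt (3 : R) by eexists.
have s32 : s3 ^+ 2 = 3 by rewrite s3E sqr_sqrtr.
have s3n0 : s3 != 0 by rewrite s3E gt_eqF// sqrtr_gt0.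
rewrite -s3E -[X in X = _]mulrA -sqrtrM; last first.
  by rewrite divr_ge0 ?pi_ge0// ltW// addr_gt0// divr_gt0// mulr_gt0.
have -> : pi / (3 * c / s ^+ 3 + 3 * c / r ^+ 3) * (pi / (c * a)) =
    (2 * pi * (s * r) ^+ 2 / (s3 * c * (s + r) ^+ 2)) ^+ 2.
  have -> : 3 * c / s ^+ 3 + 3 * c / r ^+ 3 =
      3 * c * (s ^+ 3 + r ^+ 3) / (s ^+ 3 * r ^+ 3).
    by field; rewrite sn0 rn0.
  by rewrite srE /a -s32; field; rewrite sn0 rn0 cn0 srn0' s3n0 qn0 ?pin0.
rewrite sqrtr_sqr ger0_norm; last first.
  by rewrite divr_ge0 ?mulr_ge0 ?pi_ge0 ?exprn_ge0 ?addr_ge0 ?mulr_ge0 ?ltW// s3E sqrtr_gt0.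
clear - sn0 rn0 cn0 srn0' s3n0 pin0; move: (pi : R) pin0 => p pn0.
by field; rewrite sn0 rn0 cn0 srn0' s3n0 pn0.
Qed.

End gaussian_integrals.

(** * Integrals of product functions over column vectors *)

Section product_integral.
Context {R : realType}.

Lemma measurable_cV_coord n (i : 'I_n) :
  measurable_fun [set: 'cV[R]_n] (fun v : 'cV[R]_n => v i ord0).
Proof. exact: measurable_mx_entry. Qed.

Lemma measurable_cV_prod n (f : 'I_n -> R -> R) :
  (forall i, measurable_fun setT (f i)) ->
  measurable_fun setT (fun v : 'cV[R]_n => \prod_(i < n) f i (v i ord0)).
Proof.
move=> mf; apply: measurable_prod => i _.
exact: (measurableT_comp (mf i) (measurable_cV_coord i)).
Qed.

(** Induction along the construction of [lebesgue_cV]: the integral is pulled back along [cV_cons]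
    and Tonelli splits off the first coordinate. In dimension 0 the measure is a Dirac mass and the
    product is empty. *)
Lemma integral_lebesgue_cV_prod n (f : 'I_n -> R -> R) (I : 'I_n -> R) :
  (forall i, measurable_fun setT (f i)) -> (forall i x, 0 <= f i x) ->
  (forall i, (\int[lebesgue_measure]_x (f i x)%:E = (I i)%:E)%E) ->
  (\int[lebesgue_cV n]_v (\prod_(i < n) f i (v i ord0))%:E =
   (\prod_(i < n) I i)%:E)%E.
Proof.
elim: n f I => [|n IH] f I mf f0 fI.
  rewrite /= integral_dirac//; last first.
    by apply/measurable_EFinP; exact: measurable_cV_prod.
  by rewrite diracT mul1e !big_ord0.
rewrite /= [LHS](@ge0_integral_pushforward _ _ _ _ _ _ (@measurable_cV_cons R n))//=; last 2 first.
- by apply/measurable_EFinP; exact: measurable_cV_prod.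
- by move=> v _; rewrite lee_fin prodr_ge0.
have mF : measurable_fun setT (fun p : measurableTypeR R * 'cV[R]_n =>
    (\prod_(i < n.+1) f i (cV_cons p i ord0))%:E).
  apply/measurable_EFinP.
  apply: (measurableT_comp (measurable_cV_prod mf)).
  exact: measurable_cV_cons.
rewrite preimage_setT fubini_tonelli1//=; last first.
  by move=> p; rewrite lee_fin prodr_ge0.
rewrite /fubini_F/=.
under eq_integral => x _.
  under eq_integral => v _.
    rewrite big_ord_recl cV_cons0/=.
    under eq_bigr do rewrite cV_consS/=.
    rewrite EFinM; over.
  rewrite ge0_integralZl_EFin//; last 2 first.
  - by move=> v _; rewrite lee_fin prodr_ge0.
  - apply/measurable_EFinP.
    exact: (@measurable_cV_prod n (fun i => f (lift ord0 i))).
  rewrite (IH (fun i => f (lift ord0 i)) (fun i => I (lift ord0 i)))//.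
  rewrite muleC; over.
rewrite ge0_integralZl_EFin//; last 3 first.
- by move=> v _; rewrite lee_fin.
- by apply/measurable_EFinP; exact: (mf ord0).
- apply: prodr_ge0 => i _; rewrite -lee_fin -fI.
  by apply: integral_ge0 => x _; rewrite lee_fin.
by rewrite fI -EFinM mulrC big_ord_recl.
Qed.

End product_integral.

Section kolmogorov.
Context {R : realType} {d : nat}.
Local Notation V := ('cV[R]_d * 'cV[R]_d)%type.
Implicit Types (z w : V) (c s r t : R).

Lemma mx_enorm_sqr m n (A : 'M[R]_(m, n)) :
  mx_enorm A ^+ 2 = \sum_i \sum_j A i j ^+ 2.
Proof.
by rewrite sqr_sqrtr// sumr_ge0// => i _; rewrite sumr_ge0// => j _; exact: sqr_ge0.
Qed.

Lemma cV_enorm_sqr n (A : 'cV[R]_n) : mx_enorm A ^+ 2 = \sum_i A i ord0 ^+ 2.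
Proof. by rewrite mx_enorm_sqr; under eq_bigr do rewrite big_ord1. Qed.

Lemma kolmogorov_density_prod c t z w :
  kolmogorov_density c t z w = \prod_(i < d) kolmogorov1 c t
    (z.1 i ord0) (z.2 i ord0) (w.1 i ord0) (w.2 i ord0).
Proof.
rewrite /kolmogorov_density /kolmogorov1 big_split/= -expR_sum; congr (_ * expR _).
- rewrite prodr_const card_ord expr_div_n [(c * _) ^+ d]exprMn; congr (_ * _ / _).
  by rewrite mulrC powRrM powR_mulrn ?powR_ge0// powR12_sqrt.
- rewrite -mulr_sumr big_split/= !cV_enorm_sqr; congr (_ * (_ + _)).
    by rewrite mulr_suml; apply: eq_bigr => i _; rewrite !mxE.
  rewrite -mulr_sumr mulr_suml; congr (_ * _); apply: eq_bigr => i _.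
  by rewrite !mxE.
Qed.

Lemma kolmogorov_density_gt0 c t z w : 0 < c -> t != 0 ->
  0 < kolmogorov_density c t z w.
Proof.
move=> c0 t0; rewrite mulr_gt0 ?expR_gt0// divr_gt0// ?mulr_gt0 ?powR_gt0 ?exprn_gt0//.
by rewrite mulr_gt0 ?exprn_even_gt0// mulr_gt0// pi_gt0.
Qed.

Lemma kolmogorov_density_ge0 c t z w : 0 < c -> 0 <= kolmogorov_density c t z w.
Proof.
by move=> c0; rewrite kolmogorov_density_prod prodr_ge0// => i _;
  rewrite kolmogorov1_ge0// ltW.
Qed.

Lemma measurable_kolmogorov_density dT (T : measurableType dT) c
    (t : T -> R) (z w : T -> V) :
  measurable_fun setT t -> measurable_fun setT z -> measurable_fun setT w ->
  measurable_fun setT (fun x => kolmogorov_density c (t x) (z x) (w x)).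
Proof.
move=> mt mz mw.
under eq_fun do rewrite kolmogorov_density_prod.
have m1 i (u : T -> V) : measurable_fun setT u ->
    measurable_fun setT (fun x => (u x).1 i ord0).
  move=> mu; apply: (measurableT_comp (measurable_cV_coord i)).
  exact: (measurableT_comp measurable_fst).
have m2 i (u : T -> V) : measurable_fun setT u ->
    measurable_fun setT (fun x => (u x).2 i ord0).
  move=> mu; apply: (measurableT_comp (measurable_cV_coord i)).
  exact: (measurableT_comp measurable_snd).
apply: measurable_prod => i _.
by apply: measurable_kolmogorov1 => //; first [exact: m1|exact: m2].
Qed.

Lemma integral_leb2E (f : V -> \bar R) :
  measurable_fun setT f -> (forall w, 0 <= f w)%E ->
  (\int[leb2]_w f w = \int[lebesgue_cV d]_x \int[lebesgue_cV d]_y f (x, y))%E.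
Proof. by move=> mf f0; rewrite [LHS]fubini_tonelli1. Qed.

Lemma kolmogorov_density_semigroup c s t z z' : 0 < c -> 0 < s -> s < t ->
  (\int[leb2]_w
     (kolmogorov_density c s z w * kolmogorov_density c (t - s) w z')%:E
   = (kolmogorov_density c t z z')%:E)%E.
Proof.
move=> c0 s0 st; have ts0 : 0 < t - s by rewrite subr_gt0.

rewrite integral_leb2E; last 2 first.
- apply/measurable_EFinP; apply: measurable_funM;
  apply: measurable_kolmogorov_density => //.
- by move=> w; rewrite lee_fin mulr_ge0// kolmogorov_density_ge0.
(* [k] is the integrand of one coordinate and [g] its integral over the position; the closed form of
   that integral makes [g] finite and measurable. *)
pose k i (w x : R) := kolmogorov1 c s (z.1 i ord0) (z.2 i ord0) w x *
  kolmogorov1 c (t - s) w x (z'.1 i ord0) (z'.2 i ord0).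
have k0 i u x : 0 <= k i u x by rewrite mulr_ge0// kolmogorov1_ge0// ltW.
have mk1 i u : measurable_fun setT (k i u).
  by apply: measurable_funM; apply: measurable_kolmogorov1 => //.
pose g i u := fine (\int[lebesgue_measure]_x (k i u x)%:E)%E.
have gE i u : (\int[lebesgue_measure]_x (k i u x)%:E)%E = (g i u)%:E.
  by rewrite /g /k integral_kolmogorov1_y.
have mg i : measurable_fun setT (g i).
  rewrite /g /k; under eq_fun do rewrite integral_kolmogorov1_y//=.
  by measurability.
have -> : kolmogorov_density c t z z' = \prod_(i < d)
    kolmogorov1 c t (z.1 i ord0) (z.2 i ord0) (z'.1 i ord0) (z'.2 i ord0).
  exact: kolmogorov_density_prod.
rewrite -(@integral_lebesgue_cV_prod _ d g)//; last 2 first.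
- by move=> i x; rewrite fine_ge0// integral_ge0// => u _; rewrite lee_fin.
- move=> i; under eq_integral do rewrite -gE.
  by rewrite kolmogorov1_semigroup// addrC subrK.
apply: eq_integral => x _.
rewrite -(@integral_lebesgue_cV_prod _ d (fun i => k i (x i ord0)))//.
by apply: eq_integral => y _; rewrite !kolmogorov_density_prod -big_split.
Qed.

End kolmogorov.

(** * Singular time integrals *)

Section time_integrals.
Context {R : realType}.
Local Notation mu := (@lebesgue_measure R).
Implicit Types a b t : R.

(** The integrand may blow up at both ends, so the fundamental theorem is applied on compact
    intervals exhausting the open one. Monotonicity of [F] bounds each value, and monotone
    convergence passes to the limit. *)
Lemma integral_oo_le (f F : R -> R) t : 0 < t ->
  measurable_fun `]0, t[%classic f ->
  (forall x, 0 < x < t -> 0 <= f x) ->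
  (forall x, 0 < x < t -> {for x, continuous f}) ->
  (forall x, 0 < x < t -> is_derive x 1 F (f x)) ->
  (forall x y, 0 <= x -> x <= y -> y <= t -> F x <= F y) ->
  (\int[mu]_(x in `]0%R, t[%classic) (f x)%:E <= (F t - F 0)%:E)%E.
Proof.
move=> t0 mf f0 cf dF Fmono.
(* The shift to [n.+3] gives [e n < t - e n] from the first index on. *)
pose e (n : nat) : R := t / (n.+3)%:R.
have e0 n : 0 < e n by rewrite divr_gt0.
have et n : e n < t - e n.
  rewrite ltrBrDr /e -mulrDl ltr_pdivrMr// -mulr2n -[_ *+ 2]mulr_natr.
  by rewrite ltr_pM2l// ltr_nat.
pose A (n : nat) : set R := `[e n, t - e n]%classic.
have eA : \bigcup_n A n = `]0, t[%classic.
  apply/seteqP; split => x /=.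
    move=> [n _]; rewrite /A /= !in_itv/= => /andP[x1 x2].
    by rewrite (lt_le_trans (e0 n) x1) (le_lt_trans x2)// ltrBlDr ltrDl.
  rewrite in_itv/= => /andP[x0 xt].
  pose m := Num.min x (t - x).
  have m0 : 0 < m by rewrite lt_min x0 subr_gt0.
  pose n := Num.truncn (t / m).
  have nm : e n <= m.
    rewrite /e ler_pdivrMr// mulrC -ler_pdivrMr//.
    by rewrite ltW// (lt_le_trans (truncnS_gt _))// ler_nat ltnS !leqW.
  exists n => //; rewrite /A/= in_itv/=; apply/andP; split.
    by rewrite (le_trans nm)// ge_min lexx.
  by rewrite lerBrDr -lerBrDl (le_trans nm)// ge_min lexx orbT.
have ndA : nondecreasing_seq A.
  move=> m n mn; rewrite subsetEset /A => x /=; rewrite !in_itv/=.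
  have enm : e n <= e m by rewrite ler_pM2l// lef_pV2 ?posrE// ler_nat.
  by move=> /andP[x1 x2]; rewrite (le_trans enm)//= (le_trans x2)// lerB.
have AS n : A n `<=` `]0, t[%classic by rewrite -eA; exact: bigcup_sup.
have cvgA : (\int[mu]_(x in A n) (f x)%:E)%E @[n --> \oo] -->
    (\int[mu]_(x in \bigcup_n A n) (f x)%:E)%E.
  apply: ge0_nondecreasing_set_cvg_integral => //.
  - by move=> n; exact: measurable_itv.
  - move=> n; apply/measurable_EFinP; exact: measurable_funS (AS n) mf.
  - by move=> n x /AS /=; rewrite in_itv/= lee_fin => /f0.
rewrite -eA; move/cvg_lim : (cvgA) => <- //.
apply: lime_le; first by apply/cvg_ex; eexists; exact: cvgA.
apply: nearW => n.
have inA x : e n <= x <= t - e n -> 0 < x < t.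
  move=> xA; have := AS n x; rewrite /A /= !in_itv/=; exact.
have dxF x : e n <= x <= t - e n -> {for x, continuous F}.
  move=> /inA /dF dFx; apply/differentiable_continuous.
  by apply/derivable1_diffP; exact: ex_derive.
have ee : e n <= e n <= t - e n by rewrite lexx ltW.
have ete : e n <= t - e n <= t - e n by rewrite lexx ltW.
rewrite /A (@continuous_FTC2 _ f F)//.
- rewrite -EFinB lee_fin lerB// Fmono//.
  + by rewrite ltW// (lt_trans (e0 n)).
  + by rewrite lerBlDr lerDl ltW.
  + by rewrite ltW.
  + by rewrite ltW// (lt_trans (et n))// ltrBlDr ltrDl.
- apply/continuous_within_itvP => //; split.
  + move=> x; rewrite in_itv/= => /andP[x1 x2].
    by apply: cf; apply: inA; rewrite !ltW.
  + by apply: cvg_at_right_filter; apply: cf; exact: inA.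
  + by apply: cvg_at_left_filter; apply: cf; exact: inA.
- split.
  + move=> x; rewrite in_itv/= => /andP[x1 x2].
    have /inA/dF dFx : e n <= x <= t - e n by rewrite !ltW.
    exact: ex_derive.
  + by apply: cvg_at_right_filter; exact: dxF.
  + by apply: cvg_at_left_filter; exact: dxF.
- move=> x; rewrite in_itv/= => /andP[x1 x2].
  have /inA/dF dFx : e n <= x <= t - e n by rewrite !ltW.
  by rewrite derive1E; exact: derive_val.
Qed.

Lemma integral_powR a t : 0 < a -> 0 < t ->
  (\int[mu]_(u in `]0%R, t[%classic) (u `^ (a - 1))%:E <= (t `^ a / a)%:E)%E.
Proof.
move=> a0 t0; pose F x := x `^ a / a.
have F0 : F 0 = 0 by rewrite /F powR0 ?mul0r// gt_eqF.
have -> : t `^ a / a = F t - F 0 by rewrite F0 subr0.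
have dF x : 0 < x < t -> is_derive x 1 F (x `^ (a - 1)).
  move=> /andP[x0 _]; rewrite /F.
  have dp := is_derive1_powR a x0.
  apply: is_derive_eq.
  by rewrite scaler0 add0r /GRing.scale/=; field; rewrite gt_eqF.
apply: integral_oo_le => //.
- by apply: measurable_funTS; exact: measurable_powR.
- by move=> x _; exact: powR_ge0.
- move=> x /andP[x0 xt]; apply/differentiable_continuous/derivable1_diffP.
  by apply: derivable_powR; rewrite in_itv/= x0.
- move=> x y x0 xy yt; rewrite /F ler_pM2r ?invr_gt0//.
  by apply: ge0_ler_powR; rewrite ?nnegrE// ?(ltW a0)// (le_trans x0).
Qed.

Lemma integral_powR_rev a t : 0 < a -> 0 < t ->
  (\int[mu]_(u in `]0%R, t[%classic) ((t - u) `^ (a - 1))%:E <= (t `^ a / a)%:E)%E.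
Proof.
move=> a0 t0; pose F x := - ((t - x) `^ a / a).
have Ft : F t = 0 by rewrite /F subrr powR0 ?mul0r ?oppr0// gt_eqF.
have -> : t `^ a / a = F t - F 0 by rewrite Ft sub0r /F opprK subr0.
have dF x : 0 < x < t -> is_derive x 1 F ((t - x) `^ (a - 1)).
  move=> /andP[x0 xt]; rewrite /F.
  have tx : 0 < t - x by rewrite subr_gt0.
  have dp := is_derive1_powR a tx.
  have dl : is_derive x 1 (fun y : R => t - y) (-1).
    by have := is_deriveB (is_derive_cst t x 1) (is_derive_id x 1); rewrite sub0r.
  have dc : is_derive x 1 (fun y => (t - y) `^ a) _ :=
    @is_derive1_comp _ (fun y => y `^ a) (fun y => t - y) x _ _ dp dl.
  apply: is_derive_eq.
  by rewrite scaler0 add0r /GRing.scale/=; field; rewrite gt_eqF.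
apply: integral_oo_le => //.
- apply: measurable_funTS; apply: measurable_powR_comp.
  exact: measurable_funB.
- by move=> x _; exact: powR_ge0.
- move=> x /andP[x0 xt].
  apply: (@continuous_comp _ _ _ (fun y => t - y) (fun y => y `^ (a - 1))).
    by apply: cvgB; [exact: cvg_cst|exact: cvg_id].
  apply/differentiable_continuous/derivable1_diffP.
  by apply: derivable_powR; rewrite in_itv/= subr_gt0 xt.
- move=> x y x0 xy yt; rewrite /F lerN2 ler_pM2r ?invr_gt0//.
  by apply: ge0_ler_powR; rewrite ?nnegrE ?subr_ge0 ?lerB// ?(ltW a0)// (le_trans xy).
Qed.

Lemma powR_antitone (x y e : R) : 0 < x -> x <= y -> e <= 0 -> y `^ e <= x `^ e.
Proof.
move=> x0 xy e0; have y0 : 0 < y by exact: lt_le_trans xy.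
have -> : e = - (- e) by rewrite opprK.
rewrite ![_ `^ - (- e)]powRN lef_pV2 ?posrE ?powR_gt0//.
by apply: ge0_ler_powR; rewrite ?oppr_ge0// nnegrE ltW.
Qed.

Lemma powR_halve (a b t : R) : 0 < a <= 1 -> 0 < b -> 0 < t ->
  (t / 2) `^ (a - 1) * (t `^ b / b) <= 2 / b * t `^ (a + b - 1).
Proof.
move=> /andP[a0 a1] b0 t0.
have -> : (t / 2) `^ (a - 1) * (t `^ b / b) =
    (2^-1 `^ (a - 1)) / b * t `^ (a + b - 1).
  rewrite powRM ?invr_ge0 ?(ltW t0)// addrAC [t `^ (a - 1 + b)]powRD; last by rewrite (gt_eqF t0) implybT.
  by field; rewrite gt_eqF.
rewrite ler_wpM2r ?powR_ge0// ler_pM2r ?invr_gt0//.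
rewrite -[2^-1]powR_inv1// -powRrM -[leRHS]powRr1// ler_powR//; first by rewrite ler1n.
by rewrite mulN1r opprB lerBlDr lerDl ltW.
Qed.

(** On each half of the interval one of the two factors is at most its value at [t / 2]; adding both
    bounds avoids cutting the domain. *)
Lemma integral_beta_le (a b t : R) : 0 < a <= 1 -> 0 < b <= 1 -> 0 < t ->
  (\int[mu]_(u in `]0%R, t[%classic) (u `^ (a - 1) * (t - u) `^ (b - 1))%:E <=
   ((2 / a + 2 / b) * t `^ (a + b - 1))%:E)%E.
Proof.
move=> a01 b01 t0; have [a0 a1] := andP a01; have [b0 b1] := andP b01.
have mpr e : measurable_fun setT (fun u : R => (t - u) `^ e).
  by apply: measurable_powR_comp; exact: measurable_funB.
have mp e : measurable_fun setT (fun u : R => u `^ e).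
  exact: measurable_powR.
apply: (@le_trans _ _ (\int[mu]_(u in `]0%R, t[%classic)
  (((t / 2) `^ (a - 1))%:E * ((t - u) `^ (b - 1))%:E +
  ((t / 2) `^ (b - 1))%:E * (u `^ (a - 1))%:E))%E).
  apply: ge0_le_integral => //.
  - by move=> u _; rewrite lee_fin mulr_ge0 ?powR_ge0.
  - apply: measurable_funTS; apply/measurable_EFinP.
    by measurability.
  - apply: measurable_funTS; apply: emeasurable_funD;
    by apply/measurable_EFinP; measurability.
  - move=> u /=; rewrite in_itv/= => /andP[u0 ut].
    rewrite -!EFinM -EFinD lee_fin.
    have [tu|tu] := leP (t / 2) u.
      rewrite ler_wpDr ?mulr_ge0 ?powR_ge0// ler_wpM2r ?powR_ge0//.
      by apply: powR_antitone; rewrite ?divr_gt0// subr_le0.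
    rewrite ler_wpDl ?mulr_ge0 ?powR_ge0// mulrC ler_wpM2r ?powR_ge0//.
    apply: powR_antitone; rewrite ?divr_gt0// ?subr_le0//.
    by rewrite lerBrDr -lerBrDl (le_trans (ltW tu))// lerBrDl -splitr.
rewrite ge0_integralD//; last 4 first.
- by move=> u _; rewrite -EFinM lee_fin mulr_ge0 ?powR_ge0.
- by apply: measurable_funTS; apply/measurable_EFinP; measurability.
- by move=> u _; rewrite -EFinM lee_fin mulr_ge0 ?powR_ge0.
- by apply: measurable_funTS; apply/measurable_EFinP; measurability.
rewrite !ge0_integralZl_EFin ?powR_ge0//; last 4 first.
- by move=> u _; rewrite lee_fin powR_ge0.
- by apply: measurable_funTS; apply/measurable_EFinP; measurability.
- by move=> u _; rewrite lee_fin powR_ge0.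
- by apply: measurable_funTS; apply/measurable_EFinP; measurability.
rewrite [2 / a + _]addrC mulrDl EFinD; apply: leeD.
  apply: (@le_trans _ _ (((t / 2) `^ (a - 1))%:E * (t `^ b / b)%:E)%E).
    by apply: lee_wpmul2l; [rewrite lee_fin powR_ge0|exact: integral_powR_rev].
  by rewrite -EFinM lee_fin powR_halve.
apply: (@le_trans _ _ (((t / 2) `^ (b - 1))%:E * (t `^ a / a)%:E)%E).
  by apply: lee_wpmul2l; [rewrite lee_fin powR_ge0|exact: integral_powR].
by rewrite -EFinM lee_fin [a + b]addrC powR_halve.
Qed.

(** [x ^ a] is at most 1 or at most [x], hence below [1 + x <= expR x]. *)
Lemma expRN_le_powR (x a : R) : 0 < x -> 0 <= a <= 1 -> expR (- x) <= x `^ (- a).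
Proof.
move=> x0 /andP[a0 a1].
rewrite expRN powRN lef_pV2 ?posrE ?powR_gt0 ?expR_gt0//.
have ex : 1 + x <= expR x by exact: expR_ge1Dx.
have [x1|x1] := leP x 1.
  have xa : x `^ a <= 1 `^ a by rewrite ge0_ler_powR// nnegrE ltW.
  by rewrite powR1 in xa; rewrite (le_trans xa)// (le_trans _ ex)// lerDl ltW.
have xa : x `^ a <= x `^ 1 by apply: ler_powR => //; exact: ltW.
by rewrite (powRr1 (ltW x0)) in xa; rewrite (le_trans xa)// (le_trans _ ex)// lerDr.
Qed.

(* The weight [exp (- l u)] makes the singular kernel a contraction. *)
Lemma small_laplace (th T e : R) : 0 < th <= 1 -> 0 < T -> 0 < e ->
  exists2 l : R, 0 < l & forall t, 0 < t <= T ->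
    (\int[mu]_(u in `]0%R, t[%classic)
      (u `^ (th - 1) * expR (- (l * u)) * (t - u) `^ (th - 1))%:E <=
      (e * t `^ (th - 1))%:E)%E /\
    (\int[mu]_(u in `]0%R, t[%classic)
      (u `^ (th - 1) * expR (- (l * u)))%:E <= e%:E)%E.
Proof.
move=> th01 T0 e0; have [th0 th1] := andP th01.
have h0 : 0 < th / 2 by rewrite divr_gt0.
have h1 : th / 2 <= 1 by rewrite ler_pdivrMr// mul1r (le_trans th1)// ler1n.
pose B := 2 / (th / 2) + 2 / th.
have B0 : 0 < B by rewrite addr_gt0// divr_gt0.
pose M := T `^ (th / 2) * B.
have M0 : 0 < M by rewrite mulr_gt0// powR_gt0.
(* Half of the exponent [th] is traded for the small factor [l ^ (- th / 2) = e / M]; the other half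
   keeps the singularity at 0 integrable. [B] is the beta constant for the exponents [th / 2] and
   [th]. *)
pose l := (e / M) `^ (- (2 / th)).
have l0 : 0 < l by apply: powR_gt0; exact: divr_gt0.
have lE : l `^ (- (th / 2)) = e / M.
  rewrite -powRrM mulrNN (_ : 2 / th * (th / 2) = 1) ?powRr1 ?divr_ge0 ?ltW//.
  by field; rewrite gt_eqF.
have lu u : 0 < u -> u `^ (th - 1) * expR (- (l * u)) <=
    e / M * u `^ (th / 2 - 1).
  move=> u0; rewrite -lE; apply: (@le_trans _ _ (u `^ (th - 1) * (l * u) `^ (- (th / 2)))).
    by rewrite ler_wpM2l ?powR_ge0// expRN_le_powR ?mulr_gt0// h1 ltW.
  rewrite powRM ?(ltW u0) ?(ltW l0)// mulrCA -powRD; last by rewrite (gt_eqF u0) implybT.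
  by rewrite ler_wpM2l ?powR_ge0// (_ : _ + _ = th / 2 - 1)//; field.
exists l => // t /andP[t0 tT].
have tM x : 0 < x -> t `^ (th / 2) * x <= T `^ (th / 2) * x.
  by move=> x0; rewrite ler_pM2r// ge0_ler_powR ?nnegrE// ltW.
have mp a : measurable_fun setT (fun u : R => u `^ a).
  exact: measurable_powR.
have mpr a : measurable_fun setT (fun u : R => (t - u) `^ a).
  by apply: measurable_powR_comp; exact: measurable_funB.
have me : measurable_fun setT (fun u : R => expR (- (l * u))).
  by measurability.
split.
  apply: (@le_trans _ _ (\int[mu]_(u in `]0%R, t[%classic)
    ((e / M)%:E * (u `^ (th / 2 - 1) * (t - u) `^ (th - 1))%:E))%E).
    apply: ge0_le_integral => //.
    - by move=> u _; rewrite lee_fin !mulr_ge0 ?powR_ge0 ?expR_ge0.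
    - by apply: measurable_funTS; apply/measurable_EFinP; measurability.
    - by apply: measurable_funTS; apply/measurable_EFinP; measurability.
    - move=> u /=; rewrite in_itv/= => /andP[u0 ut].
      by rewrite -EFinM lee_fin mulrA ler_wpM2r ?powR_ge0// lu.
  rewrite ge0_integralZl_EFin//; last 3 first.
  - by move=> u _; rewrite lee_fin mulr_ge0 ?powR_ge0.
  - by apply: measurable_funTS; apply/measurable_EFinP; measurability.
  - by rewrite divr_ge0 ?ltW.
  apply: (@le_trans _ _ ((e / M)%:E * (B * t `^ (th / 2 + th - 1))%:E)%E).
    apply: lee_wpmul2l; first by rewrite lee_fin divr_ge0 ?ltW.
    by apply: integral_beta_le; rewrite ?h0.
  rewrite -EFinM lee_fin -addrA [t `^ (th / 2 + _)]powRD; last by rewrite (gt_eqF t0) implybT.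
  rewrite (_ : e / M * _ = e / M * (t `^ (th / 2) * (B * t `^ (th - 1)))); last by ring.
  apply: (@le_trans _ _ (e / M * (T `^ (th / 2) * (B * t `^ (th - 1))))).
    by rewrite ler_pM2l ?divr_gt0// tM// mulr_gt0// powR_gt0.
  by rewrite [T `^ _ * _]mulrA -/M mulrA divfK// gt_eqF.
apply: (@le_trans _ _ (\int[mu]_(u in `]0%R, t[%classic)
    ((e / M)%:E * (u `^ (th / 2 - 1))%:E))%E).
  apply: ge0_le_integral => //.
  - by move=> u _; rewrite lee_fin !mulr_ge0 ?powR_ge0 ?expR_ge0.
  - by apply: measurable_funTS; apply/measurable_EFinP; measurability.
  - by apply: measurable_funTS; apply/measurable_EFinP; measurability.
  - by move=> u /=; rewrite in_itv/= => /andP[u0 ut]; rewrite -EFinM lee_fin lu.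
rewrite ge0_integralZl_EFin//; last 3 first.
- by move=> u _; rewrite lee_fin powR_ge0.
- by apply: measurable_funTS; apply/measurable_EFinP; measurability.
- by rewrite divr_ge0 ?ltW.
apply: (@le_trans _ _ ((e / M)%:E * (t `^ (th / 2) / (th / 2))%:E)%E).
  apply: lee_wpmul2l; first by rewrite lee_fin divr_ge0 ?ltW.
  exact: integral_powR.
rewrite -EFinM lee_fin; apply: (@le_trans _ _ (e / M * (T `^ (th / 2) * B))).
  rewrite ler_pM2l ?divr_gt0//; apply: (le_trans (tM _ _)); first by rewrite invr_gt0.
  rewrite ler_pM2l ?powR_gt0// /B ler_wpDr ?divr_ge0 ?(ltW th0)//.
  by rewrite ler_peMl ?ler1n// invr_ge0 ltW.
by rewrite -/M divfK// gt_eqF.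
Qed.

End time_integrals.

(** * Convolution of kernels *)

Section measure_extras.
Context {R : realType}.

Lemma measurable_fst_comp d d1 d2 (T : measurableType d) (T1 : measurableType d1)
    (T2 : measurableType d2) (g : T -> T1 * T2) :
  measurable_fun setT g -> measurable_fun setT (fun x => (g x).1).
Proof. exact: (measurableT_comp measurable_fst). Qed.

Lemma measurable_snd_comp d d1 d2 (T : measurableType d) (T1 : measurableType d1)
    (T2 : measurableType d2) (g : T -> T1 * T2) :
  measurable_fun setT g -> measurable_fun setT (fun x => (g x).2).
Proof. exact: (measurableT_comp measurable_snd). Qed.

Lemma measurable_norm_comp d (T : measurableType d) (g : T -> R) :
  measurable_fun setT g -> measurable_fun setT (fun x => `|g x|).
Proof. exact: (measurableT_comp (@normr_measurable R setT)). Qed.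

(** The positive and negative parts are integrated separately, each measurable in the parameter by
    Tonelli, so no integrability enters. *)
Lemma measurable_integral dX dY (X : measurableType dX) (Y : measurableType dY)
    (m : {sigma_finite_measure set Y -> \bar R}) (f : X -> Y -> \bar R) :
  measurable_fun setT (fun p : X * Y => f p.1 p.2) ->
  measurable_fun setT (fun x => (\int[m]_y f x y)%E).
Proof.
move=> mf; pose F := fun p : X * Y => f p.1 p.2.
have -> : (fun x => (\int[m]_y f x y)%E) = (fun x =>
  (fubini_F m (F^\+)%E x - fubini_F m (F^\-)%E x)%E).
  apply/funext => x; rewrite integralE; congr (_ - _)%E;
    by apply: eq_integral => y _; rewrite ?funeposE ?funenegE.
apply: emeasurable_funB.
- by apply: measurable_fun_fubini_tonelli_F => //; exact: measurable_funepos.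
- by apply: measurable_fun_fubini_tonelli_F => //; exact: measurable_funeneg.
Qed.

Lemma measurable_Rintegral dX dY (X : measurableType dX) (Y : measurableType dY)
    (m : {sigma_finite_measure set Y -> \bar R}) (f : X -> Y -> R) :
  measurable_fun setT (fun p : X * Y => f p.1 p.2) ->
  measurable_fun setT (fun x => \int[m]_y f x y).
Proof.
move=> mf; apply: measurableT_comp => //; apply: measurable_integral.
exact/measurable_EFinP.
Qed.

Lemma patch_snd X Y (D : set Y) (f : X -> Y -> \bar R) :
  (fun p : X * Y => (f p.1 \_ D) p.2) = ((fun p => f p.1 p.2) \_ (setT `*` D)).
Proof.
apply/funext => -[x y]; rewrite /patch/=.
by rewrite (_ : ((x, y) \in _) = (y \in D))//; apply/idP/idP; rewrite !inE//= => -[].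
Qed.

Lemma measurable_integral_in dX dY (X : measurableType dX) (Y : measurableType dY)
    (m : {sigma_finite_measure set Y -> \bar R}) (D : set Y) (f : X -> Y -> \bar R) :
  measurable D -> measurable_fun setT (fun p : X * Y => f p.1 p.2) ->
  measurable_fun setT (fun x => (\int[m]_(y in D) f x y)%E).
Proof.
move=> mD mf; under eq_fun do rewrite integral_mkcond.
apply: (@measurable_integral _ _ _ _ m (fun x => f x \_ D)).
rewrite patch_snd; apply/(measurable_restrictT _ _).1; first exact: measurableX.
exact: measurable_funTS.
Qed.

Lemma ge0_tonelli_in dX dY (X : measurableType dX) (Y : measurableType dY)
    (m1 : {sigma_finite_measure set X -> \bar R})
    (m2 : {sigma_finite_measure set Y -> \bar R}) (D : set Y)
    (f : X -> Y -> \bar R) :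
  measurable D -> measurable_fun setT (fun p : X * Y => f p.1 p.2) ->
  (forall x y, 0 <= f x y)%E ->
  (\int[m1]_x \int[m2]_(y in D) f x y = \int[m2]_(y in D) \int[m1]_x f x y)%E.
Proof.
move=> mD mf f0.
rewrite [RHS]integral_mkcond.
pose g (p : X * Y) := (f p.1 \_ D) p.2.
transitivity (\int[m1]_x \int[m2]_y g (x, y))%E.
  by apply: eq_integral => x _; rewrite integral_mkcond.
rewrite fubini_tonelli; last 2 first.
- rewrite /g patch_snd; apply/(measurable_restrictT _ _).1; first exact: measurableX.
  exact: measurable_funTS.
- by move=> [x y]; rewrite /g /patch/=; case: ifP.
apply: eq_integral => y _; rewrite /g /patch /=.
by case: ifP => // _; rewrite integral0.
Qed.

Lemma integralZr_fin d (T : measurableType d) (m : {measure set T -> \bar R})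
    (D : set T) (f : T -> R) (k : R) : measurable D -> measurable_fun D f ->
  (forall x, D x -> 0 <= f x) -> 0 <= k ->
  (\int[m]_(x in D) (k * f x)%:E = k%:E * \int[m]_(x in D) (f x)%:E)%E.
Proof.
move=> mD mf f0 k0; under eq_integral do rewrite EFinM.
by rewrite ge0_integralZl_EFin//; exact/measurable_EFinP.
Qed.

Lemma abs_Rintegral_le d (T : measurableType d) (m : {measure set T -> \bar R})
    (D : set T) (f : T -> R) : measurable D -> measurable_fun D f ->
  (`|\int[m]_(x in D) f x|%:E <= \int[m]_(x in D) `|f x|%:E)%E.
Proof.
move=> mD mf; have mF : measurable_fun D (EFin \o f) by exact/measurable_EFinP.
apply: le_trans (le_abse_integral m mD mF); rewrite /Rintegral.
by case: (integral _ _ _) => [r||]//=; rewrite normr0 leey.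
Qed.

Lemma le_Rintegral_ge0 d (T : measurableType d) (m : {measure set T -> \bar R})
    (D : set T) (f : T -> R) (g : T -> \bar R) : measurable D -> measurable_fun D f ->
  measurable_fun D g ->
  (forall x, D x -> (`|f x|%:E <= g x)%E) ->
  (`|\int[m]_(x in D) f x|%:E <= \int[m]_(x in D) g x)%E.
Proof.
move=> mD mf mg fg; apply: (le_trans (abs_Rintegral_le m mD mf)).
apply: ge0_le_integral => //.
by apply/measurable_EFinP; exact: (measurableT_comp (@normr_measurable R setT)).
Qed.

End measure_extras.

Ltac kmeas_with tac := repeat first
  [ assumption | tac | exact: measurable_cst | exact: measurable_id
  | apply: measurable_fun_pair
  | apply: measurable_funM | apply: measurable_funB | apply: measurable_funD
  | apply: measurable_funN | apply: measurable_norm_comp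
  | apply: measurable_fst_comp | apply: measurable_snd_comp
  | apply: measurable_powR_comp | apply: (measurableT_comp (@measurable_expR _)) ].

Section leb2_sigma_finite.
Context {R : realType} {d : nat}.
Local Notation V := ('cV[R]_d * 'cV[R]_d)%type.

(* The library's sigma-finite instance for product measures is only found when
   the factors are subprobabilities. *)
Lemma sigma_finite_leb2 : sigma_finite setT (@leb2 R d).
Proof.
have /sigma_finiteP[F [TF ndF Foo]] := sigma_finiteT (@lebesgue_cV R d).
exists (fun n => F n `*` F n).
  rewrite -setXTT TF predeqE => -[x y]; split.
    move=> [/= [n _ Fnx] [k _ Fky]]; exists (maxn n k) => //; split.
    - by move: x Fnx; exact/subsetPset/ndF/leq_maxl.
    - by move: y Fky; exact/subsetPset/ndF/leq_maxr.
  by move=> [n _ []/= ? ?]; split; exists n.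
move=> k; have [mFk Fk] := Foo k; split; first exact: measurableX.
by rewrite [X in (X < _)%E]product_measure1E// lte_mul_pinfty// ge0_fin_numE.
Qed.

(** A synonym of [leb2] that carries the sigma-finite structure on which Tonelli relies. *)
Definition sigma_leb2 : set V -> \bar R := @leb2 R d.
HB.instance Definition _ := Measure.on sigma_leb2.
HB.instance Definition _ :=
  Measure_isSigmaFinite.Build _ _ _ sigma_leb2 sigma_finite_leb2.

End leb2_sigma_finite.

Section convolution.
Context {R : realType} {d : nat}.
Local Notation V := ('cV[R]_d * 'cV[R]_d)%type.
Local Notation mu := (@lebesgue_measure R).
Local Notation leb2 := (@leb2 R d).
Implicit Types (f g : R -> V -> V -> R).

Definition measurable_kernel f :=
  measurable_fun setT (fun p : R * (V * V) => f p.1 p.2.1 p.2.2).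

Lemma measurable_kernel_comp f dT (T : measurableType dT) (u : T -> R)
    (z w : T -> V) : measurable_kernel f ->
  measurable_fun setT u -> measurable_fun setT z -> measurable_fun setT w ->
  measurable_fun setT (fun x => f (u x) (z x) (w x)).
Proof.
move=> mf mu mz mw.
have := measurableT_comp (f := fun p : R * (V * V) => f p.1 p.2.1 p.2.2)
  (g := fun x => (u x, (z x, w x))) mf; apply.
by apply: measurable_fun_pair => //; exact: measurable_fun_pair.
Qed.

Lemma measurable_conv_inner f g : measurable_kernel f -> measurable_kernel g ->
  measurable_fun setT (fun p : (R * (V * V)) * R =>
    \int[leb2]_w (f p.2 p.1.2.1 w * g (p.1.1 - p.2) w p.1.2.2)).
Proof.
move=> mf mg.
apply: (@measurable_Rintegral R _ _ _ _ (@sigma_leb2 R d) (fun (p : (R * (V * V)) * R) w => f p.2 p.1.2.1 w * g (p.1.1 - p.2) w p.1.2.2)).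
by apply: measurable_funM; apply: measurable_kernel_comp => //; kmeas_with fail.
Qed.

Lemma measurable_kernel_conv f g : measurable_kernel f -> measurable_kernel g ->
  measurable_kernel (time_space_conv f g).
Proof.
move=> mf mg; rewrite /measurable_kernel /time_space_conv.
pose I (p : (R * (V * V)) * R) := \int[leb2]_w (f p.2 p.1.2.1 w * g (p.1.1 - p.2) w p.1.2.2).
(* The interval of integration depends on the parameter, so it is moved into the integrand as an
   indicator. *)
have -> : (fun p : R * (V * V) => \int[mu]_(u in `[0, p.1]) \int[leb2]_w (f u p.2.1 w * g (p.1 - u) w p.2.2)) =
  (fun p => \int[mu]_u (if (0 <= u) && (u <= p.1) then I (p, u) else 0)).
  apply/funext => p; rewrite Rintegral_mkcond; congr Rintegral; apply/funext => u.
  by rewrite /patch mem_setE in_itv.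
apply: (@measurable_Rintegral R _ _ _ _ mu (fun p u => if (0 <= u) && (u <= p.1) then I (p, u) else 0)).
apply: measurable_fun_ifT; last 2 first.
- exact: (measurable_conv_inner mf mg).
- exact: measurable_cst.
apply: measurable_and.
- by apply: measurable_fun_ler; kmeas_with fail.
- by apply: measurable_fun_ler; kmeas_with fail.
Qed.

End convolution.

Ltac kmeas_step := first [ assumption | exact: measurable_id |
  match goal with
  | |- measurable_fun _ (fun=> ?c) => exact: measurable_cst
  | |- measurable_fun _ (fun x => @GRing.mul _ (@?a x) (@?b x)) =>
      apply: measurable_funM
  | |- measurable_fun _ (fun x => @GRing.add _ (@?a x) (@?b x)) =>
      apply: measurable_funD
  | |- measurable_fun _ (fun x => @GRing.opp _ (@?a x)) => apply: measurable_funN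
  | |- measurable_fun _ (fun x => @Num.norm _ _ (@?a x)) =>
      apply: measurable_norm_comp
  | H : measurable_kernel ?f
    |- measurable_fun _ (fun x => ?f (@?u x) (@?z x) (@?w x)) =>
      apply: (measurable_kernel_comp H)
  | H : measurable_fun setT ?f |- measurable_fun _ (fun x => ?f (@?u x)) =>
      is_var f; apply: (measurableT_comp H)
  | |- measurable_fun _ (fun x => powR (@?a x) ?e) => apply: measurable_powR_comp
  | |- measurable_fun _ (fun x => expR (@?a x)) =>
      apply: (measurableT_comp (@measurable_expR _))
  | |- measurable_fun _ (fun x => fst (@?a x)) => apply: measurable_fst_comp
  | |- measurable_fun _ (fun x => snd (@?a x)) => apply: measurable_snd_comp
  end ].

Ltac kmeas := repeat kmeas_step; kmeas_with ltac:(first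
  [ match goal with H : measurable_kernel _ |- _ => apply: (measurable_kernel_comp H) end
  | match goal with H : measurable_fun setT ?f |- _ =>
      is_var f; apply: (measurableT_comp H) end ]).

Ltac emeas := try apply: measurable_funTS; apply/measurable_EFinP; kmeas.

Section convolution_bounds.
Context {R : realType} {d : nat}.
Local Notation V := ('cV[R]_d * 'cV[R]_d)%type.
Local Notation mu := (@lebesgue_measure R).
Local Notation leb2 := (@leb2 R d).
Implicit Types (f g : R -> V -> V -> R).
Local Notation "'oo_ t" := (`]0%R, t[%classic) (at level 0, t at level 0).

Lemma measurable_space_integral dX (X : measurableType dX) (F : X -> V -> \bar R) :
  measurable_fun setT (fun p : X * V => F p.1 p.2) ->
  measurable_fun setT (fun x => (\int[leb2]_w F x w)%E).
Proof.
exact: (@measurable_integral R _ _ _ _ (@sigma_leb2 R d) F).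
Qed.

Lemma measurable_conv_integrand f g t z z' : measurable_kernel f -> measurable_kernel g ->
  measurable_fun setT (fun p : R * V => f p.1 z p.2 * g (t - p.1) p.2 z').
Proof.
by move=> mf mg; apply: measurable_funM; apply: measurable_kernel_comp => //; kmeas.
Qed.

Lemma measurable_conv_time f g t z z' : measurable_kernel f -> measurable_kernel g ->
  measurable_fun setT (fun u => \int[leb2]_w (f u z w * g (t - u) w z')).
Proof.
move=> mf mg.
apply: (@measurable_Rintegral R _ _ _ _ (@sigma_leb2 R d)
  (fun u w => f u z w * g (t - u) w z')).
exact: measurable_conv_integrand.
Qed.

Lemma measurable_conv_space f g t u z z' : measurable_kernel f -> measurable_kernel g ->
  measurable_fun setT (fun w => f u z w * g (t - u) w z').
Proof.
by move=> mf mg; apply: measurable_funM; apply: measurable_kernel_comp => //; kmeas.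
Qed.

(** The endpoints are negligible. Dropping them matters because kernels are only controlled at
    positive times, here [u] and [t - u]. *)
Lemma conv_oo f g t z z' : measurable_kernel f -> measurable_kernel g ->
  time_space_conv f g t z z' =
  \int[mu]_(u in 'oo_t) \int[leb2]_w (f u z w * g (t - u) w z').
Proof.
move=> mf mg; rewrite /time_space_conv.
have mI := measurable_conv_time t z z' mf mg.
have mE D : measurable_fun D (fun u =>
    (\int[leb2]_w (f u z w * g (t - u) w z'))%:E).
  by apply: measurable_funTS; apply/measurable_EFinP.
by congr fine; rewrite -integral_itv_bndo_bndc// -integral_itv_obnd_cbnd.
Qed.

Lemma le_iint (F F' : R -> V -> R) t :
  measurable_fun setT (fun p : R * V => F p.1 p.2) ->
  measurable_fun setT (fun p : R * V => F' p.1 p.2) ->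
  (forall u w, 0 <= F u w) ->
  (forall u w, 0 < u < t -> F u w <= F' u w) ->
  (\int[mu]_(u in 'oo_t) \int[leb2]_w (F u w)%:E <=
   \int[mu]_(u in 'oo_t) \int[leb2]_w (F' u w)%:E)%E.
Proof.
move=> mF mF' F0 FF'.
have mI (A : R -> V -> R) : measurable_fun setT (fun p : R * V => A p.1 p.2) ->
    measurable_fun 'oo_t (fun u => (\int[leb2]_w (A u w)%:E)%E).
  move=> mA; apply: measurable_funTS.
  apply: (@measurable_space_integral _ _ (fun u w => (A u w)%:E)).
  exact/measurable_EFinP.
have mS (A : R -> V -> R) u : measurable_fun setT (fun p : R * V => A p.1 p.2) ->
    measurable_fun setT (fun w => (A u w)%:E).
  move=> mA; apply/measurable_EFinP.
  apply: (measurableT_comp (f := fun p : R * V => A p.1 p.2) (g := fun w => (u, w)) mA).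
  by kmeas.
apply: ge0_le_integral => //.
- by move=> u _; apply: integral_ge0 => w _; rewrite lee_fin.
- exact: mI.
- exact: mI.
move=> u /=; rewrite in_itv/= => u0t; apply: ge0_le_integral => //.
- by move=> w _; rewrite lee_fin.
- exact: mS.
- exact: mS.
- by move=> w _; rewrite lee_fin FF'.
Qed.

Lemma abs_conv_le f g t z z' : measurable_kernel f -> measurable_kernel g ->
  (`|time_space_conv f g t z z'|%:E <=
   \int[mu]_(u in 'oo_t) \int[leb2]_w `|f u z w * g (t - u) w z'|%:E)%E.
Proof.
move=> mf mg; rewrite conv_oo//; apply: le_Rintegral_ge0 => //.
- by apply: measurable_funTS; exact: measurable_conv_time.
- apply: measurable_funTS.
  apply: (@measurable_space_integral _ _ (fun u w => `|f u z w * g (t - u) w z'|%:E)).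
  by apply/measurable_EFinP/measurable_norm_comp; exact: measurable_conv_integrand.
- move=> u _; apply: abs_Rintegral_le => //; exact: measurable_conv_space.
Qed.

(** Real integrals may be subtracted only for integrable functions, so absolute finiteness is asked
    at both levels: in space for each [u], and then in time. *)
Lemma abs_conv_sub_le f g f' g' t z z' :
  measurable_kernel f -> measurable_kernel g ->
  measurable_kernel f' -> measurable_kernel g' ->
  (forall u, 0 < u < t -> (\int[leb2]_w `|f u z w * g (t - u) w z'|%:E < +oo)%E) ->
  (\int[mu]_(u in 'oo_t) \int[leb2]_w `|f u z w * g (t - u) w z'|%:E < +oo)%E ->
  (forall u, 0 < u < t -> (\int[leb2]_w `|f' u z w * g' (t - u) w z'|%:E < +oo)%E) ->
  (\int[mu]_(u in 'oo_t) \int[leb2]_w `|f' u z w * g' (t - u) w z'|%:E < +oo)%E ->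
  (`|time_space_conv f g t z z' - time_space_conv f' g' t z z'|%:E <=
   \int[mu]_(u in 'oo_t) \int[leb2]_w
     `|f u z w * g (t - u) w z' - f' u z w * g' (t - u) w z'|%:E)%E.
Proof.
move=> mf mg mf' mg' i1 i2 i1' i2'.
have I1 (a b : R -> V -> V -> R) u : measurable_kernel a -> measurable_kernel b ->
    (\int[leb2]_w `|a u z w * b (t - u) w z'|%:E < +oo)%E ->
    leb2.-integrable setT (EFin \o (fun w => a u z w * b (t - u) w z')).
  move=> ma mb ab; apply/integrableP; split => //.
  by apply/measurable_EFinP; exact: measurable_conv_space.
have I2 (a b : R -> V -> V -> R) : measurable_kernel a -> measurable_kernel b ->
    (\int[mu]_(u in 'oo_t) \int[leb2]_w `|a u z w * b (t - u) w z'|%:E < +oo)%E ->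
    mu.-integrable 'oo_t (EFin \o (fun u => \int[leb2]_w (a u z w * b (t - u) w z'))).
  move=> ma mb ab; apply/integrableP; split.
    by apply/measurable_EFinP/measurable_funTS; exact: measurable_conv_time.
  apply: le_lt_trans ab; apply: ge0_le_integral => //.
  - apply/measurable_EFinP/measurable_funTS/measurable_norm_comp.
    exact: measurable_conv_time.
  - apply: measurable_funTS.
    apply: (@measurable_space_integral _ _ (fun u w => `|a u z w * b (t - u) w z'|%:E)).
    by apply/measurable_EFinP/measurable_norm_comp; exact: measurable_conv_integrand.
  - move=> u _; apply: abs_Rintegral_le => //; exact: measurable_conv_space.
rewrite !conv_oo// -RintegralB//; [|exact: I2|exact: I2].
apply: le_Rintegral_ge0 => //.
- by apply: measurable_funTS; apply: measurable_funB; exact: measurable_conv_time.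
- apply: measurable_funTS.
  apply: (@measurable_space_integral _ _ (fun u w =>
    `|f u z w * g (t - u) w z' - f' u z w * g' (t - u) w z'|%:E)).
  apply/measurable_EFinP/measurable_norm_comp.
  by apply: measurable_funB; exact: measurable_conv_integrand.
- move=> u /=; rewrite in_itv/= => u0t.
  rewrite -RintegralB//; [|apply: I1 => //; exact: i1|apply: I1 => //; exact: i1'].
  apply: abs_Rintegral_le => //.
  by apply: measurable_funB; exact: measurable_conv_space.
Qed.

(** * Convolution estimates against an abstract semigroup kernel *)

Section semigroup_kernel.
Variable G : R -> V -> V -> R.
Hypothesis mG : measurable_kernel G.
Hypothesis G0 : forall t z w, 0 <= G t z w.
Hypothesis GG : forall s t z z', 0 < s -> 0 < t ->
  (\int[leb2]_w (G s z w * G t w z')%:E = (G (s + t) z z')%:E)%E.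

Lemma space_integral_semigroup k s t z z' : 0 <= k -> 0 < s -> 0 < t ->
  (\int[leb2]_w (k * (G s z w * G t w z'))%:E = (k * G (s + t) z z')%:E)%E.
Proof.
move=> k0 s0 t0; rewrite integralZr_fin//.
- by rewrite GG.
- by kmeas.
- by move=> w _; rewrite mulr_ge0.
Qed.

(** The space integral is [G t z z'] whatever [u] is, so only the time integral of [phi] remains.
    This turns every convolution bound below into a scalar integral. *)
Lemma iint_semigroup (phi : R -> R) t z z' : measurable_fun setT phi ->
  (forall u, 0 <= phi u) ->
  (\int[mu]_(u in 'oo_t) \int[leb2]_w (phi u * (G u z w * G (t - u) w z'))%:E =
   (G t z z')%:E * \int[mu]_(u in 'oo_t) (phi u)%:E)%E.
Proof.
move=> mphi phi0.
rewrite -integralZr_fin//; last exact: measurable_funTS.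
apply: eq_integral => u; rewrite inE/= in_itv/= => /andP[u0 ut].
rewrite space_integral_semigroup ?subr_gt0//.
by rewrite addrC subrK mulrC.
Qed.

Lemma iint_majorant (F : R -> V -> R) (phi : R -> R) t (m : R) z z' :
  measurable_fun setT (fun p : R * V => F p.1 p.2) ->
  (forall u w, 0 <= F u w) ->
  measurable_fun setT phi -> (forall u, 0 <= phi u) ->
  (forall u w, 0 < u < t -> F u w <= phi u * (G u z w * G (t - u) w z')) ->
  (\int[mu]_(u in 'oo_t) (phi u)%:E <= m%:E)%E ->
  (\int[mu]_(u in 'oo_t) \int[leb2]_w (F u w)%:E <= (m * G t z z')%:E)%E.
Proof.
move=> mF F0 mphi phi0 Fphi phim.
apply: le_trans (le_iint (F' := fun u w => phi u * (G u z w * G (t - u) w z')) _ _ _ _) _ => //.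
  apply: measurable_funM; first exact: (measurableT_comp mphi measurable_fst).
  by kmeas.
rewrite iint_semigroup// [m * _]mulrC [(_ * m)%:E]EFinM.
by apply: lee_wpmul2l => //; rewrite lee_fin.
Qed.

(** The first two conclusions are the finiteness conditions of [abs_conv_sub_le], the third is the
    resulting pointwise bound. *)
Lemma conv_majorant f g (phi : R -> R) t (m : R) z z' :
  measurable_kernel f -> measurable_kernel g ->
  measurable_fun setT phi -> (forall u, 0 <= phi u) ->
  (forall u w, 0 < u < t -> `|f u z w * g (t - u) w z'| <=
     phi u * (G u z w * G (t - u) w z')) ->
  (\int[mu]_(u in 'oo_t) (phi u)%:E <= m%:E)%E ->
  [/\ (\int[mu]_(u in 'oo_t) \int[leb2]_w `|f u z w * g (t - u) w z'|%:E <=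
        (m * G t z z')%:E)%E,
      forall u, 0 < u < t ->
        (\int[leb2]_w `|f u z w * g (t - u) w z'|%:E < +oo)%E &
      `|time_space_conv f g t z z'| <= m * G t z z'].
Proof.
move=> mf mg mphi phi0 fg phim.
have le1 : (\int[mu]_(u in 'oo_t) \int[leb2]_w `|f u z w * g (t - u) w z'|%:E <=
        (m * G t z z')%:E)%E.
  apply: (@iint_majorant (fun u w => `|f u z w * g (t - u) w z'|) phi) => //.
  by apply: measurable_norm_comp; exact: measurable_conv_integrand.
split => //; last by rewrite -lee_fin (le_trans (abs_conv_le t z z' mf mg)).
move=> u u0t; have /andP[u0 ut] := u0t.
apply: (@le_lt_trans _ _ (\int[leb2]_w (phi u * (G u z w * G (t - u) w z'))%:E)%E).
  apply: ge0_le_integral => //.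
  - by apply/measurable_EFinP/measurable_norm_comp; exact: measurable_conv_space.
  - by emeas.
  - by move=> w _; rewrite lee_fin fg.
by rewrite space_integral_semigroup ?subr_gt0// ltry.
Qed.

(* Tonelli and the semigroup property move the free kernel through a
   convolution. *)
Lemma space_integral_conv (f : R -> V -> V -> R) (phi : R -> R) s t z z' : 0 < s ->
  measurable_kernel f -> measurable_fun setT phi -> (forall u, 0 <= phi u) ->
  (\int[leb2]_w ((G s z w)%:E * \int[mu]_(u in 'oo_t) \int[leb2]_w'
     (phi u * (G u w w' * `|f (t - u) w' z'|))%:E) =
   \int[mu]_(u in 'oo_t) ((phi u)%:E *
     \int[leb2]_w' (G (s + u) z w' * `|f (t - u) w' z'|)%:E))%E.
Proof.
move=> s0 mf mphi phi0.
transitivity (\int[leb2]_w \int[mu]_(u in 'oo_t) \int[leb2]_w'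
     (G s z w * (phi u * (G u w w' * `|f (t - u) w' z'|)))%:E)%E.
  apply: eq_integral => w _; rewrite -ge0_integralZl_EFin//.
  - apply: eq_integral => u _; rewrite [RHS]integralZr_fin//.
    + by kmeas.
    + by move=> w' _; rewrite !mulr_ge0.
  - by move=> u _; apply: integral_ge0 => w' _; rewrite lee_fin !mulr_ge0.
  - apply: measurable_funTS.
    apply: (@measurable_space_integral _ _ (fun u w' => (phi u * (G u w w' * `|f (t - u) w' z'|))%:E)).
    by emeas.
rewrite [LHS](@ge0_tonelli_in R _ _ _ _ (@sigma_leb2 R d) mu 'oo_t (fun w u => \int[leb2]_w'
     (G s z w * (phi u * (G u w w' * `|f (t - u) w' z'|)))%:E)%E)//; last 2 first.
- apply: (@measurable_space_integral _ _ (fun p w' => (G s z p.1 * (phi p.2 * (G p.2 p.1 w' * `|f (t - p.2) w' z'|)))%:E)).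
  by emeas.
- by move=> w u; apply: integral_ge0 => w' _; rewrite lee_fin !mulr_ge0.
apply: eq_integral => u; rewrite inE/= in_itv/= => /andP[u0 ut].
rewrite [LHS](@ge0_tonelli_in R _ _ _ _ (@sigma_leb2 R d) (@sigma_leb2 R d) setT (fun w w' =>
     (G s z w * (phi u * (G u w w' * `|f (t - u) w' z'|)))%:E)%E)//; last 2 first.
- by emeas.
- by move=> w w'; rewrite lee_fin !mulr_ge0.
rewrite -integralZr_fin//; last 2 first.
- by kmeas.
- by move=> w' _; rewrite mulr_ge0.
apply: eq_integral => w' _.
rewrite [RHS](_ : _ = (phi u * `|f (t - u) w' z'| * G (s + u) z w')%:E); last first.
  by congr EFin; ring.
rewrite -space_integral_semigroup ?mulr_ge0//.
by apply: eq_integral => w _; congr EFin; ring.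
Qed.

End semigroup_kernel.
End convolution_bounds.

(** * Stability of the parametrix series *)

(** The bounds with [M] make both series converge, so that [limn] is a true limit and commutes with
    subtraction; the estimate itself involves [D] alone. *)
Lemma geometric_series_sub {R : realType} (u v : nat -> R) (M D : R) :
  (forall r, `|u r| <= M * 2^-1 ^+ r) -> (forall r, `|v r| <= M * 2^-1 ^+ r) ->
  (forall r, `|u r - v r| <= D * 2^-1 ^+ r) ->
  `|limn (series u) - limn (series v)| <= 2 * D.
Proof.
move=> uM vM uvD.
have cv (w : nat -> R) : (forall r, `|w r| <= M * 2^-1 ^+ r) -> cvgn (series w).
  move=> wM; apply: normed_cvg.
  apply: (@series_le_cvg _ _ (geometric M 2^-1)).
  - by move=> n; exact: normr_ge0.
  - by move=> n; exact: le_trans (normr_ge0 _) (wM n).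
  - by move=> n; exact: wM.
  - apply: is_cvg_geometric_series.
    by rewrite ger0_norm ?invr_ge0// invf_lt1// ltr1n.
have D0 : 0 <= D by have := le_trans (normr_ge0 _) (uvD 0); rewrite expr0 mulr1.
have cd : cvgn (series u \- series v) by apply: is_cvgB; exact: cv.
rewrite -limB; [|exact: cv|exact: cv].
rewrite -lim_norm//; apply: limr_le; first exact: is_cvg_norm.
apply: nearW => n.
rewrite (_ : (series u - series v) n = \sum_(0 <= r < n) (u r - v r)); last first.
  by rewrite sumrB.
apply: (le_trans (ler_norm_sum _ _ _)).
apply: (@le_trans _ _ (D * \sum_(0 <= r < n) 2^-1 ^+ r)).
  by rewrite mulr_sumr; apply: ler_sum => r _; exact: uvD.
rewrite mulrC ler_wpM2r//.
have -> : \sum_(0 <= r < n) (2^-1 ^+ r : R) = 2 - 2 * 2^-1 ^+ n.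
  elim: n => [|n IH]; first by rewrite big_nil expr0 mulr1 subrr.
  by rewrite big_nat_recr//= IH exprS; field.
by rewrite lerBlDr lerDl mulr_ge0// exprn_ge0.
Qed.

Section parametrix_stability.
Context {R : realType} {d : nat}.
Local Notation V := ('cV[R]_d * 'cV[R]_d)%type.
Local Notation mu := (@lebesgue_measure R).
Local Notation leb2 := (@leb2 R d).
Local Notation "'oo_ t" := (`]0%R, t[%classic) (at level 0, t at level 0).

Variable G : R -> V -> V -> R.
Hypothesis mG : measurable_kernel G.
Hypothesis G0 : forall t z w, 0 <= G t z w.
Hypothesis GG : forall s t z z', 0 < s -> 0 < t ->
  (\int[leb2]_w (G s z w * G t w z')%:E = (G (s + t) z z')%:E)%E.

Variables (T K th l : R).
Hypotheses (T0 : 0 < T) (K0 : 0 < K) (th01 : 0 < th <= 1) (l0 : 0 < l).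
Local Notation om t := (t `^ (th - 1)).
(** [K] is the common constant of all kernel bounds. With [(4 * K)^-1], a convolution by a kernel of
    size [K * om] gains a factor 1/4, which leaves room for error terms in a contraction by 1/2. *)
Hypothesis laplace : forall t, 0 < t <= T ->
  (\int[mu]_(u in 'oo_t) (om u * expR (- (l * u)) * om (t - u))%:E <=
    ((4 * K)^-1 * om t)%:E)%E /\
  (\int[mu]_(u in 'oo_t) (om u * expR (- (l * u)))%:E <= ((4 * K)^-1)%:E)%E.

Let th0 : 0 < th. Proof. by case/andP: th01. Qed.
Let th1 : th <= 1. Proof. by case/andP: th01. Qed.

Lemma measurable_kernel_iter (H : R -> V -> V -> R) r : measurable_kernel H ->
  measurable_kernel (iter r (time_space_conv H) H).
Proof. by move=> mH; elim: r => //= r IH; exact: measurable_kernel_conv. Qed.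

(** The growth [expR (l * (t - u))] allowed for [h] is [expR (l * t) * expR (- (l * u))]: the first
    factor is kept in the bound and the second is the decaying weight of [laplace]. *)
Lemma conv_iter_majorant (f h : R -> V -> V -> R) (phi : R -> R) (A m : R) t z z' :
  measurable_kernel f -> measurable_kernel h -> 0 <= A ->
  (forall t w w', 0 < t <= T -> `|h t w w'| <= A * expR (l * t) * om t * G t w w') ->
  measurable_fun setT phi -> (forall u, 0 <= phi u) ->
  (forall u w, 0 < u <= T -> `|f u z w| <= phi u * G u z w) ->
  0 < t <= T ->
  (\int[mu]_(u in 'oo_t) (phi u * expR (- (l * u)) * om (t - u))%:E <= m%:E)%E ->
  [/\ (\int[mu]_(u in 'oo_t) \int[leb2]_w `|f u z w * h (t - u) w z'|%:E <=
        (A * expR (l * t) * m * G t z z')%:E)%E,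
      forall u, 0 < u < t ->
        (\int[leb2]_w `|f u z w * h (t - u) w z'|%:E < +oo)%E &
      `|time_space_conv f h t z z'| <= A * expR (l * t) * m * G t z z'].
Proof.
move=> mf mh A0 hh mphi phi0 fphi /andP[t0 tT] phim.
apply: (conv_majorant mG G0 GG (phi := fun u =>
    A * expR (l * t) * (phi u * expR (- (l * u)) * om (t - u)))) => //.
- by kmeas.
- by move=> u; rewrite !mulr_ge0 ?expR_ge0 ?powR_ge0.
- move=> u w /andP[u0 ut]; rewrite normrM.
  have tu : 0 < t - u <= T.
    by rewrite subr_gt0 ut/= (le_trans _ tT)// lerBlDr lerDl ltW.
  have uT : 0 < u <= T by rewrite u0 (le_trans (ltW ut)).
  apply: le_trans (ler_pM (normr_ge0 _) (normr_ge0 _) (fphi u w uT) (hh _ w z' tu)) _.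
  rewrite mulrBr expRD; apply: eqr_le; ring.
- rewrite integralZr_fin//.
  + rewrite [(A * _ * m)%:E]EFinM; apply: lee_wpmul2l => //.
    by rewrite lee_fin mulr_ge0 ?expR_ge0.
  + by apply: measurable_funTS; kmeas.
  + by move=> u _; rewrite !mulr_ge0 ?expR_ge0 ?powR_ge0.
  + by rewrite mulr_ge0 ?expR_ge0.
Qed.

Lemma laplace_scaled t : 0 < t <= T ->
  (\int[mu]_(u in 'oo_t) (K * om u * expR (- (l * u)) * om (t - u))%:E <=
    (K * ((4 * K)^-1 * om t))%:E)%E.
Proof.
move=> t0T; under eq_integral do rewrite -!mulrA.
rewrite integralZr_fin ?(ltW K0)//; last 2 first.
- by apply: measurable_funTS; kmeas.
- by move=> u _; rewrite !mulr_ge0 ?expR_ge0 ?powR_ge0.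
rewrite EFinM; apply: lee_wpmul2l; first by rewrite lee_fin ltW.
under eq_integral do rewrite mulrA.
by have [] := laplace t0T.
Qed.

Lemma iter_kernel_bound (H : R -> V -> V -> R) : measurable_kernel H ->
  (forall t z w, 0 < t <= T -> `|H t z w| <= K * om t * G t z w) ->
  forall r t z w, 0 < t <= T ->
  `|iter r (time_space_conv H) H t z w| <=
    K * 2^-1 ^+ r * expR (l * t) * om t * G t z w.
Proof.
move=> mH bH; elim=> [|r IH] t z w /[dup] t0T /andP[t0 tT].
  rewrite expr0 mulr1; apply: (le_trans (bH t z w t0T)).
  apply: ler_wpM2r => //; rewrite -mulrA ler_pM2l// ler_peMl ?powR_ge0//.
  by rewrite -[leLHS]expR0 ler_expR mulr_ge0// ltW.
have A0 : 0 <= K * 2^-1 ^+ r by rewrite mulr_ge0 ?ltW// exprn_gt0.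
have mphi : measurable_fun setT (fun u => K * om u) by kmeas.
have phi0 u : 0 <= K * om u by rewrite mulr_ge0 ?powR_ge0 ?(ltW K0).
have [_ _ /le_trans] := conv_iter_majorant w mH (measurable_kernel_iter r mH)
  A0 IH mphi phi0 (fun u w' => bH u z w') t0T (laplace_scaled t0T).
apply; apply: ler_wpM2r => //; rewrite exprS.
(* A convolution gains 1/4; only 1/2 is claimed, the rate that [smoothed_difference] reaches as
   well. *)
rewrite (_ : K * 2^-1 ^+ r * expR (l * t) * (K * ((4 * K)^-1 * om t)) =
  4^-1 * (K * 2^-1 ^+ r * expR (l * t) * om t)); last by field; rewrite gt_eqF.
rewrite (_ : K * (2^-1 * _) * _ * _ =
  2^-1 * (K * 2^-1 ^+ r * expR (l * t) * om t)); last by ring.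
apply: ler_wpM2r; first by rewrite !mulr_ge0 ?expR_ge0 ?powR_ge0 ?(ltW K0).
by rewrite lef_pV2 ?posrE// ler_nat.
Qed.

Lemma integral_smooth_le t : 0 < t <= T ->
  (\int[mu]_(u in 'oo_t) (K * expR (- (l * u)) * om (t - u))%:E <=
   (K * (T `^ th / th))%:E)%E.
Proof.
move=> /andP[t0 tT].
apply: (@le_trans _ _ (\int[mu]_(u in 'oo_t) (K * om (t - u))%:E)%E).
  apply: ge0_le_integral => //.
  - by move=> u _; rewrite lee_fin !mulr_ge0 ?expR_ge0 ?powR_ge0 ?ltW.
  - by emeas.
  - by emeas.
  - move=> u /=; rewrite in_itv/= => /andP[u0 _].
    rewrite lee_fin ler_wpM2r ?powR_ge0// ler_piMr ?(ltW K0)//.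
    by rewrite -[leRHS]expR0 ler_expR oppr_le0 mulr_ge0// ltW.
rewrite integralZr_fin ?(ltW K0)//; last 2 first.
- by apply: measurable_funTS; kmeas.
- by move=> u _; rewrite powR_ge0.
rewrite EFinM; apply: lee_wpmul2l; first by rewrite lee_fin ltW.
apply: (le_trans (integral_powR_rev th0 t0)); rewrite lee_fin.
by rewrite ler_pM2r ?invr_gt0// ge0_ler_powR ?nnegrE// ltW.
Qed.

(** The splitting is [(f - fe) h + fe (h - he)]. The first part is bounded pointwise; the second
    stays an integral against [G], the only form in which [h - he] is controlled. *)
Lemma sub_conv_le (f fe h he : R -> V -> V -> R) (phi phif : R -> R) (A m n : R) t z z' :
  measurable_kernel f -> measurable_kernel fe ->
  measurable_kernel h -> measurable_kernel he -> 0 <= A ->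
  (forall t w w', 0 < t <= T -> `|h t w w'| <= A * expR (l * t) * om t * G t w w') ->
  (forall t w w', 0 < t <= T -> `|he t w w'| <= A * expR (l * t) * om t * G t w w') ->
  measurable_fun setT phi -> (forall u, 0 <= phi u) ->
  measurable_fun setT phif -> (forall u, 0 <= phif u) ->
  (forall u w, 0 < u <= T -> `|f u z w| <= phif u * G u z w) ->
  (forall u w, 0 < u <= T -> `|fe u z w| <= phif u * G u z w) ->
  (forall u w, 0 < u <= T -> `|f u z w - fe u z w| <= phi u * G u z w) ->
  0 < t <= T ->
  (\int[mu]_(u in 'oo_t) (phif u * expR (- (l * u)) * om (t - u))%:E <= n%:E)%E ->
  (\int[mu]_(u in 'oo_t) (phi u * expR (- (l * u)) * om (t - u))%:E <= m%:E)%E ->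
  (`|time_space_conv f h t z z' - time_space_conv fe he t z z'|%:E <=
   (A * expR (l * t) * m * G t z z')%:E +
   \int[mu]_(u in 'oo_t) \int[leb2]_w
     (phif u * (G u z w * `|h (t - u) w z' - he (t - u) w z'|))%:E)%E.
Proof.
move=> mf mfe mh mhe A0 bh bhe mphi phi0 mphif phif0 bf bfe df t0T nf mm.
have [i1 i2 _] := conv_iter_majorant z' mf mh A0 bh mphif phif0 bf t0T nf.
have [i1' i2' _] := conv_iter_majorant z' mfe mhe A0 bhe mphif phif0 bfe t0T nf.
have mdf : measurable_kernel (fun u z w => f u z w - fe u z w).
  exact: measurable_funB.
have [i3 _ _] := conv_iter_majorant z' mdf mh A0 bh mphi phi0 df t0T mm.
apply: le_trans (abs_conv_sub_le mf mh mfe mhe i2 _ i2' _) _.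
- by apply: le_lt_trans i1 _; rewrite ltry.
- by apply: le_lt_trans i1' _; rewrite ltry.
apply: (@le_trans _ _ (\int[mu]_(u in 'oo_t) \int[leb2]_w
   (`|(f u z w - fe u z w) * h (t - u) w z'| +
    phif u * (G u z w * `|h (t - u) w z' - he (t - u) w z'|))%:E)%E).
  apply: le_iint => //.
  - by kmeas.
  - by kmeas.
  move=> u w /andP[u0 ut].
  have uT : 0 < u <= T by rewrite u0 (le_trans (ltW ut))//; case/andP: t0T.
  rewrite (_ : _ - _ = (f u z w - fe u z w) * h (t - u) w z' +
    fe u z w * (h (t - u) w z' - he (t - u) w z')); last by ring.
  rewrite (le_trans (ler_normD _ _))// lerD2l normrM mulrA ler_wpM2r//.
  exact: bfe.
have E : (\int[mu]_(u in 'oo_t) \int[leb2]_w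
   (`|(f u z w - fe u z w) * h (t - u) w z'| +
    phif u * (G u z w * `|h (t - u) w z' - he (t - u) w z'|))%:E =
   \int[mu]_(u in 'oo_t) \int[leb2]_w `|(f u z w - fe u z w) * h (t - u) w z'|%:E +
   \int[mu]_(u in 'oo_t) \int[leb2]_w
    (phif u * (G u z w * `|h (t - u) w z' - he (t - u) w z'|))%:E)%E.
  rewrite -ge0_integralD//.
  - apply: eq_integral => u _; under eq_integral do rewrite EFinD.
    rewrite ge0_integralD//.
    + by emeas.
    + by move=> w _; rewrite lee_fin !mulr_ge0.
    + by emeas.
  - by move=> u _; apply: integral_ge0 => w _; rewrite lee_fin.
  - apply: measurable_funTS.
    apply: (@measurable_space_integral _ _ _ _ (fun u w => `|(f u z w - fe u z w) * h (t - u) w z'|%:E)).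
    by emeas.
  - by move=> u _; apply: integral_ge0 => w _; rewrite lee_fin !mulr_ge0.
  - apply: measurable_funTS.
    apply: (@measurable_space_integral _ _ _ _ (fun u w => (phif u * (G u z w * `|h (t - u) w z' - he (t - u) w z'|))%:E)).
    by emeas.
by rewrite E; apply: leeD.
Qed.

Variables (P Pe H He : R -> V -> V -> R) (db : V -> R) (Dl : R).
Hypotheses (mP : measurable_kernel P) (mPe : measurable_kernel Pe).
Hypotheses (mH : measurable_kernel H) (mHe : measurable_kernel He).
Hypotheses (mdb : measurable_fun setT db) (db0 : forall z, 0 <= db z).
Hypothesis Dl0 : 0 <= Dl.
Hypothesis bP : forall t z w, 0 < t <= T -> `|P t z w| <= K * G t z w.
Hypothesis bPe : forall t z w, 0 < t <= T -> `|Pe t z w| <= K * G t z w.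
Hypothesis bH : forall t z w, 0 < t <= T -> `|H t z w| <= K * om t * G t z w.
Hypothesis bHe : forall t z w, 0 < t <= T -> `|He t z w| <= K * om t * G t z w.
Hypothesis dP : forall t z w, 0 < t <= T ->
  `|P t z w - Pe t z w| <= K * Dl * G t z w.
Hypothesis dH : forall t z w, 0 < t <= T ->
  `|H t z w - He t z w| <=
    K * (Dl * om t + db z * t `^ (2^-1 - 1)) * G t z w.
(** Averaging between two kernels turns the unbounded [db] into [Dl], at the price of a singularity
    in either time. *)
Hypothesis drift : forall s t z z', 0 < s -> 0 < t -> s + t <= T ->
  (\int[leb2]_w (db w * t `^ (2^-1 - 1) * (G s z w * G t w z'))%:E <=
   (K * Dl * (om s + om t) * G (s + t) z z')%:E)%E.

(** Variables with defining equations, so that the iterates stay opaque until an equation is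
    used. *)
Variables (h he : nat -> R -> V -> V -> R).
Hypothesis hE : forall r, h r = iter r (time_space_conv H) H.
Hypothesis heE : forall r, he r = iter r (time_space_conv He) He.

Let mh r : measurable_kernel (h r).
Proof. by rewrite hE; exact: measurable_kernel_iter. Qed.
Let mhe r : measurable_kernel (he r).
Proof. by rewrite heE; exact: measurable_kernel_iter. Qed.
Let A0 r : 0 <= K * 2^-1 ^+ r.
Proof. by rewrite mulr_ge0 ?(ltW K0)// exprn_ge0. Qed.
Let bh r t w w' : 0 < t <= T ->
  `|h r t w w'| <= K * 2^-1 ^+ r * expR (l * t) * om t * G t w w'.
Proof. by rewrite hE; exact: iter_kernel_bound. Qed.
Let bhe r t w w' : 0 < t <= T ->
  `|he r t w w'| <= K * 2^-1 ^+ r * expR (l * t) * om t * G t w w'.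
Proof. by rewrite heE; exact: iter_kernel_bound. Qed.

Definition beta_const := (2 / 2^-1 + 2 / th) * T `^ th.
(** Chosen to meet the two requirements of [smoothed_difference]: at least [K + K ^+ 2] for the base
    case, and [K / 4 + K ^+ 3 * B <= Dc / 4] for the induction step. *)
Definition stability_const :=
  4 * (K / 4 + K ^+ 3 * beta_const) + (K + K ^+ 2).
Local Notation B := beta_const.
Local Notation Dc := stability_const.

Let B0 : 0 <= B.
Proof. by rewrite mulr_ge0 ?powR_ge0 ?addr_ge0 ?divr_ge0 ?(ltW th0). Qed.

Let Dc0 : 0 <= Dc.
Proof.
have [K3 K2] : 0 <= K ^+ 3 /\ 0 <= K ^+ 2 by rewrite !exprn_ge0 ?(ltW K0).
have KB : 0 <= K ^+ 3 * B by rewrite mulr_ge0.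
by rewrite /stability_const; have := ltW K0; lra.
Qed.

Lemma integral_drift_le t : 0 < t <= T ->
  (\int[mu]_(u in 'oo_t) (u `^ (2^-1 - 1) * expR (- (l * u)) * om (t - u))%:E <=
   (B * t `^ (2^-1 - 1))%:E)%E.
Proof.
move=> /andP[t0 tT].
apply: (@le_trans _ _ (\int[mu]_(u in 'oo_t) (u `^ (2^-1 - 1) * om (t - u))%:E)%E).
  apply: ge0_le_integral => //.
  - by move=> u _; rewrite lee_fin !mulr_ge0 ?expR_ge0 ?powR_ge0.
  - by emeas.
  - by emeas.
  - move=> u /=; rewrite in_itv/= => /andP[u0 _].
    rewrite lee_fin ler_wpM2r ?powR_ge0// ler_piMr ?powR_ge0//.
    by rewrite -[leRHS]expR0 ler_expR oppr_le0 mulr_ge0// ltW.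
apply: (le_trans (integral_beta_le _ th01 t0)).
  by rewrite invr_gt0 invf_le1// ltr0n ler1n.
rewrite lee_fin -mulrA ler_wpM2l ?addr_ge0 ?divr_ge0 ?(ltW th0)//.
rewrite (_ : 2^-1 + th - 1 = th + (2^-1 - 1)); last by ring.
rewrite powRD; last by rewrite (gt_eqF t0) implybT.
by rewrite ler_wpM2r ?powR_ge0// ge0_ler_powR ?nnegrE// ltW.
Qed.

(** [step_phi w] is the time profile of [H - He] started at [w], and [step_m w] bounds its weighted
    integral. The part in [Dl] uses the smallness of [laplace]; the part in [db w] keeps the
    singularity [t^(-1/2)] and waits to be averaged by [drift]. *)
Let step_phi (w : V) u := K * (Dl * om u + db w * u `^ (2^-1 - 1)).
Let step_m (w : V) t := K * (Dl * ((4 * K)^-1 * om t) + db w * (B * t `^ (2^-1 - 1))).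

Lemma step_le w t : 0 < t <= T ->
  (\int[mu]_(u in 'oo_t) (step_phi w u * expR (- (l * u)) * om (t - u))%:E <=
   (step_m w t)%:E)%E.
Proof.
move=> t0T; have Dlw := db0 w.
have E u : step_phi w u * expR (- (l * u)) * om (t - u) =
  K * Dl * (om u * expR (- (l * u)) * om (t - u)) +
  K * db w * (u `^ (2^-1 - 1) * expR (- (l * u)) * om (t - u)).
  by rewrite /step_phi; ring.
under eq_integral do rewrite E EFinD.
have KD : 0 <= K * Dl by rewrite mulr_ge0 ?(ltW K0).
have Kdb : 0 <= K * db w by rewrite mulr_ge0 ?(ltW K0).
rewrite ge0_integralD//; last 4 first.
- by move=> u _; rewrite lee_fin !mulr_ge0 ?expR_ge0 ?powR_ge0 ?(ltW K0).
- by emeas.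
- by move=> u _; rewrite lee_fin !mulr_ge0 ?expR_ge0 ?powR_ge0 ?(ltW K0).
- by emeas.
rewrite !integralZr_fin//; last 4 first.
- by apply: measurable_funTS; kmeas.
- by move=> u _; rewrite !mulr_ge0 ?expR_ge0 ?powR_ge0.
- by apply: measurable_funTS; kmeas.
- by move=> u _; rewrite !mulr_ge0 ?expR_ge0 ?powR_ge0.
rewrite (_ : step_m w t = K * Dl * ((4 * K)^-1 * om t) +
  K * db w * (B * t `^ (2^-1 - 1))); last by rewrite /step_m; ring.
rewrite EFinD [(K * Dl * _)%:E]EFinM [(K * db w * _)%:E]EFinM.
apply: leeD; apply: lee_wpmul2l; rewrite ?lee_fin//.
- by have [] := laplace t0T.
- exact: integral_drift_le.
Qed.

(* Only this average of the difference of the r-th iterates is controlled: [db]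
   is in L^q, hence not bounded, and needs the free kernel [G s] to smooth it. *)
Lemma smoothed_difference r s t z z' : 0 < s -> 0 < t -> s + t <= T ->
  (\int[leb2]_w (G s z w * `|h r t w z' - he r t w z'|)%:E <=
   (Dc * 2^-1 ^+ r * expR (l * t) * (om s + om t) * Dl * G (s + t) z z')%:E)%E.
Proof.
elim: r s t z z' => [|r IH] s t z z' s0 t0 stT.
  (* For the kernels themselves, [dH] gives one part for the semigroup property and one for
     [drift]. *)
  have t0T : 0 < t <= T by rewrite t0 (le_trans _ stT)// lerDr ltW.
  rewrite hE heE /= expr0 mulr1.
  apply: (@le_trans _ _ (\int[leb2]_w ((K * Dl * om t * (G s z w * G t w z'))%:E +
     (K * (db w * t `^ (2^-1 - 1) * (G s z w * G t w z')))%:E))%E).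
    apply: ge0_le_integral => //.
    - by move=> w _; rewrite lee_fin mulr_ge0.
    - by emeas.
    - by apply: emeasurable_funD; emeas.
    - move=> w _; rewrite -EFinD lee_fin.
      apply: le_trans (ler_wpM2l (G0 _ _ _) (dH w z' t0T)) _.
      by apply: eqr_le; ring.
  rewrite ge0_integralD//; last 4 first.
  - by move=> w _; rewrite lee_fin !mulr_ge0 ?powR_ge0 ?(ltW K0).
  - by emeas.
  - by move=> w _; rewrite lee_fin !mulr_ge0 ?powR_ge0 ?(ltW K0).
  - by emeas.
  rewrite (space_integral_semigroup mG G0 GG)//; last first.
    by rewrite !mulr_ge0 ?powR_ge0 ?(ltW K0).
  rewrite integralZr_fin ?(ltW K0)//; last 2 first.
  - by kmeas.
  - by move=> w _; rewrite !mulr_ge0 ?powR_ge0.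
  apply: (@le_trans _ _ ((K * Dl * om t * G (s + t) z z')%:E +
    K%:E * (K * Dl * (om s + om t) * G (s + t) z z')%:E)%E).
    by apply: leeD => //; apply: lee_wpmul2l; [rewrite lee_fin (ltW K0)|exact: drift].
  rewrite -EFinM -EFinD lee_fin.
  have e1 : 1 <= expR (l * t) by rewrite -[leLHS]expR0 ler_expR mulr_ge0// ltW.
  rewrite [leLHS](_ : _ = (K * om t + K ^+ 2 * (om s + om t)) * (Dl * G (s + t) z z')); last by ring.
  rewrite [leRHS](_ : _ = (Dc * expR (l * t) * (om s + om t)) * (Dl * G (s + t) z z')); last by ring.
  apply: ler_wpM2r; first by rewrite mulr_ge0.
  have os := powR_ge0 s (th - 1); have ot := powR_ge0 t (th - 1).
  apply: (@le_trans _ _ ((K + K ^+ 2) * (om s + om t))).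
    by rewrite mulrDl lerD2r ler_wpM2l ?(ltW K0)// lerDr.
  apply: ler_wpM2r; first by rewrite addr_ge0.
  apply: (@le_trans _ _ Dc); last by rewrite ler_peMr.
  have KB : 0 <= K ^+ 3 * B by rewrite mulr_ge0// exprn_ge0// ltW.
  by rewrite /stability_const; have := ltW K0; lra.
have t0T : 0 < t <= T by rewrite t0 (le_trans _ stT)// lerDr ltW.
have s0T : 0 < s <= T by rewrite s0 (le_trans _ stT)// lerDl ltW.
have mhr := mh r; have mher := mhe r.
have mhr1 := mh r.+1; have mher1 := mhe r.+1.
pose A := K * 2^-1 ^+ r * expR (l * t).
have A'0 : 0 <= A by rewrite mulr_ge0 ?expR_ge0.
(* The part of the recursion in which the iterates of rank [r] differ; it remains an integral until
   [G s] is applied to it. *)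
pose E2 w := (\int[mu]_(u in 'oo_t) \int[leb2]_w'
  (K * om u * (G u w w' * `|h r (t - u) w' z' - he r (t - u) w' z'|))%:E)%E.
have E20 w : (0 <= E2 w)%E.
  apply: integral_ge0 => u _; apply: integral_ge0 => w' _.
  by rewrite lee_fin !mulr_ge0 ?powR_ge0 ?(ltW K0).
have mE2 : measurable_fun setT E2.
  apply: (@measurable_integral_in _ _ _ _ _ mu) => //.
  apply: (@measurable_space_integral _ _ _ _ (fun p w' => (K * om p.2 *
    (G p.2 p.1 w' * `|h r (t - p.2) w' z' - he r (t - p.2) w' z'|))%:E)).
  by emeas.
have sm0 w : 0 <= step_m w t.
  rewrite /step_m mulr_ge0 ?(ltW K0)// addr_ge0// mulr_ge0 ?db0// mulr_ge0 ?powR_ge0//.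
  by rewrite invr_ge0 mulr_ge0 ?(ltW K0).
have step w : (`|h r.+1 t w z' - he r.+1 t w z'|%:E <=
    (A * step_m w t * G t w z')%:E + E2 w)%E.
  rewrite hE heE /= -hE -heE.
  apply: (sub_conv_le (phi := step_phi w) (phif := fun u => K * om u)
     (n := K * ((4 * K)^-1 * om t))) => //.
  - exact: bh.
  - exact: bhe.
  - by rewrite /step_phi; kmeas.
  - by move=> u; rewrite /step_phi !mulr_ge0 ?addr_ge0 ?mulr_ge0 ?powR_ge0 ?(ltW K0).
  - by kmeas.
  - by move=> u; rewrite mulr_ge0 ?powR_ge0 ?(ltW K0).
  - by move=> u w'; exact: bH.
  - by move=> u w'; exact: bHe.
  - by move=> u w'; exact: dH.
  - exact: laplace_scaled.
  - exact: step_le.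
pose k1 := A * (K * Dl * ((4 * K)^-1 * om t)).
have k10 : 0 <= k1 by rewrite !mulr_ge0 ?invr_ge0 ?powR_ge0 ?mulr_ge0 ?(ltW K0).
have AKB : 0 <= A * (K * B) by rewrite mulr_ge0// mulr_ge0// (ltW K0).
apply: (@le_trans _ _ (\int[leb2]_w ((k1 * (G s z w * G t w z'))%:E +
   (A * (K * B) * (db w * t `^ (2^-1 - 1) * (G s z w * G t w z')))%:E +
   (G s z w)%:E * E2 w))%E).
  apply: ge0_le_integral => //.
  - by move=> w _; rewrite lee_fin mulr_ge0.
  - by emeas.
  - apply: emeasurable_funD; last by apply: emeasurable_funM => //; emeas.
    by apply: emeasurable_funD; emeas.
  - move=> w _; rewrite EFinM.
    apply: (@le_trans _ _ ((G s z w)%:E * ((A * step_m w t * G t w z')%:E + E2 w))%E).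
      by apply: lee_wpmul2l => //; rewrite lee_fin.
    rewrite ge0_muleDr//; last first.
      by rewrite lee_fin; apply: mulr_ge0 => //; apply: mulr_ge0.
    apply: leeD => //; rewrite -EFinM -EFinD lee_fin /step_m /k1.
    by apply: eqr_le; ring.
rewrite ge0_integralD//; last 4 first.
- move=> w _; rewrite -EFinD lee_fin; apply: addr_ge0; apply: mulr_ge0 => //.
    exact: mulr_ge0.
  by apply: mulr_ge0; rewrite mulr_ge0 ?powR_ge0.
- by apply: emeasurable_funD; emeas.
- by move=> w _; rewrite mule_ge0// lee_fin.
- by apply: emeasurable_funM => //; emeas.
rewrite ge0_integralD//; last 4 first.
- by move=> w _; rewrite lee_fin mulr_ge0// mulr_ge0.
- by emeas.
- by move=> w _; rewrite lee_fin mulr_ge0// mulr_ge0// mulr_ge0 ?powR_ge0.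
- by emeas.
rewrite (space_integral_semigroup mG G0 GG)//.
rewrite integralZr_fin//; last 2 first.
- by kmeas.
- by move=> w _; rewrite !mulr_ge0 ?powR_ge0.
(* [G s] and [G u] merge into [G (s + u)], so the induction hypothesis applies under the time
   integral. *)
have -> : (\int[leb2]_w ((G s z w)%:E * E2 w) =
  \int[mu]_(u in 'oo_t) ((K * om u)%:E *
     \int[leb2]_w' (G (s + u) z w' * `|h r (t - u) w' z' - he r (t - u) w' z'|)%:E))%E.
  rewrite -(space_integral_conv mG G0 GG (f := fun t z w => h r t z w - he r t z w)
    (phi := fun u => K * om u) t z z' s0)//.
  - by apply: measurable_funB; [exact: mh|exact: mhe].
  - by kmeas.
  - by move=> u; rewrite mulr_ge0 ?powR_ge0 ?(ltW K0).
have [kk kkE] : exists kk, kk =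
    K * (Dc * 2^-1 ^+ r * expR (l * t) * Dl * G (s + t) z z') by eexists.
have kk0 : 0 <= kk by rewrite kkE !mulr_ge0 ?exprn_ge0 ?expR_ge0 ?(ltW K0).
have I3 : (\int[mu]_(u in 'oo_t) ((K * om u)%:E *
     \int[leb2]_w' (G (s + u) z w' * `|h r (t - u) w' z' - he r (t - u) w' z'|)%:E) <=
   (kk * ((4 * K)^-1 * (om s + om t)))%:E)%E.
  apply: (@le_trans _ _ (\int[mu]_(u in 'oo_t)
    ((kk * om s * (om u * expR (- (l * u))))%:E +
     (kk * (om u * expR (- (l * u)) * om (t - u)))%:E))%E).
    apply: ge0_le_integral => //.
    - move=> u _; rewrite mule_ge0 ?lee_fin ?mulr_ge0 ?powR_ge0 ?(ltW K0)//.
      by apply: integral_ge0 => w' _; rewrite lee_fin mulr_ge0.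
    - apply: measurable_funTS; apply: emeasurable_funM.
        by emeas.
      apply: (@measurable_space_integral _ _ _ _ (fun u w' =>
        (G (s + u) z w' * `|h r (t - u) w' z' - he r (t - u) w' z'|)%:E)).
      by emeas.
    - by apply: measurable_funTS; apply: emeasurable_funD; emeas.
    - move=> u /=; rewrite in_itv/= => /andP[u0 ut].
      have su0 : 0 < s + u by rewrite addr_gt0.
      have tu0 : 0 < t - u by rewrite subr_gt0.
      (* The times [s + u] and [t - u] have the same sum as [s] and [t], so the same [G (s + t)]
         comes out; this is why the induction runs over all [s] and [t]. Since [th <= 1], the
         singularity at [s + u] is at most that at [s]. *)
      have sutu : s + u + (t - u) = s + t by ring.
      have IHu := IH (s + u) (t - u) z z' su0 tu0.
      rewrite sutu in IHu.
      apply: (@le_trans _ _ ((K * om u)%:E * (Dc * 2^-1 ^+ r * expR (l * (t - u)) *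
        (om (s + u) + om (t - u)) * Dl * G (s + t) z z')%:E)%E).
        apply: lee_wpmul2l; last exact: IHu.
        by rewrite lee_fin mulr_ge0 ?powR_ge0 ?(ltW K0).
      rewrite -EFinM -EFinD lee_fin mulrBr expRD.
      have os : om (s + u) <= om s.
        by apply: powR_antitone; rewrite ?lerDl ?(ltW u0)// subr_le0.
      rewrite [leLHS](_ : _ = kk * (om u * expR (- (l * u))) * (om (s + u) + om (t - u))); last first.
        by rewrite kkE; ring.
      rewrite [leRHS](_ : _ = kk * (om u * expR (- (l * u))) * (om s + om (t - u))); last by ring.
      by rewrite ler_wpM2l ?lerD2r// !mulr_ge0 ?powR_ge0 ?expR_ge0.
  rewrite ge0_integralD//; last 4 first.
  - by move=> u _; rewrite lee_fin !mulr_ge0 ?expR_ge0 ?powR_ge0.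
  - by emeas.
  - by move=> u _; rewrite lee_fin !mulr_ge0 ?expR_ge0 ?powR_ge0.
  - by emeas.
  have kos : 0 <= kk * om s by rewrite mulr_ge0 ?powR_ge0.
  rewrite !integralZr_fin//; last 4 first.
  - by apply: measurable_funTS; kmeas.
  - by move=> u _; rewrite !mulr_ge0 ?expR_ge0 ?powR_ge0.
  - by apply: measurable_funTS; kmeas.
  - by move=> u _; rewrite !mulr_ge0 ?expR_ge0 ?powR_ge0.
  have [L1 L2] := laplace t0T.
  apply: (@le_trans _ _ ((kk * om s)%:E * ((4 * K)^-1)%:E + kk%:E * ((4 * K)^-1 * om t)%:E)%E).
    by apply: leeD; apply: lee_wpmul2l; rewrite ?lee_fin.
  rewrite -!EFinM -EFinD lee_fin; apply: eqr_le; ring.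
apply: (@le_trans _ _ ((k1 * G (s + t) z z')%:E +
  (A * (K * B))%:E * (K * Dl * (om s + om t) * G (s + t) z z')%:E +
  (kk * ((4 * K)^-1 * (om s + om t)))%:E)%E).
  apply: leeD => //; apply: leeD => //; apply: lee_wpmul2l; first by rewrite lee_fin.
  exact: drift.
rewrite -EFinM -!EFinD lee_fin.
have os := powR_ge0 s (th - 1); have ot := powR_ge0 t (th - 1).
have Kn0 : K != 0 by rewrite gt_eqF.
pose W := 2^-1 ^+ r * expR (l * t) * Dl * G (s + t) z z'.
have W0 : 0 <= W by rewrite !mulr_ge0 ?exprn_ge0 ?expR_ge0.
(* [K / 4] comes from the [Dl] part of [dH], [K ^+ 3 * B] from the drift and [Dc / 4] from the
   recursion; their sum is at most [Dc / 2]. *)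
rewrite [leLHS](_ : _ = W * (K / 4 * om t + (K ^+ 3 * B + Dc / 4) * (om s + om t))); last first.
  by rewrite kkE /k1 /A /W; field.
rewrite [leRHS](_ : _ = W * (Dc / 2 * (om s + om t))); last first.
  by rewrite /W exprS; field.
rewrite ler_wpM2l//.
apply: (@le_trans _ _ ((K / 4 + K ^+ 3 * B + Dc / 4) * (om s + om t))).
  rewrite -[K / 4 + K ^+ 3 * B + Dc / 4]addrA [(K / 4 + _) * _]mulrDl lerD2r.
  rewrite ler_wpM2l ?divr_ge0 ?(ltW K0)//.
  by rewrite lerDr.
rewrite ler_wpM2r ?addr_ge0//.
have : K / 4 + K ^+ 3 * B <= Dc / 4.
  by rewrite /stability_const; have := ltW K0; have := sqr_ge0 K; lra.
lra.
Qed.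

(** Convolution with [P] or [Pe], both dominated by [K * G], is exactly the average that
    [smoothed_difference] controls; this is how pointwise bounds are recovered. *)
Lemma parametrix_term_difference r t z z' : 0 < t <= T ->
  `|time_space_conv P (h r) t z z' - time_space_conv Pe (he r) t z z'| <=
  (K ^+ 2 + 2 * K * Dc) * expR (l * T) * (T `^ th / th) * 2^-1 ^+ r * Dl * G t z z'.
Proof.
move=> /[dup] t0T /andP[t0 tT]; rewrite -lee_fin.
have mhr := mh r; have mher := mhe r.
have KDl : 0 <= K * Dl by rewrite mulr_ge0 ?(ltW K0).
have Tth : 0 <= T `^ th / th by rewrite divr_ge0 ?powR_ge0 ?(ltW th0).
apply: le_trans (sub_conv_le (phi := fun=> K * Dl) (phif := fun=> K)
  (n := K * (T `^ th / th)) (m := Dl * (K * (T `^ th / th))) z' mP mPe mhr mher (A0 r) (@bh r) (@bhe r) _ _ _ _ _ _ _ t0T _ _) _ => //.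
- by move=> u; exact: ltW.
- by move=> u w; exact: bP.
- by move=> u w; exact: bPe.
- by move=> u w; exact: dP.
- exact: integral_smooth_le.
- have E u : K * Dl * expR (- (l * u)) * om (t - u) =
    Dl * (K * expR (- (l * u)) * om (t - u)) by ring.
  under eq_integral do rewrite E.
  rewrite integralZr_fin//; last 2 first.
  + by apply: measurable_funTS; kmeas.
  + by move=> u _; rewrite !mulr_ge0 ?expR_ge0 ?powR_ge0 ?(ltW K0).
  rewrite EFinM; apply: lee_wpmul2l; first by rewrite lee_fin.
  exact: integral_smooth_le.
have elt : expR (l * t) <= expR (l * T) by rewrite ler_expR ler_pM2l.
pose W := 2^-1 ^+ r * Dl * G t z z'.
have W0 : 0 <= W by rewrite !mulr_ge0 ?exprn_ge0.
have I2 : (\int[mu]_(u in 'oo_t) \int[leb2]_w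
     (K * (G u z w * `|h r (t - u) w z' - he r (t - u) w z'|))%:E <=
   (K * Dc * expR (l * T) * W * (2 * (T `^ th / th)))%:E)%E.
  have kk0 : 0 <= K * Dc * expR (l * T) * W by rewrite !mulr_ge0 ?expR_ge0 ?(ltW K0).
  apply: (@le_trans _ _ (\int[mu]_(u in 'oo_t)
    (K * Dc * expR (l * T) * W * (om u + om (t - u)))%:E)%E).
    apply: ge0_le_integral => //.
    - move=> u _; apply: integral_ge0 => w _.
      by rewrite lee_fin !mulr_ge0 ?(ltW K0).
    - apply: measurable_funTS.
      apply: (@measurable_space_integral _ _ _ _ (fun u w =>
        (K * (G u z w * `|h r (t - u) w z' - he r (t - u) w z'|))%:E)).
      by emeas.
    - by emeas.
    - move=> u /=; rewrite in_itv/= => /andP[u0 ut].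
      have tu0 : 0 < t - u by rewrite subr_gt0.
      have utu : u + (t - u) = t by ring.
      rewrite integralZr_fin ?(ltW K0)//; last 2 first.
      + by kmeas.
      + by move=> w _; rewrite mulr_ge0.
      have := @smoothed_difference r u (t - u) z z' u0 tu0.
      rewrite utu => /(_ tT) Su.
      apply: (@le_trans _ _ (K%:E * (Dc * 2^-1 ^+ r * expR (l * (t - u)) *
         (om u + om (t - u)) * Dl * G t z z')%:E)%E).
        by apply: lee_wpmul2l => //; rewrite lee_fin (ltW K0).
      rewrite -EFinM lee_fin.
      rewrite [leLHS](_ : _ = K * Dc * expR (l * (t - u)) * (W * (om u + om (t - u)))); last by rewrite /W; ring.
      rewrite -[leRHS]mulrA ler_wpM2r ?mulr_ge0 ?addr_ge0 ?powR_ge0//.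
      rewrite ler_wpM2l ?mulr_ge0 ?(ltW K0)// ler_expR ler_pM2l//.
      by rewrite (le_trans _ tT)// lerBlDr lerDl ltW.
  rewrite integralZr_fin//; last 2 first.
  - by apply: measurable_funTS; kmeas.
  - by move=> u _; rewrite addr_ge0 ?powR_ge0.
  rewrite [(_ * (2 * _))%:E]EFinM; apply: lee_wpmul2l => //.
  under eq_integral do rewrite EFinD.
  rewrite ge0_integralD//; last 4 first.
  - by move=> u _; rewrite lee_fin powR_ge0.
  - by emeas.
  - by move=> u _; rewrite lee_fin powR_ge0.
  - by emeas.
  have tTth : ((t `^ th / th)%:E <= (T `^ th / th)%:E)%E.
    by rewrite lee_fin ler_pM2r ?invr_gt0// ge0_ler_powR ?nnegrE ?(ltW th0) ?(ltW t0) ?(ltW T0).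
  rewrite (_ : 2 * _ = T `^ th / th + T `^ th / th); last by ring.
  rewrite EFinD; apply: leeD.
    exact: le_trans (integral_powR th0 t0) tTth.
  exact: le_trans (integral_powR_rev th0 t0) tTth.
apply: (@le_trans _ _ ((K * 2^-1 ^+ r * expR (l * t) * (Dl * (K * (T `^ th / th))) * G t z z')%:E +
  (K * Dc * expR (l * T) * W * (2 * (T `^ th / th)))%:E)%E).
  exact: leeD.
rewrite -EFinD lee_fin.
rewrite (_ : _ * _ * G t z z' = K ^+ 2 * expR (l * t) * W * (T `^ th / th)); last by rewrite /W; ring.
apply: (@le_trans _ _ (K ^+ 2 * expR (l * T) * W * (T `^ th / th) +
  K * Dc * expR (l * T) * W * (2 * (T `^ th / th)))).
  by rewrite lerD2r ler_wpM2r// ler_wpM2r// ler_wpM2l// sqr_ge0.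
by apply: eqr_le; rewrite /W; ring.
Qed.

Lemma parametrix_term_bound (Q : R -> V -> V -> R) (k : R -> V -> V -> R) r t z z' :
  measurable_kernel Q -> measurable_kernel k ->
  (forall t z w, 0 < t <= T -> `|Q t z w| <= K * G t z w) ->
  (forall t w w', 0 < t <= T ->
    `|k t w w'| <= K * 2^-1 ^+ r * expR (l * t) * om t * G t w w') ->
  0 < t <= T ->
  `|time_space_conv Q k t z z'| <=
  (K ^+ 2 * expR (l * T) * (T `^ th / th) * G t z z') * 2^-1 ^+ r.
Proof.
move=> mQ mk bQ bk /[dup] t0T /andP[t0 tT].
have K'0 (u : R) : 0 <= K by exact: ltW.
have [_ _ /le_trans] := conv_iter_majorant z' mQ mk (A0 r) bk (measurable_cst K)
  K'0 (fun u w => bQ u z w) t0T (integral_smooth_le t0T).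
apply; rewrite [leLHS](_ : _ =
  (K ^+ 2 * (T `^ th / th) * G t z z' * 2^-1 ^+ r) * expR (l * t)); last by ring.
rewrite [leRHS](_ : _ = (K ^+ 2 * (T `^ th / th) * G t z z' * 2^-1 ^+ r) * expR (l * T)); last by ring.
rewrite ler_wpM2l ?ler_expR ?ler_pM2l//.
rewrite mulr_ge0 ?exprn_ge0// mulr_ge0// mulr_ge0 ?exprn_ge0 ?(ltW K0)//.
by rewrite divr_ge0 ?powR_ge0 ?(ltW th0).
Qed.

Lemma parametrix_series_difference t z z' : 0 < t <= T ->
  `|limn (series (fun r => (if r is k.+1 then time_space_conv P (h k) else P) t z z')) -
    limn (series (fun r => (if r is k.+1 then time_space_conv Pe (he k) else Pe) t z z'))| <=
  2 * (K + 2 * ((K ^+ 2 + 2 * K * Dc) * expR (l * T) * (T `^ th / th))) * Dl * G t z z'.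
Proof.
move=> t0T; set C := (K ^+ 2 + 2 * K * Dc) * expR (l * T) * (T `^ th / th).
have C0 : 0 <= C.
  by rewrite !mulr_ge0 ?addr_ge0 ?mulr_ge0 ?invr_ge0 ?expR_ge0 ?powR_ge0 ?sqr_ge0 ?(ltW K0) ?(ltW th0).
pose M := K * G t z z' + 2 * (K ^+ 2 * expR (l * T) * (T `^ th / th) * G t z z').
have KG0 : 0 <= K * G t z z' by rewrite mulr_ge0// ltW.
have KG1 : 0 <= K ^+ 2 * expR (l * T) * (T `^ th / th) * G t z z'.
  by rewrite !mulr_ge0 ?invr_ge0 ?expR_ge0 ?powR_ge0 ?exprn_ge0 ?(ltW K0) ?(ltW th0).
have bnd (a b : R) r : 0 <= a -> b * 2^-1 ^+ r <= (a + 2 * b) * 2^-1 ^+ r.+1.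
  move=> a0; rewrite exprS (_ : (a + 2 * b) * _ = a / 2 * 2^-1 ^+ r + b * 2^-1 ^+ r); last by field.
  by rewrite lerDr !mulr_ge0 ?exprn_ge0.
rewrite -2!mulrA; apply: (@geometric_series_sub R _ _ M) => -[|r].
- by rewrite expr0 mulr1; apply: le_trans (bP _ _ t0T) _; rewrite lerDl mulr_ge0.
- by apply: (le_trans _ (bnd _ _ _ KG0)); apply: parametrix_term_bound => //; exact: bh.
- by rewrite expr0 mulr1; apply: le_trans (bPe _ _ t0T) _; rewrite lerDl mulr_ge0.
- by apply: (le_trans _ (bnd _ _ _ KG0)); apply: parametrix_term_bound => //; exact: bhe.
- rewrite expr0 mulr1; apply: le_trans (dP _ _ t0T) _.
  rewrite -mulrA ler_wpM2r// ?mulr_ge0// lerDl mulr_ge0//.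
- rewrite (_ : (K + 2 * C) * (Dl * G t z z') = K * (Dl * G t z z') + 2 * (C * (Dl * G t z z'))); last by ring.
  apply: (le_trans _ (bnd _ _ _ _)); last by rewrite !mulr_ge0// ltW.
  apply: le_trans (parametrix_term_difference _ _ _ t0T) _.
  by apply: eqr_le; rewrite /C; ring.
Qed.

End parametrix_stability.

(** * Smoothing of the drift difference *)

Section drift_hoelder.
Context {R : realType} {d : nat}.
Local Notation V := ('cV[R]_d * 'cV[R]_d)%type.
Local Notation kd := (@kolmogorov_density R d).
Local Notation leb2 := (@leb2 R d).
Variable c : R.
Hypothesis c0 : 0 < c.

Definition kolmogorov_peak (t : R) : R :=
  c ^+ d * 3 `^ (d%:R / 2) / (2 * pi * t ^+ 2) ^+ d.

Definition kolmogorov_form (t : R) (z z' : V) : R :=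
  mx_enorm (z'.1 - z.1) ^+ 2 / (4 * t) +
    3 * (mx_enorm (z'.2 - z.2 - (t / 2) *: (z.1 + z'.1)) ^+ 2 / t ^+ 3).

Lemma kolmogorov_densityE t z z' :
  kd c t z z' = kolmogorov_peak t * expR (- c * kolmogorov_form t z z').
Proof. by []. Qed.

Lemma kolmogorov_peak_gt0 t : 0 < t -> 0 < kolmogorov_peak t.
Proof.
move=> t0; rewrite divr_gt0// ?mulr_gt0 ?powR_gt0 ?exprn_gt0//.
by rewrite mulr_gt0 ?exprn_gt0// mulr_gt0// pi_gt0.
Qed.

Lemma kolmogorov_density_scale p t z z' : 0 < p -> 0 < t ->
  kolmogorov_density (c * p) t z z' =
  p ^+ d * kolmogorov_peak t * expR (- c * kolmogorov_form t z z') `^ p.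
Proof.
move=> p0 t0; rewrite -expRM /kolmogorov_density -/(kolmogorov_form t z z').
rewrite (_ : - (c * p) * _ = - c * kolmogorov_form t z z' * p); last by ring.
by congr (_ * _); rewrite /kolmogorov_peak exprMn; ring.
Qed.

(* The p-th power of the kernel with constant [c] is a multiple of the kernel
   with constant [c p], for which the semigroup property applies. *)
Lemma integral_kolmogorov_powR p s t z z' : 0 < p -> 0 < s -> 0 < t ->
  (\int[leb2]_w ((kd c s z w * kd c t w z') `^ p)%:E =
   (p ^- d * (kolmogorov_peak s * kolmogorov_peak t / kolmogorov_peak (s + t)) `^ (p - 1) *
    kd c (s + t) z z' `^ p)%:E)%E.
Proof.
move=> p0 s0 t0; have st0 : 0 < s + t by rewrite addr_gt0.
have ps := kolmogorov_peak_gt0 s0; have pt := kolmogorov_peak_gt0 t0.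
have pst := kolmogorov_peak_gt0 st0.
have pn0 : p != 0 by rewrite gt_eqF.
have E (a : R) : 0 < a -> a `^ p = a `^ (p - 1) * a.
  move=> a0; have := @powRD _ a (p - 1) 1; rewrite subrK (powRr1 (ltW a0)).
  by apply; rewrite (gt_eqF a0) implybT.
have k0 a (x y : V) : 0 < a -> kd c a x y `^ p =
    kolmogorov_peak a `^ (p - 1) * (p ^- d * kolmogorov_density (c * p) a x y).
  move=> a0; have pa := kolmogorov_peak_gt0 a0.
  rewrite kolmogorov_densityE powRM ?expR_ge0 ?(ltW pa)// E//.
  rewrite kolmogorov_density_scale//; field.
  by rewrite expf_neq0.
have E2 w : (kd c s z w * kd c t w z') `^ p =
   kolmogorov_peak s `^ (p - 1) * kolmogorov_peak t `^ (p - 1) * p ^- d * p ^- d *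
   (kolmogorov_density (c * p) s z w * kolmogorov_density (c * p) t w z').
  by rewrite powRM ?kolmogorov_density_ge0// !k0//; ring.
have cp0 : 0 < c * p by rewrite mulr_gt0.
under eq_integral do rewrite E2.
rewrite (space_integral_semigroup (G := kolmogorov_density (c * p)))//; first last.
- by rewrite !mulr_ge0 ?powR_ge0 ?invr_ge0 ?exprn_ge0 ?(ltW p0).
- move=> a b x y a0 b0.
  have := @kolmogorov_density_semigroup R d (c * p) a (a + b) x y cp0 a0.
  by rewrite ltrDl addrAC subrr add0r => /(_ b0).
- by move=> a x y; rewrite kolmogorov_density_ge0.
- by apply: measurable_kolmogorov_density; kmeas.
congr EFin; rewrite k0//.
have pp : 0 <= kolmogorov_peak s * kolmogorov_peak t.
  by apply: mulr_ge0; exact: ltW.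
rewrite (powRM _ pp) ?invr_ge0 ?(ltW pst)// (powRM _ (ltW ps) (ltW pt)).
have Ei : (kolmogorov_peak (s + t))^-1 `^ (p - 1) * kolmogorov_peak (s + t) `^ (p - 1) = 1.
  by rewrite -powRM ?invr_ge0 ?(ltW pst)// mulVf ?gt_eqF// powR1.
rewrite [RHS](_ : _ = kolmogorov_peak s `^ (p - 1) * kolmogorov_peak t `^ (p - 1) *
   p ^- d * p ^- d * kolmogorov_density (c * p) (s + t) z z' *
   ((kolmogorov_peak (s + t))^-1 `^ (p - 1) * kolmogorov_peak (s + t) `^ (p - 1))).
  by rewrite Ei mulr1.
ring.
Qed.

Definition kolmogorov_peak1 : R := c ^+ d * 3 `^ (d%:R / 2) / (2 * pi) ^+ d.

Lemma kolmogorov_peak1_gt0 : 0 < kolmogorov_peak1.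
Proof.
rewrite divr_gt0// ?mulr_gt0 ?powR_gt0 ?exprn_gt0//.
by rewrite mulr_gt0// pi_gt0.
Qed.

(** The peak is proportional to [t^(-2d)], so the ratio is a power of [(s + t) / (s t)]. *)
Lemma kolmogorov_peak_ratio s t : 0 < s -> 0 < t ->
  kolmogorov_peak s * kolmogorov_peak t / kolmogorov_peak (s + t) =
  kolmogorov_peak1 * (s^-1 + t^-1) ^+ (2 * d).
Proof.
move=> s0 t0; have st0 : 0 < s + t by rewrite addr_gt0.
have sn0 : s != 0 by rewrite gt_eqF. have tn0 : t != 0 by rewrite gt_eqF.
have stn0 : s + t != 0 by rewrite gt_eqF.
have E a : 0 < a -> kolmogorov_peak a = kolmogorov_peak1 * (a ^- 2) ^+ d.
  by move=> a0; rewrite /kolmogorov_peak /kolmogorov_peak1 exprMn invfM exprVn mulrA.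
have k0 : kolmogorov_peak1 != 0 by rewrite gt_eqF// kolmogorov_peak1_gt0.
have Cd : (s + t) ^- 2 ^+ d != 0 by rewrite expf_neq0// invr_neq0// expf_neq0.
rewrite !E//; transitivity (kolmogorov_peak1 * (s ^- 2 * t ^- 2 / (s + t) ^- 2) ^+ d).
  by rewrite expr_div_n exprMn; field; rewrite k0 Cd.
rewrite exprM; congr (_ * _ ^+ d).
by field; rewrite sn0 tn0 stn0.
Qed.

Lemma Lnorm_kolmogorov p s t z z' : 1 < p -> 0 < s -> 0 < t ->
  (Lnorm leb2 p%:E (EFin \o
     (fun w => kd c s z w * kd c t w z')%R) <=
   (kolmogorov_peak1 `^ ((p - 1) / p) * (s^-1 + t^-1) `^ ((2 * d)%:R * ((p - 1) / p)) *
    kd c (s + t) z z')%:E)%E.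
Proof.
move=> p1 s0 t0; have p0 : 0 < p by rewrite (lt_trans _ p1).
have G0 := @kolmogorov_density_ge0 R d c.
have e0 : 0 <= (p - 1) / p by rewrite divr_ge0 ?(ltW p0)// subr_ge0 ltW.
have st0 : 0 <= s^-1 + t^-1 by rewrite addr_ge0 ?invr_ge0 ?ltW.
have GG0 w : 0 <= kd c s z w * kd c t w z'.
  by apply: mulr_ge0; exact: G0.
rewrite unlock /=; under eq_integral do rewrite /= ger0_norm//.
rewrite integral_kolmogorov_powR// poweR_EFin lee_fin kolmogorov_peak_ratio//.
move: (kolmogorov_peak1) (ltW kolmogorov_peak1_gt0) (kd c _ _ _)
  (G0 (s + t) z z' c0) (s^-1 + t^-1) st0 => k k1 g g0 X X0.
have pd0 : 0 <= p ^- d by rewrite invr_ge0 exprn_ge0 ?(ltW p0).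
have Xd0 : 0 <= X ^+ (2 * d) by rewrite exprn_ge0.
have kX0 : 0 <= (k * X ^+ (2 * d)) `^ (p - 1) by exact: powR_ge0.
rewrite (powRM _ (mulr_ge0 pd0 kX0) (powR_ge0 _ _)) -[_ `^ p `^ p^-1]powRrM.
rewrite divff ?gt_eqF// (powRr1 g0) ler_wpM2r// (powRM _ pd0 kX0).
rewrite -[_ `^ (p - 1) `^ p^-1]powRrM (powRM _ k1 Xd0) -[X ^+ _]powR_mulrn//.
rewrite -[X `^ _ `^ _]powRrM -[leRHS]mul1r ler_wpM2r ?mulr_ge0 ?powR_ge0//.
(* What is left to bound is a root of [p ^- d], at most 1 because [p > 1]. *)
have -> : 1 = 1 `^ p^-1 :> R by rewrite powR1.
apply: ge0_ler_powR; rewrite ?invr_ge0 ?nnegrE ?(ltW p0)//.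
by rewrite invf_le1 ?exprn_gt0// exprn_ege1// ltW.
Qed.

End drift_hoelder.

(** Both factors are compared with powers of the smaller time [m], and a power of [m] is one of the
    two summands. *)
Lemma powR_sum_le {R : realType} (s t a : R) : 0 < s -> 0 < t -> 0 <= a <= 1 ->
  (s^-1 + t^-1) `^ a * t `^ (2^-1 - 1) <=
  2 * (s `^ (- (a + 2^-1)) + t `^ (- (a + 2^-1))).
Proof.
move=> s0 t0 /andP[a0 a1].
pose m := Num.min s t.
have m0 : 0 < m by rewrite lt_min s0.
have ms : m <= s by rewrite ge_min lexx.
have mt : m <= t by rewrite ge_min lexx orbT.
have h : (s^-1 + t^-1) `^ a <= 2 * m `^ (- a).
  apply: (@le_trans _ _ ((2 * m^-1) `^ a)).
    apply: ge0_ler_powR => //; rewrite ?nnegrE ?addr_ge0 ?mulr_ge0 ?invr_ge0 ?(ltW s0) ?(ltW t0) ?(ltW m0)//.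
    by rewrite mulr2n mulrDl mul1r lerD// lef_pV2.
  rewrite powRM ?invr_ge0 ?(ltW m0)// -(powR_inv1 (ltW m0)).
  rewrite -[m `^ (-1) `^ a]powRrM mulN1r ler_wpM2r ?powR_ge0//.
  by rewrite -[leRHS]powRr1// ler_powR// ler1n.
have h2 : t `^ (2^-1 - 1) <= m `^ (- 2^-1).
  rewrite (_ : 2^-1 - 1 = - 2^-1); last by field.
  by apply: powR_antitone => //; rewrite oppr_le0 invr_ge0.
apply: (le_trans (ler_pM (powR_ge0 _ _) (powR_ge0 _ _) h h2)).
rewrite -mulrA -powRD; last by rewrite (gt_eqF m0) implybT.
rewrite -opprD ler_pM2l//.
by rewrite /m; case: (leP s t) => _; rewrite ?lerDl ?lerDr powR_ge0.
Qed.

Section drift_bound.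
Context {R : realType} {d : nat}.
Local Notation V := ('cV[R]_d * 'cV[R]_d)%type.
Local Notation kd := (@kolmogorov_density R d).
Local Notation leb2 := (@leb2 R d).

(** The exponent of [s^-1 + t^-1] produced by Hoelder's inequality; for [q = +oo] no power is
    lost. *)
Definition drift_exponent (q : \bar R) : R :=
  if q is r%:E then (2 * d)%:R / r else 0.

Lemma drift_smoothing (c : R) (q : \bar R) (T th : R) : 0 < c -> (0 < d)%N ->
  ((4 * d)%:R%:E < q)%E -> 0 < T -> 0 < th -> th <= 2^-1 - drift_exponent q ->
  exists2 C : R, 0 < C & forall (f : V -> R) (N : R),
    measurable_fun setT f -> (forall w, 0 <= f w) ->
    (Lnorm leb2 q (EFin \o f) <= N%:E)%E ->
    forall s t z z', 0 < s -> 0 < t -> s + t <= T ->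
    (\int[leb2]_w (f w * t `^ (2^-1 - 1) *
       (kd c s z w * kd c t w z'))%:E <=
     (C * N * (s `^ (th - 1) + t `^ (th - 1)) *
       kd c (s + t) z z')%:E)%E.
Proof.
move=> c0 d0 dq T0 th0 thq.
have G0 t z w : 0 <= kd c t z w by apply: kolmogorov_density_ge0.
have mG := @measurable_kolmogorov_density R d.
have a01 : 0 <= drift_exponent q <= 1.
  apply/andP; split.
    rewrite /drift_exponent; case: q dq {thq} => [r|//|//]; rewrite lte_fin => dr.
    by rewrite divr_ge0// (le_trans _ (ltW dr)).
  have : drift_exponent q <= 2^-1 by lra.
  by lra.
pose k : R := if q is r%:E then kolmogorov_peak1 (d := d) c `^ r^-1 else 1.
have k0 : 0 < k.
  by rewrite /k; case: (q) => [r||]//; rewrite powR_gt0// kolmogorov_peak1_gt0.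
have key (f : V -> R) (N : R) : measurable_fun setT f -> (forall w, 0 <= f w) ->
    (Lnorm leb2 q (EFin \o f) <= N%:E)%E ->
    forall s t z z', 0 < s -> 0 < t ->
    (\int[leb2]_w (f w *
       (kd c s z w * kd c t w z'))%:E <=
     (k * N * (s^-1 + t^-1) `^ drift_exponent q *
       kd c (s + t) z z')%:E)%E.
  move=> mf f0 fN s t z z' s0 t0.
  have st0 : s^-1 + t^-1 != 0 by rewrite gt_eqF// addr_gt0 ?invr_gt0.
  have N0 : 0 <= N by rewrite -lee_fin (le_trans _ fN)// Lnorm_ge0.
  have GG0 w : 0 <= kd c s z w * kd c t w z'.
    by apply: mulr_ge0; exact: kolmogorov_density_ge0.
  have mGG : measurable_fun setT (fun w => kd c s z w * kd c t w z').
    by apply: measurable_funM; apply: mG; kmeas.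
  case: q dq thq a01 @k k0 fN => [q|_|//].
    rewrite lte_fin => dq _ _ k k0 fN.
    have q1 : 1 < q by rewrite (le_lt_trans _ dq)// ler1n muln_gt0.
    have q0 : 0 < q by rewrite (lt_trans _ q1).
    have qn0 : q != 0 by rewrite gt_eqF.
    have q1n0 : q - 1 != 0 by rewrite subr_eq0 gt_eqF.
    (* The conjugate exponent; [(p - 1) / p = q^-1] turns the exponent of [Lnorm_kolmogorov] into
       [2 d / q]. *)
    pose p := q / (q - 1).
    have p1 : 1 < p by rewrite ltr_pdivlMr ?subr_gt0// mul1r ltrBlDr ltrDl.
    have pq : (p - 1) / p = q^-1 by rewrite /p; field; rewrite qn0 q1n0.
    have := @hoelder _ _ R leb2 f (fun w => kd c s z w * kd c t w z') q p mf mGG q0 (lt_trans ltr01 p1).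
    have -> : q^-1 + p^-1 = 1 by rewrite /p; field; rewrite qn0 q1n0.
    move=> /(_ erefl); rewrite Lnorm1 => H.
    rewrite [leLHS](_ : _ = (\int[leb2]_w `|(EFin \o (f \* (fun w => kd c s z w * kd c t w z'))%R) w|)%E); last first.
      by apply: eq_integral => w _ /=; rewrite ger0_norm//; exact: mulr_ge0.
    apply: (le_trans H).
    apply: (@le_trans _ _ (N%:E * (k * (s^-1 + t^-1) `^ drift_exponent q%:E *
       kd c (s + t) z z')%:E)%E).
      apply: lee_pmul => //; try exact: Lnorm_ge0.
      apply: (le_trans (Lnorm_kolmogorov c0 z z' p1 s0 t0)).
      by rewrite pq /k /drift_exponent.
    by rewrite -EFinM lee_fin; apply: eqr_le; ring.
  (* For [q = +oo] the norm is an essential supremum, so [f <= N] almost everywhere and the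
     semigroup property suffices. *)
  move=> _ _ k k0; rewrite unlock /= => fN.
  have E : (\int[leb2]_w (N * (kd c s z w * kd c t w z'))%:E =
     (k * N * (s^-1 + t^-1) `^ 0 * kd c (s + t) z z')%:E)%E.
    rewrite integralZr_fin//.
    have := @kolmogorov_density_semigroup R d c s (s + t) z z' c0 s0.
    rewrite ltrDl addrAC subrr add0r => /(_ t0) ->.
    by rewrite -EFinM powRr0 /k mul1r mulr1.
  rewrite -E.
  (* On a space of measure zero the norm at [+oo] is 0 by convention and says nothing about [f], but
     then the integral of [f] vanishes. *)
  have [mu0|] := ltP 0%E (leb2 setT); last first.
    rewrite le_eqVlt => /orP[/eqP mu0|]; last by rewrite ltNge measure_ge0.
    rewrite null_set_integral//; last by apply/measurable_EFinP; apply: measurable_funM.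
    by apply: integral_ge0 => w _; rewrite lee_fin; exact: mulr_ge0.
  rewrite mu0 in fN; move/ess_supP : fN => fN.
  apply: ae_ge0_le_integral => //.
  - by move=> w _; rewrite lee_fin; exact: mulr_ge0.
  - by apply/measurable_EFinP; apply: measurable_funM.
  - by move=> w _; rewrite lee_fin; exact: mulr_ge0.
  - by apply/measurable_EFinP; apply: measurable_funM.
  - apply: filterS fN => w + _ /=; rewrite lee_fin ger0_norm// => fN.
    by rewrite lee_fin ler_wpM2r.
(* The exponent [th] may be smaller than [1/2 - 2 d / q]; the surplus becomes a power of [T]. *)
pose C := k * 2 * T `^ (2^-1 - drift_exponent q - th).
exists C; first by rewrite !mulr_gt0 ?powR_gt0.
move=> f N mf f0 fN s t z z' s0 t0 stT.
have N0 : 0 <= N by rewrite -lee_fin (le_trans _ fN)// Lnorm_ge0.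
have E w : f w * t `^ (2^-1 - 1) * (kd c s z w * kd c t w z') =
  t `^ (2^-1 - 1) * (f w * (kd c s z w * kd c t w z')) by ring.
under eq_integral do rewrite E.
rewrite integralZr_fin ?powR_ge0//; last 2 first.
- by apply: measurable_funM => //; apply: measurable_funM; apply: mG; kmeas.
- by move=> w _; apply: mulr_ge0 => //; apply: mulr_ge0; exact: kolmogorov_density_ge0.
apply: (@le_trans _ _ ((t `^ (2^-1 - 1))%:E * (k * N * (s^-1 + t^-1) `^ drift_exponent q *
       kd c (s + t) z z')%:E)%E).
  by apply: lee_wpmul2l; [rewrite lee_fin powR_ge0|exact: key].
rewrite -EFinM lee_fin.
rewrite [leLHS](_ : _ = k * N * kd c (s + t) z z' *
  ((s^-1 + t^-1) `^ drift_exponent q * t `^ (2^-1 - 1))); last by ring.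
rewrite [leRHS](_ : _ = k * N * kd c (s + t) z z' *
  (2 * (T `^ (2^-1 - drift_exponent q - th) * s `^ (th - 1) +
        T `^ (2^-1 - drift_exponent q - th) * t `^ (th - 1)))); last by rewrite /C; ring.
apply: ler_wpM2l.
  apply: mulr_ge0; last exact: kolmogorov_density_ge0.
  by apply: mulr_ge0 => //; exact: ltW.
apply: (le_trans (powR_sum_le s0 t0 a01)); rewrite ler_pM2l//.
have mono x : 0 < x -> x <= T -> x `^ (- (drift_exponent q + 2^-1)) <=
    T `^ (2^-1 - drift_exponent q - th) * x `^ (th - 1).
  move=> x0 xT.
  rewrite (_ : - (_ + _) = (2^-1 - drift_exponent q - th) + (th - 1)); last by field.
  rewrite [leLHS]powRD; last by rewrite (gt_eqF x0) implybT.
  rewrite ler_wpM2r ?powR_ge0// ge0_ler_powR ?nnegrE ?(ltW x0) ?(ltW T0)//.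
  by rewrite subr_ge0.
by apply: lerD; apply: mono => //; rewrite (le_trans _ stT)// ?lerDl ?lerDr ltW.
Qed.

End drift_bound.

(** * Elliptic covariance matrices *)

Section elliptic_matrices.
Context {R : realType}.

Definition qf n (N : 'M[R]_n) (u v : 'cV[R]_n) : R :=
  \sum_i \sum_j u i ord0 * N i j * v j ord0.

Definition sqn n (v : 'cV[R]_n) : R := \sum_i v i ord0 ^+ 2.

Lemma qfE n (N : 'M[R]_n) u v : (u^T *m N *m v) ord0 ord0 = qf N u v.
Proof.
rewrite mxE /qf exchange_big/=; apply: eq_bigr => j _.
by rewrite mxE mulr_suml; apply: eq_bigr => i _; rewrite mxE.
Qed.

Lemma sqn_ge0 n (v : 'cV[R]_n) : 0 <= sqn v.
Proof. by apply: sumr_ge0 => i _; exact: sqr_ge0. Qed.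

Lemma sqn_eq0 n (v : 'cV[R]_n) : sqn v <= 0 -> v = 0.
Proof.
move=> v0; have /eqP : sqn v = 0 by apply/eqP; rewrite eq_le v0 sqn_ge0.
rewrite psumr_eq0; last by move=> i _; exact: sqr_ge0.
move=> /allP v0'; apply/colP => i; rewrite mxE; apply/eqP.
by have := v0' i (mem_index_enum _); rewrite /= sqrf_eq0.
Qed.

Lemma sqr_le_sqn n (v : 'cV[R]_n) i : v i ord0 ^+ 2 <= sqn v.
Proof. by rewrite /sqn (bigD1 i)//= lerDl sumr_ge0// => j _; exact: sqr_ge0. Qed.

Lemma norm_le_sqn n (v : 'cV[R]_n) i : `|v i ord0| <= Num.sqrt (sqn v).
Proof. by rewrite -sqrtr_sqr ler_wsqrtr// sqr_le_sqn. Qed.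

Record elliptic_mx (lam mu : R) n (M : 'M[R]_n) : Prop := {
  elliptic_lb : forall v, lam * sqn v <= qf M v v ;
  elliptic_ub : forall i j, `|M i j| <= mu }.

Lemma elliptic_unit lam n (M : 'M[R]_n) : 0 < lam ->
  (forall v, lam * sqn v <= qf M v v) -> M \in unitmx.
Proof.
move=> lam0 lb; rewrite -row_free_unit -kermx_eq0; apply/eqP/eqP; apply/rowV0P => u.
move=> /sub_kermxP uM0; apply: trmx_inj; rewrite trmx0.
apply: sqn_eq0; rewrite -(pmulr_rle0 _ lam0) (le_trans (lb _))//.
by rewrite -qfE trmxK uM0 mul0mx mxE.
Qed.

(** For [v] the [j]-th column of the inverse, ellipticity reads [lam |v|^2 <= v_j], and
    [v_j <= |v|]; so [|v| <= lam^-1]. *)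
Lemma elliptic_inv_le lam n (M : 'M[R]_n) i j : 0 < lam ->
  (forall v, lam * sqn v <= qf M v v) -> `|invmx M i j| <= lam^-1.
Proof.
move=> lam0 lb; have uM := elliptic_unit lam0 lb.
pose v := invmx M *m (delta_mx j ord0 : 'cV_n).
have vE k : v k ord0 = invmx M k j.
  rewrite mxE (bigD1 j)//= mxE !eqxx mulr1 big1 ?addr0// => l lj.
  by rewrite mxE (negbTE lj) mulr0.
have := lb v; rewrite -qfE -mulmxA /v mulKVmx// -/v.
rewrite (_ : (_ *m _) ord0 ord0 = v j ord0); last first.
  rewrite mxE (bigD1 j)//= [v^T _ _]mxE [delta_mx _ _ _ _]mxE !eqxx mulr1.
  by rewrite big1 ?addr0// => l lj; rewrite [delta_mx _ _ _ _]mxE (negbTE lj) mulr0.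
move=> h.
have vj0 : 0 <= v j ord0 by apply: le_trans h; rewrite mulr_ge0 ?sqn_ge0 ?ltW.
have vj : v j ord0 <= lam^-1.
  have [->|vjn0] := eqVneq (v j ord0) 0; first by rewrite invr_ge0 ltW.
  have vjp : 0 < v j ord0 by rewrite lt_neqAle eq_sym vjn0.
  rewrite -(ler_pM2l lam0) divff ?gt_eqF// -(ler_pM2r vjp) mul1r -mulrA -expr2.
  by rewrite (le_trans _ h)// ler_pM2l// sqr_le_sqn.
have : sqn v <= lam^-1 ^+ 2.
  by rewrite -(ler_pM2l lam0) (le_trans h)// expr2 mulrA divff ?gt_eqF// mul1r.
move=> /(le_trans (sqr_le_sqn v i)); rewrite vE -[_ ^+ 2 <= _]ler_sqrt ?sqr_ge0//.
by rewrite !sqrtr_sqr [X in _ <= X]ger0_norm// invr_ge0 ltW.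
Qed.

(* The determinant does not vanish on the segment from the identity to [M]. *)
Lemma elliptic_det_gt0 lam n (M : 'M[R]_n) : 0 < lam ->
  (forall v, lam * sqn v <= qf M v v) -> 0 < \det M.
Proof.
move=> lam0 lb.
have nz s : 0 <= s <= 1 -> \det ((1 - s)%:M + s *: M) != 0.
  move=> /andP[s0 s1]; have l0 : 0 < (1 - s) + s * lam.
    have [->|sn0] := eqVneq s 0; first by rewrite mul0r subr0 addr0.
    by rewrite ltr_wpDl ?subr_ge0// mulr_gt0// lt_neqAle eq_sym sn0.
  rewrite -unitfE -unitmxE; apply: (elliptic_unit l0) => //.
  move=> v; rewrite -qfE mulmxDr mulmxDl mxE mulrDl; apply: lerD.
    rewrite -scalemx1 -scalemxAr mulmx1 -scalemxAl mxE.
    apply: eqr_le; congr (_ * _).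
    by rewrite mxE; apply: eq_bigr => i _; rewrite mxE -expr2.
  rewrite -scalemxAr -scalemxAl mxE qfE -mulrA.
  by rewrite ler_wpM2l.
(* Along the segment the determinant is a polynomial in the parameter with value 1 at 0; a
   nonpositive value at 1 would force a root between. *)
pose p := \det ((1 - 'X)%:M + 'X *: map_mx polyC M).
have pE s : p.[s] = \det ((1 - s)%:M + s *: M).
  rewrite -horner_evalE -det_map_mx; congr (\det _); apply/matrixP => i j.
  rewrite !mxE /= horner_evalE hornerD hornerM hornerX hornerC; congr (_ + _).
  by rewrite !mulrb; case: eqP; rewrite ?hornerE.
have pn : forall s, 0 <= s <= 1 -> p.[s] != 0 by move=> s /nz; rewrite pE.
have p1 : p.[1] = \det M by rewrite pE subrr scale1r (_ : 0%:M = 0) ?add0r//;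
  apply/matrixP => i j; rewrite !mxE mul0rn.
have p0 : p.[0] = 1 by rewrite pE subr0 scale0r addr0 det1.
rewrite ltNge; apply/negP => detM.
have := @poly_ivt R (- p) 0 1 ler01.
rewrite !hornerN p0 p1 oppr_le0 ler01 oppr_ge0 detM => /(_ isT)[s].
move=> s01 /rootP; rewrite hornerN => /eqP; rewrite oppr_eq0;
  apply/negP; exact: pn.
Qed.

(** With [z = M v] the inverse form at [z] is the form of [M] at [v], at least [lam |v|^2], while
    the entry bound gives [|z|^2 <= n^3 mu^2 |v|^2]. *)
Lemma elliptic_invform_ge lam mu n (M : 'M[R]_n) z : 0 < lam -> 0 < mu ->
  elliptic_mx lam mu M ->
  lam / (n%:R ^+ 3 * mu ^+ 2) * sqn z <= qf (invmx M) z z.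
Proof.
move=> lam0 mu0 [lb ub]; have uM := elliptic_unit lam0 lb.
have [n0|n0] := posnP n.
  subst n; rewrite expr0n/= mul0r invr0 mulr0 mul0r /qf big_ord0//.
pose v := invmx M *m z.
have zE : z = M *m v by rewrite /v mulKVmx.
have -> : qf (invmx M) z z = qf M v v.
  rewrite -!qfE -mulmxA -/v [in LHS]zE trmx_mul.
  have -> : v^T *m M^T *m v = (v^T *m M *m v)^T.
    by clearbody v; rewrite !trmx_mul trmxK mulmxA. 
  by rewrite [LHS]mxE.
apply: le_trans (lb v); rewrite -mulrA ler_pM2l// mulrC ler_pdivrMr; last first.
  by rewrite mulr_gt0 ?exprn_gt0// ltr0n.
pose s := Num.sqrt (sqn v).
have s0 : 0 <= s by exact: sqrtr_ge0.
have zi i : `|z i ord0| <= n%:R * (mu * s).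
  rewrite zE mxE (le_trans (ler_norm_sum _ _ _))//.
  apply: (@le_trans _ _ (\sum_(j < n) (mu * s))).
    by apply: ler_sum => j _; rewrite normrM ler_pM// norm_le_sqn.
  by rewrite sumr_const card_ord mulr_natl.
rewrite /sqn; apply: (@le_trans _ _ (\sum_(i < n) (n%:R * (mu * s)) ^+ 2)).
  apply: ler_sum => i _; rewrite -[X in X <= _]real_normK ?num_real//.
  rewrite ler_sqr ?nnegrE// ?zi//; apply: mulr_ge0 => //; apply: mulr_ge0 => //.
  exact: ltW.
rewrite sumr_const card_ord -mulr_natl !exprMn -/(sqn v).
rewrite (sqr_sqrtr (sqn_ge0 v)); apply: eqr_le; ring.
Qed.

(* Closed under sums and products, with constants that do not depend on [dl]:
   all dependence of the Gaussian on its covariance is estimated through it. *)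
Definition close (A dl x y : R) := [/\ `|x| <= A, `|y| <= A & `|x - y| <= A * dl].

Section close_theory.
Variable dl : R.
Hypothesis dl0 : 0 <= dl.
Local Notation close A := (close A dl).

Lemma close_ge0 A x y : close A x y -> 0 <= A.
Proof. by case=> xA _ _; exact: le_trans xA. Qed.

Lemma close_le A B x y : A <= B -> close A x y -> close B x y.
Proof.
move=> AB [xA yA xyA]; split; [exact: le_trans AB|exact: le_trans AB|].
by rewrite (le_trans xyA)// ler_wpM2r.
Qed.

Lemma close_cst A x : `|x| <= A -> close A x x.
Proof. by move=> xA; split=> //; rewrite subrr normr0 mulr_ge0// (le_trans _ xA). Qed.

Lemma closeD A B x y x' y' : close A x y -> close B x' y' ->
  close (A + B) (x + x') (y + y').
Proof.
move=> [xA yA xyA] [xB yB xyB]; split.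
- by rewrite (le_trans (ler_normD _ _))// lerD.
- by rewrite (le_trans (ler_normD _ _))// lerD.
- by rewrite opprD addrACA (le_trans (ler_normD _ _))// mulrDl lerD// addrC.
Qed.

Lemma closeN A x y : close A x y -> close A (- x) (- y).
Proof. by move=> [xA yA xyA]; split; rewrite ?normrN// -opprD normrN. Qed.

Lemma closeB A B x y x' y' : close A x y -> close B x' y' ->
  close (A + B) (x - x') (y - y').
Proof. by move=> h /closeN; exact: closeD. Qed.

Lemma closeM A B x y x' y' : close A x y -> close B x' y' ->
  close (2 * A * B) (x * x') (y * y').
Proof.
move=> h h'; have A0 := close_ge0 h; have B0 := close_ge0 h'.
case: h h' => [xA yA xyA] [xB yB xyB].
have AB : A * B <= 2 * A * B by have := mulr_ge0 A0 B0; lra.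
split.
- by rewrite normrM (le_trans _ AB)// ler_pM.
- by rewrite normrM (le_trans _ AB)// ler_pM.
- rewrite (_ : _ - _ = (x - y) * x' + y * (x' - y')); last by ring.
  rewrite (le_trans (ler_normD _ _))// !normrM.
  apply: (@le_trans _ _ (A * dl * B + A * (B * dl))); last by apply: eqr_le; ring.
  by rewrite lerD// ler_pM.
Qed.

Lemma close_sum I (r : seq I) A (F G : I -> R) :
  (forall i, close (A i) (F i) (G i)) ->
  close (\sum_(i <- r) A i) (\sum_(i <- r) F i) (\sum_(i <- r) G i).
Proof.
move=> h; elim: r => [|i r IH]; last by rewrite !big_cons; exact: closeD.
by rewrite !big_nil; apply: close_cst; rewrite normr0.
Qed.

Lemma close_prod I (r : seq I) A (F G : I -> R) :
  (forall i, close A (F i) (G i)) ->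
  close ((2 * A) ^+ size r) (\prod_(i <- r) F i) (\prod_(i <- r) G i).
Proof.
move=> h; elim: r => [|i r IH]; last by rewrite !big_cons exprS; exact: closeM.
by rewrite !big_nil; apply: close_cst; rewrite normr1.
Qed.

Lemma close_det n A (M N : 'M[R]_n) : (forall i j, close A (M i j) (N i j)) ->
  close (n`!%:R * (2 * (2 * A) ^+ n)) (\det M) (\det N).
Proof.
move=> h; have -> : n`!%:R * (2 * (2 * A) ^+ n) = \sum_(s : 'S_n) 2 * (2 * A) ^+ n.
  by rewrite big_const iter_addr_0 card_Sn mulr_natl.
rewrite /determinant.
apply: close_sum => s; rewrite -[X in X * _]mulr1.
apply: closeM; first by apply: close_cst; rewrite normrX normrN1 expr1n.
by have := close_prod (index_enum 'I_n) (fun i => h i (s i)); rewrite [index_enum _]unlock -enumT size_enum_ord.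
Qed.

Lemma close_qf n A U V (M N : 'M[R]_n) (u v : 'cV[R]_n) :
  (forall i j, close A (M i j) (N i j)) ->
  (forall i, `|u i ord0| <= U) -> (forall i, `|v i ord0| <= V) ->
  close (n%:R ^+ 2 * (4 * U * A * V)) (qf M u v) (qf N u v).
Proof.
move=> h uU vV; rewrite expr2 -mulrA mulr_natl -[n in _ *+ n]card_ord -sumr_const.
apply: close_sum => i; rewrite mulr_natl -[n in _ *+ n]card_ord -sumr_const.
apply: close_sum => j; rewrite (_ : 4 * U * A * V = 2 * (2 * U * A) * V); last by ring.
by apply: closeM (close_cst (vV j)); apply: closeM => //; exact: close_cst.
Qed.

(** The difference of the roots is [(x - y) / (sqrt x + sqrt y)], with denominator at least
    [sqrt m]. *)
Lemma close_sqrt A m x y : 0 < m -> m <= x -> m <= y -> close A x y ->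
  close (Num.sqrt A + A / Num.sqrt m) (Num.sqrt x) (Num.sqrt y).
Proof.
move=> m0 mx my h; have A0 := close_ge0 h; case: h => xA yA xyA.
have sm : 0 < Num.sqrt m by rewrite sqrtr_gt0.
have Am : 0 <= A / Num.sqrt m by rewrite divr_ge0// ltW.
have sx z : m <= z -> `|z| <= A -> `|Num.sqrt z| <= Num.sqrt A + A / Num.sqrt m.
  move=> mz zA; rewrite ger0_norm ?sqrtr_ge0// ler_wpDr// ler_wsqrtr//.
  by rewrite (le_trans (ler_norm _)).
split; [exact: sx|exact: sx|].
rewrite mulrDl ler_wpDl ?mulr_ge0 ?sqrtr_ge0//.
rewrite mulrAC ler_pdivlMr// -[leLHS](ger0_norm (mulr_ge0 (normr_ge0 _) (ltW sm))).
have sxy : Num.sqrt m <= Num.sqrt x + Num.sqrt y.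
  by rewrite ler_wpDr ?sqrtr_ge0// ler_wsqrtr.
rewrite (le_trans _ xyA)//.
rewrite -[x in X in _ <= X](sqr_sqrtr (le_trans (ltW m0) mx)).
rewrite -[y in X in _ <= X](sqr_sqrtr (le_trans (ltW m0) my)) subr_sqr !normrM normr_id.
by rewrite ler_wpM2l// !ger0_norm ?addr_ge0 ?sqrtr_ge0.
Qed.

(** The common lower bound [m] of the exponents survives in the constant: it will carry the Gaussian
    decay in the bound on the difference too. *)
Lemma close_expRN A m x y : m <= x -> m <= y -> close A x y ->
  close (expR (- m) * (1 + A)) (expR (- x)) (expR (- y)).
Proof.
move=> mx my h; have A0 := close_ge0 h; case: h => _ _ xyA.
have ex z : m <= z -> `|expR (- z)| <= expR (- m) * (1 + A).
  move=> mz; rewrite ger0_norm ?expR_ge0// mulrDr mulr1 ler_wpDr ?mulr_ge0 ?expR_ge0//.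
  by rewrite ler_expR lerN2.
have key u v : m <= u -> u <= v -> `|expR (- u) - expR (- v)| <= expR (- m) * `|u - v|.
  move=> mu uv; rewrite ger0_norm; last by rewrite subr_ge0 ler_expR lerN2.
  rewrite distrC ger0_norm ?subr_ge0//.
  apply: (@le_trans _ _ (expR (- u) * (v - u))); last first.
    by rewrite ler_wpM2r ?subr_ge0// ler_expR lerN2.
  have := ler_wpM2l (expR_ge0 (- u)) (expR_ge1Dx (- (v - u))).
  rewrite -expRD (_ : - u - (v - u) = - v); last by ring.
  lra.
split; [exact: ex|exact: ex|].
apply: (@le_trans _ _ (expR (- m) * `|x - y|)).
  have [/key->//|/ltW yx] := leP x y.
  by rewrite distrC [X in _ * X]distrC key.
rewrite -mulrA ler_wpM2l ?expR_ge0// mulrDl ler_wpDl// mul1r//.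
Qed.

(** The resolvent identity [M^-1 - N^-1 = M^-1 (N - M) N^-1] with the entry bound for elliptic
    inverses. *)
Lemma close_inv lam A n (M N : 'M[R]_n) : 0 < lam ->
  (forall v, lam * sqn v <= qf M v v) -> (forall v, lam * sqn v <= qf N v v) ->
  (forall i j, close A (M i j) (N i j)) ->
  forall i j, close (lam^-1 + n%:R ^+ 2 * (lam^-1 ^+ 2 * A)) (invmx M i j) (invmx N i j).
Proof.
move=> lam0 lM lN h i j.
have A0 : 0 <= A by have /close_ge0 := h i j.
have le1 : lam^-1 <= lam^-1 + n%:R ^+ 2 * (lam^-1 ^+ 2 * A).
  by rewrite lerDl mulr_ge0 ?exprn_ge0// mulr_ge0 ?exprn_ge0// invr_ge0 ltW.
have uM := elliptic_unit lam0 lM; have uN := elliptic_unit lam0 lN.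
split; [exact: le_trans (elliptic_inv_le _ _ lam0 lM) le1|
        exact: le_trans (elliptic_inv_le _ _ lam0 lN) le1|].
rewrite mulrDl ler_wpDl//; first by rewrite mulr_ge0// invr_ge0 ltW.
have -> : invmx M i j - invmx N i j = (invmx M *m (N - M) *m invmx N) i j.
  rewrite mulmxBr mulmxBl mulmxK// mulVmx// mul1mx.
  by rewrite !mxE.
rewrite mxE (le_trans (ler_norm_sum _ _ _))//.
rewrite expr2 -!mulrA mulr_natl -[n in _ *+ n]card_ord -sumr_const.
apply: ler_sum => k _; rewrite normrM.
have nk : `|(invmx M *m (N - M)) i k| <= n%:R * (lam^-1 * (A * dl)).
  rewrite mxE (le_trans (ler_norm_sum _ _ _))// mulr_natl -[n in _ *+ n]card_ord -sumr_const.
  apply: ler_sum => l _; rewrite normrM ler_pM//; first exact: elliptic_inv_le.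
  by rewrite !mxE distrC; case: (h l k).
apply: le_trans (ler_pM _ _ nk (elliptic_inv_le k j lam0 lN)) _ => //.
by apply: eqr_le; ring.
Qed.

End close_theory.

(** The symmetrised bilinear form: the derivative of [qf N v v] in the direction [e] is twice
    [bl N e v], with no symmetry of [N] to be proved. *)
Definition bl n (N : 'M[R]_n) (u v : 'cV[R]_n) : R := (qf N u v + qf N v u) / 2.

(* The centered Gaussian of covariance [M], without its factor [(2 pi)^(-n/2)],
   and its first and second derivatives in the directions [- e] and [- f]. *)
Definition psi0 n (M : 'M[R]_n) (v : 'cV[R]_n) : R :=
  expR (- (qf (invmx M) v v / 2)) / Num.sqrt (\det M).

Definition psi1 n (M : 'M[R]_n) (v e : 'cV[R]_n) : R :=
  psi0 M v * bl (invmx M) e v.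

Definition psi2 n (M : 'M[R]_n) (v e f : 'cV[R]_n) : R :=
  psi0 M v * (bl (invmx M) e v * bl (invmx M) f v - bl (invmx M) e f).

(** The Gaussian and its derivatives are built from determinant, inverse, root and exponential, each
    compatible with [close]. The decay rate is that of [elliptic_invform_ge]; every form evaluated
    at [v] costs at most a factor [1 + sqn v]. *)
Lemma psi_close n lam mu : 0 < lam -> 0 < mu ->
  let c := lam / (n%:R ^+ 3 * mu ^+ 2) in
  exists2 K, 0 <= K & forall dl (M M' : 'M[R]_n) (v e f : 'cV[R]_n), 0 <= dl ->
    elliptic_mx lam mu M -> elliptic_mx lam mu M' ->
    (forall i j, close mu dl (M i j) (M' i j)) ->
    (forall i, `|e i ord0| <= 1) -> (forall i, `|f i ord0| <= 1) ->
    let A := K * (1 + sqn v) ^+ 3 * expR (- (c / 2 * sqn v)) in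
    [/\ close A dl (psi0 M v) (psi0 M' v), close A dl (psi1 M v e) (psi1 M' v e) &
        close A dl (psi2 M v e f) (psi2 M' v e f)].
Proof.
move=> lam0 mu0 c.
pose AN := lam^-1 + n%:R ^+ 2 * (lam^-1 ^+ 2 * mu).
have AN0 : 0 <= AN.
  have := ltW mu0; have : 0 <= lam^-1 by rewrite invr_ge0 ltW.
  by move=> *; rewrite addr_ge0// mulr_ge0 ?exprn_ge0// mulr_ge0 ?exprn_ge0.
pose DM : R := n`!%:R * (2 * (2 * mu) ^+ n).
pose DN : R := n`!%:R * (2 * (2 * AN) ^+ n).
have DM0 : 0 < DM by rewrite mulr_gt0 ?ltr0n ?fact_gt0// mulr_gt0// exprn_gt0// mulr_gt0.
have DN0 : 0 <= DN by rewrite mulr_ge0// mulr_ge0// exprn_ge0// mulr_ge0.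
pose AS : R := Num.sqrt DN + DN / Num.sqrt DM^-1.
have AS0 : 0 <= AS by rewrite addr_ge0 ?sqrtr_ge0// divr_ge0 ?sqrtr_ge0.
pose AQ : R := 2 * (n%:R ^+ 2 * (4 * AN)).
have AQ0 : 0 <= AQ by rewrite mulr_ge0// mulr_ge0 ?exprn_ge0// mulr_ge0.
pose K0 : R := 2 * (1 + AQ) * AS.
have K00 : 0 <= K0 by rewrite mulr_ge0// mulr_ge0// addr_ge0.
pose K := K0 + 2 * K0 * AQ + 2 * K0 * (2 * AQ * AQ + AQ).
have K1 : 0 <= 2 * K0 * AQ by rewrite mulr_ge0// mulr_ge0.
have K2 : 0 <= 2 * K0 * (2 * AQ * AQ + AQ).
  by rewrite mulr_ge0 ?mulr_ge0// addr_ge0// mulr_ge0// mulr_ge0.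
exists K; first by rewrite /K !addr_ge0.
move=> dl M M' v e f dl0 eM eM' MM' e1 f1 A.
have [lM uM] := eM; have [lM' uM'] := eM'.
have NN := close_inv dl0 lam0 lM lM' MM'.
have cdM := close_det dl0 MM'.
have cdN := close_det dl0 NN.
have detN (X : 'M[R]_n) : \det (invmx X) = (\det X)^-1 by rewrite det_inv.
have dM0 := elliptic_det_gt0 lam0 lM; have dM'0 := elliptic_det_gt0 lam0 lM'.
(* The inverse root is read as the root of [\det (invmx M)], which is at least [DM^-1] because
   [\det M <= DM]; away from 0 the root is Lipschitz. *)
have cS : close AS dl (Num.sqrt (\det M))^-1 (Num.sqrt (\det M'))^-1.
  rewrite -!sqrtrV ?ltW// -!detN; case: cdM => dM dM' _.
  apply: close_sqrt => //; first by rewrite invr_gt0.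
    by rewrite detN lef_pV2 ?posrE// (le_trans (ler_norm _)).
  by rewrite detN lef_pV2 ?posrE// (le_trans (ler_norm _)).
pose rho := 1 + sqn v; pose E := expR (- (c / 2 * sqn v)).
have sv0 := sqn_ge0 v.
have rho1 : 1 <= rho by rewrite lerDl.
have rho0 : 0 <= rho by exact: le_trans rho1.
have E0 : 0 <= E by exact: expR_ge0.
have vrho i : `|v i ord0| <= Num.sqrt (sqn v) by exact: norm_le_sqn.
have srho : Num.sqrt (sqn v) <= rho.
  rewrite -[leRHS]ger0_norm// -sqrtr_sqr ler_wsqrtr// expr2 /rho; nra.
have cl (g : 'cV[R]_n) : (forall i, `|g i ord0| <= 1) ->
    close (AQ * rho) dl (bl (invmx M) g v) (bl (invmx M') g v).
  move=> g1; have gg : forall i, `|g i ord0| <= 1 by [].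
  have vv i : `|v i ord0| <= rho by rewrite (le_trans (vrho i)).
  have h1 := close_qf dl0 NN gg vv; have h2 := close_qf dl0 NN vv gg.
  have := closeM (closeD h1 h2) (close_cst dl0 (lexx `|2^-1|)).
  apply: close_le => //; rewrite ger0_norm// /AQ -/AN.
  by apply: eqr_le; field.
have clef : close AQ dl (bl (invmx M) e f) (bl (invmx M') e f).
  have h1 := close_qf dl0 NN e1 f1; have h2 := close_qf dl0 NN f1 e1.
  have := closeM (closeD h1 h2) (close_cst dl0 (lexx `|2^-1|)).
  apply: close_le => //; rewrite ger0_norm// /AQ -/AN.
  by apply: eqr_le; field.
have c0 : close (K0 * rho * E) dl (psi0 M v) (psi0 M' v).
  have h1 := close_qf dl0 NN vrho vrho.
  have h2 := closeM h1 (close_cst dl0 (lexx `|2^-1|)).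
  have lo X : elliptic_mx lam mu X -> c / 2 * sqn v <= qf (invmx X) v v / 2.
    by move=> eX; rewrite mulrAC ler_pM2r// (elliptic_invform_ge _ lam0 mu0).
  have h3 := close_expRN dl0 (lo _ eM) (lo _ eM') h2.
  have := closeM h3 cS; apply: close_le => //.
  rewrite ger0_norm// -/E (_ : 2 * _ * _ = 2 * AS * E * (1 + AQ / 2 * Num.sqrt (sqn v) ^+ 2)); last first.
    by rewrite /AQ -/AN; field.
  rewrite sqr_sqrtr// (_ : K0 * rho * E = 2 * AS * E * ((1 + AQ) * rho)); last by rewrite /K0; ring.
  by rewrite ler_wpM2l ?mulr_ge0// /rho; nra.
have rho3 : rho <= rho ^+ 3.
  by rewrite -[leLHS]expr1; apply: ler_weXn2l.
have rho23 : rho ^+ 2 <= rho ^+ 3 by apply: ler_weXn2l.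
have re0 : 0 <= rho ^+ 3 * E by rewrite mulr_ge0// exprn_ge0.
split.
- apply: close_le c0 => //; rewrite -mulrA /A -/rho -/E -mulrA.
  apply: (@le_trans _ _ (K0 * (rho ^+ 3 * E))); first by rewrite ler_wpM2l// ler_wpM2r.
  by rewrite ler_wpM2r// /K; lra.
- have := closeM c0 (cl _ e1); apply: close_le => //.
  rewrite (_ : 2 * _ * _ = 2 * K0 * AQ * (rho ^+ 2 * E)); last by ring.
  rewrite /A -/rho -/E -[leRHS]mulrA.
  apply: (@le_trans _ _ (2 * K0 * AQ * (rho ^+ 3 * E))); first by rewrite ler_wpM2l// ler_wpM2r.
  by rewrite ler_wpM2r// /K; lra.
- have := closeM c0 (closeB (closeM (cl _ e1) (cl _ f1)) clef); apply: close_le => //.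
  rewrite /A -/rho -/E -[leRHS]mulrA.
  apply: (@le_trans _ _ (2 * K0 * (2 * AQ * AQ + AQ) * (rho ^+ 3 * E))); last first.
    by rewrite ler_wpM2r// /K; lra.
  rewrite [leLHS](_ : _ = 2 * K0 * E * (rho * (2 * AQ * AQ * rho ^+ 2 + AQ))); last by ring.
  rewrite [leRHS](_ : _ = 2 * K0 * E * (rho * (2 * AQ * AQ * rho ^+ 2 + AQ * rho ^+ 2))); last by ring.
  apply: ler_wpM2l; first by apply: mulr_ge0 => //; apply: mulr_ge0.
  by apply: ler_wpM2l => //; rewrite lerD2l ler_peMr// expr_ge1.
Qed.

(** Half of the decay pays for the polynomial: [1 + x <= k^-1 * expR (k * (1 + x))], with [k] so
    small that [m] such factors cost at most [c / 2]. Using [m.+1] covers [m = 0]. *)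
Lemma absorb_power c m : 0 < c -> exists2 K : R, 0 <= K &
  forall x, 0 <= x -> (1 + x) ^+ m * expR (- (c * x)) <= K * expR (- (c / 2 * x)).
Proof.
move=> c0; pose k := c / (2 * m.+1%:R).
have k0 : 0 < k by rewrite divr_gt0// mulr_gt0.
exists (k^-1 ^+ m * expR (c / 2)).
  by rewrite mulr_ge0 ?expR_ge0// exprn_ge0// invr_ge0 ltW.
move=> x x0.
have h : (1 + x) ^+ m <= k^-1 ^+ m * expR (c / 2 * (1 + x)).
  have h1 : 1 + x <= k^-1 * expR (k * (1 + x)).
    rewrite mulrC ler_pdivlMr// mulrC (le_trans _ (expR_ge1Dx _))//.
    by rewrite lerDr.
  apply: (@le_trans _ _ ((k^-1 * expR (k * (1 + x))) ^+ m)).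
    by rewrite lerXn2r// nnegrE ?mulr_ge0 ?expR_ge0 ?invr_ge0 ?(ltW k0)// addr_ge0.
  rewrite exprMn ler_wpM2l// ?exprn_ge0 ?invr_ge0 ?(ltW k0)//.
  rewrite -expRM_natl ler_expR mulrA ler_wpM2r ?addr_ge0//.
  rewrite /k mulrA ler_pdivrMr ?mulr_gt0// mulrC.
  rewrite (_ : c / 2 * _ = c * m.+1%:R); last by field.
  by rewrite ler_wpM2l ?(ltW c0)// ler_nat.
apply: le_trans (ler_wpM2r (expR_ge0 _) h) _.
rewrite -!mulrA -!expRD ler_wpM2l ?exprn_ge0 ?invr_ge0 ?(ltW k0)// ler_expR.
by apply: eqr_le; field.
Qed.

End elliptic_matrices.

(** * The frozen density *)

Section frozen_derivatives.
Context {R : realType} {d : nat}.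
Local Notation V := ('cV[R]_d * 'cV[R]_d)%type.

Lemma qfDl n (N : 'M[R]_n) u u' v : qf N (u + u') v = qf N u v + qf N u' v.
Proof. by rewrite -!qfE linearD/= !mulmxDl mxE. Qed.

Lemma qfDr n (N : 'M[R]_n) u v v' : qf N u (v + v') = qf N u v + qf N u v'.
Proof. by rewrite -!qfE mulmxDr mxE. Qed.

Lemma qfZl n (N : 'M[R]_n) k u v : qf N (k *: u) v = k * qf N u v.
Proof. by rewrite -!qfE linearZ/= -!scalemxAl mxE. Qed.

Lemma qfZr n (N : 'M[R]_n) k u v : qf N u (k *: v) = k * qf N u v.
Proof. by rewrite -!qfE -!scalemxAr mxE. Qed.

Definition frozen_shift (t : R) (z z' : V) : 'cV[R]_(d + d) :=
  col_mx z'.1 z'.2 - resolvent_mx t *m col_mx z.1 z.2.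

Definition resolvent_dir (t : R) (i : 'I_d) : 'cV[R]_(d + d) :=
  resolvent_mx t *m col_mx (delta_mx i ord0) 0.

Lemma frozen_shift_line t i (h : R) z z' :
  frozen_shift t (h *: delta_mx i ord0 + z.1, z.2) z' =
  frozen_shift t z z' + (- h) *: resolvent_dir t i.
Proof.
rewrite /frozen_shift /resolvent_dir /=.
have -> : col_mx (h *: delta_mx i ord0 + z.1) z.2 =
    h *: col_mx (delta_mx i ord0) 0 + col_mx z.1 z.2 :> 'cV[R]_(d + d).
  by rewrite scale_col_mx scaler0 add_col_mx add0r.
by rewrite mulmxDr -scalemxAr scaleNr opprD addrA addrAC.
Qed.

Lemma partial_xE i (f : V -> R) z df :
  is_derive (0 : R) (1 : R) (fun h : R => f (h *: delta_mx i ord0 + z.1, z.2)) df ->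
  partial_x i f z = df.
Proof.
move=> [_ <-]; rewrite /partial_x /derive.
apply: (congr1 (fun F : R -> R => lim (F h @[h --> 0^']))).
by apply/funext => h /=; rewrite addr0 [h *: 1]mulr1 scale0r add0r.
Qed.

(** The affine factor lets one computation serve twice: with the factor 1 it gives first
    derivatives, and these are again a Gaussian times an affine function, so it gives the second
    ones too. *)
Lemma is_derive_gaussian_line (al be ga k m n : R) :
  is_derive (0 : R) (1 : R) (fun h : R => expR (- (al - 2 * h * be + h ^+ 2 * ga) / 2) / k
    * (m - h * n)) (expR (- al / 2) / k * (be * m - n)).
Proof.
pose p : {poly R} := (- al / 2)%:P + be%:P * 'X - (ga / 2)%:P * 'X^2.
pose q : {poly R} := k^-1%:P * (m%:P - n%:P * 'X).
rewrite [X in is_derive _ _ X](_ : _ = (expR \o horner p) * horner q); last first.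
  apply/funext => h; transitivity (expR p.[h] * q.[h]); last by [].
  rewrite /p /q !(hornerD, hornerM, hornerN, hornerC, hornerX, hornerXn); set e := expR _; set e' := expR _.
  have -> : e' = e by congr expR; field.
  by clearbody e; ring.
apply: is_derive_eq; rewrite /GRing.scale/=.
rewrite (_ : p.[0] = - al / 2); last by rewrite /p !(hornerD, hornerM, hornerN, hornerC, hornerX, hornerXn); field.
rewrite (_ : q.[0] = k^-1 * m); last by rewrite /q !(hornerD, hornerM, hornerN, hornerC, hornerX, hornerXn); ring.
rewrite (_ : p^`().[0] = be); last by rewrite /p !(derivD, derivN, derivM, derivC, derivX, derivXn) ?(hornerMn, horner0, expr0n) !(hornerMn, horner0, hornerXn, hornerD, hornerM, hornerN, hornerC, hornerX, hornerXn); ring.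
rewrite (_ : q^`().[0] = - (k^-1 * n)); last by rewrite /q !(derivD, derivN, derivM, derivC, derivX, derivXn) ?(hornerMn, horner0, expr0n) !(hornerMn, horner0, hornerXn, hornerD, hornerM, hornerN, hornerC, hornerX, hornerXn); ring.
by move: (expR _) => e; ring.
Qed.

Lemma frozen_densityE a t (z z' : V) :
  frozen_density a t z z' =
  expR (- qf (invmx (frozen_cov a t z')) (frozen_shift t z z') (frozen_shift t z z') / 2)
  / Num.sqrt ((2 * pi) ^+ (d + d) * \det (frozen_cov a t z')).
Proof. by rewrite /frozen_density /gaussian_pdf qfE. Qed.

(** The covariance depends on [z'] alone, so moving the starting point changes only the shift, and
    changes it linearly. *)
Lemma frozen_density_line a t i (h : R) (z z' : V) (m n : R) :
  is_derive (0 : R) (1 : R) (fun h : R =>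
    frozen_density a t (h *: delta_mx i ord0 + z.1, z.2) z' * (m - h * n))
  (frozen_density a t z z' *
   (bl (invmx (frozen_cov a t z')) (resolvent_dir t i) (frozen_shift t z z') * m - n)).
Proof.
set N := invmx _; set th := frozen_shift t z z'; set e := resolvent_dir t i.
rewrite [X in is_derive _ _ X](_ : _ = fun h : R =>
  expR (- (qf N th th - 2 * h * bl N e th + h ^+ 2 * qf N e e) / 2)
  / Num.sqrt ((2 * pi) ^+ (d + d) * \det (frozen_cov a t z')) * (m - h * n)).
  by rewrite frozen_densityE; exact: is_derive_gaussian_line.
apply/funext => k; rewrite frozen_densityE frozen_shift_line -/N -/th -/e.
congr (expR (- _ / 2) / _ * _).
by clearbody th e N; rewrite qfDl !qfDr !qfZl !qfZr /bl; field.
Qed.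

Lemma partial_frozen_density a t i (z z' : V) :
  partial_x i (frozen_density a t ^~ z') z =
  frozen_density a t z z' *
  bl (invmx (frozen_cov a t z')) (resolvent_dir t i) (frozen_shift t z z').
Proof.
apply: partial_xE.
have := frozen_density_line a t i 0 z z' 1 0; rewrite mulr1 subr0.
rewrite (_ : (fun h : R => _) = (fun h : R =>
    frozen_density a t (h *: delta_mx i ord0 + z.1, z.2) z'))//.
by apply/funext => h; rewrite mulr0 subr0 mulr1.
Qed.

Lemma partial2_frozen_density a t i j (z z' : V) :
  partial_x i (partial_x j (frozen_density a t ^~ z')) z =
  frozen_density a t z z' *
  (bl (invmx (frozen_cov a t z')) (resolvent_dir t i) (frozen_shift t z z') *
   bl (invmx (frozen_cov a t z')) (resolvent_dir t j) (frozen_shift t z z') -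
   bl (invmx (frozen_cov a t z')) (resolvent_dir t j) (resolvent_dir t i)).
Proof.
have -> : partial_x j (frozen_density a t ^~ z') = fun w =>
    frozen_density a t w z' *
    bl (invmx (frozen_cov a t z')) (resolvent_dir t j) (frozen_shift t w z').
  by apply/funext => w; exact: partial_frozen_density.
apply: partial_xE; set N := invmx _; set th := frozen_shift t z z'.
have := frozen_density_line a t i 0 z z' (bl N (resolvent_dir t j) th)
  (bl N (resolvent_dir t j) (resolvent_dir t i)).
rewrite -/N -/th.
rewrite [X in is_derive _ _ X](_ : _ = (fun h : R =>
    frozen_density a t (h *: delta_mx i ord0 + z.1, z.2) z' *
    bl N (resolvent_dir t j) (frozen_shift t (h *: delta_mx i ord0 + z.1, z.2) z')))//.
apply/funext => h; rewrite frozen_shift_line -/th; congr (_ * _).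
by clearbody th N; rewrite /bl qfDl qfDr qfZl qfZr; field.
Qed.

End frozen_derivatives.

(** * Integrals over a compact time interval *)

Lemma integrable_sumr d (T : measurableType d) (R : realType)
    (m : {measure set T -> \bar R}) (D : set T) I (r : seq I) (f : I -> T -> R) :
  measurable D -> (forall i, m.-integrable D (EFin \o f i)) ->
  m.-integrable D (EFin \o (fun x => \sum_(i <- r) f i x)).
Proof.
move=> mD itf; elim: r => [|i s IH].
  by under eq_fun do rewrite big_nil; exact: integrable0.
rewrite (_ : _ \o _ = fun x => ((f i x)%:E + (\sum_(j <- s) f j x)%:E)%E).
  by apply: (integrableD mD); [exact: itf|exact: IH].
by apply/funext => x; rewrite /= big_cons EFinD.
Qed.

Lemma Rintegral_sum d (T : measurableType d) (R : realType)
    (m : {measure set T -> \bar R}) (D : set T) I (r : seq I) (f : I -> T -> R) :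
  measurable D -> (forall i, m.-integrable D (EFin \o f i)) ->
  \int[m]_(x in D) (\sum_(i <- r) f i x) = \sum_(i <- r) \int[m]_(x in D) f i x.
Proof.
move=> mD itf; elim: r => [|i s IH].
  by under eq_Rintegral do rewrite big_nil; rewrite big_nil Rintegral_cst// mul0r.
under eq_Rintegral do rewrite big_cons.
by rewrite RintegralD// ?IH ?big_cons//; exact: integrable_sumr.
Qed.

Lemma Rintegral_deriv_poly (R : realType) (p : {poly R}) (a b : R) : a < b ->
  \int[lebesgue_measure]_(u in `[a, b]) p^`().[u] = p.[b] - p.[a].
Proof.
move=> ab; rewrite /Rintegral (@continuous_FTC2 _ _ (horner p))//.
- by apply: continuous_subspaceT => x; exact: continuous_horner.
- split => [x _||]; first exact: derivable_horner.
  + by apply: cvg_at_right_filter; exact: continuous_horner.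
  + by apply: cvg_at_left_filter; exact: continuous_horner.
- by move=> x _; rewrite -derivE.
Qed.

Section itv_integral.
Context {R : realType}.
Variable t : R.
Hypothesis t0 : 0 < t.
Local Notation mu := (@lebesgue_measure R).

Lemma lebesgue_measure_itv0 : mu `[0, t]%classic = t%:E.
Proof. by rewrite lebesgue_measure_itv/= lte_fin t0 sube0. Qed.

Lemma bounded_itv_integrable (f : R -> R) (B : R) : measurable_fun setT f ->
  (forall u, 0 <= u <= t -> `|f u| <= B) -> mu.-integrable `[0, t] (EFin \o f).
Proof.
move=> mf fB; apply: measurable_bounded_integrable => //.
- by have h := ltry t; rewrite -lebesgue_measure_itv0 in h; exact: h.
- exact: measurable_funTS.
- exists B; split; first by rewrite num_real.
  by move=> M BM u; rewrite /= in_itv/= => /fB/le_trans; apply; exact: ltW.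
Qed.

Lemma abs_itv_integral_le (f : R -> R) (B : R) : measurable_fun setT f ->
  (forall u, 0 <= u <= t -> `|f u| <= B) -> `|\int[mu]_(u in `[0, t]) f u| <= B * t.
Proof.
move=> mf fB; have itf := bounded_itv_integrable mf fB.
apply: (@le_trans _ _ (\int[mu]_(u in `[0, t]) `|f u|)).
  by apply: le_normr_Rintegral.
rewrite -[leRHS](_ : \int[mu]_(u in `[0, t]) B = _); last first.
  by rewrite Rintegral_cst//= lebesgue_measure_itv0.
apply: le_Rintegral => //.
- apply: (@bounded_itv_integrable _ B); first exact: measurableT_comp.
  by move=> u /fB; rewrite normr_id.
- by apply: (@bounded_itv_integrable _ `|B|).
Qed.

Lemma itv_integral_quadratic (A B C : R) :
  \int[mu]_(u in `[0, t]) (A + 2 * B * (t - u) + C * (t - u) ^+ 2) =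
  A * t + B * t ^+ 2 + C * t ^+ 3 / 3.
Proof.
pose p : {poly R} := (A + 2 * B * t + C * t ^+ 2)%:P * 'X
  - (B + C * t)%:P * ('X * 'X) + (C / 3)%:P * ('X * 'X * 'X).
rewrite (_ : (fun u => _) = (fun u => p^`().[u])).
  rewrite Rintegral_deriv_poly// /p.
  by rewrite !(hornerD, hornerM, hornerN, hornerC, hornerX); field.
apply/funext => u; rewrite /p !(derivD, derivN, derivM, derivC, derivX).
by rewrite !(hornerD, hornerM, hornerN, hornerC, hornerX); field.
Qed.

End itv_integral.

Section scaled_covariance.
Context {R : realType} {d : nat}.
Local Notation V := ('cV[R]_d * 'cV[R]_d)%type.
Local Notation mu := (@lebesgue_measure R).

(* The entry [(i, j)] of [R_s B a B^* R_s^*] is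
   [wt s i * wt s j * a (ind i) (ind j)]. *)
Definition wt (s : R) (i : 'I_(d + d)) : R := if fintype.split i is inl _ then 1 else s.

Definition ind (i : 'I_(d + d)) : 'I_d :=
  match fintype.split i with inl k => k | inr k => k end.

Lemma wt_l s k : wt s (lshift d k) = 1.
Proof. by rewrite /wt (unsplitK (inl k)). Qed.

Lemma wt_r s k : wt s (rshift d k) = s.
Proof. by rewrite /wt (unsplitK (inr k)). Qed.

Lemma ind_l k : ind (lshift d k) = k.
Proof. by rewrite /ind (unsplitK (inl k)). Qed.

Lemma ind_r k : ind (rshift d k) = k.
Proof. by rewrite /ind (unsplitK (inr k)). Qed.

Lemma resolvent_noiseE s i k :
  (resolvent_mx s *m noise_mx : 'M[R]_(d + d, d)) i k = wt s i * (ind i == k)%:R.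
Proof.
rewrite /resolvent_mx /noise_mx mul_block_col !(mulmx0, mulmx1, addr0).
by case: (split_ordP i) => j ->; rewrite ?(col_mxEu, col_mxEd) ?wt_l ?wt_r ?ind_l ?ind_r
  mxE ?mul1r// mulr_natr.
Qed.

Lemma frozen_covE (a : V -> 'M[R]_d) t z' i j :
  frozen_cov a t z' i j = \int[mu]_(u in `[0, t])
    (wt (t - u) i * wt (t - u) j * a (backward_flow (t - u) z') (ind i) (ind j)).
Proof.
rewrite mxE; apply: eq_Rintegral => u _; set s := t - u; set b := a _.
rewrite -[_ *m noise_mx^T *m _]mulmxA -trmx_mul mxE.
rewrite (bigD1 (ind j))//= [X in _ + X]big1 ?addr0; last first.
  by move=> k kj; rewrite [(_^T) _ _]mxE resolvent_noiseE eq_sym (negbTE kj) mulr0 mulr0.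
rewrite [(_^T) _ _]mxE resolvent_noiseE eqxx mulr1 mxE.
rewrite (bigD1 (ind i))//= [X in _ + X]big1 ?addr0; last first.
  by move=> k kj; rewrite resolvent_noiseE eq_sym (negbTE kj) mulr0 mul0r.
by rewrite resolvent_noiseE eqxx mulr1; ring.
Qed.

(* The intrinsic scales of the two components are [t^(1/2)] and [t^(3/2)]. *)
Definition dil (t : R) (i : 'I_(d + d)) : R :=
  if fintype.split i is inl _ then (Num.sqrt t)^-1 else (Num.sqrt t)^-1 ^+ 3.

Definition dil_mx t : 'M[R]_(d + d) := diag_mx (\row_i dil t i).

Lemma dil_l t k : dil t (lshift d k) = (Num.sqrt t)^-1.
Proof. by rewrite /dil (unsplitK (inl k)). Qed.

Lemma dil_r t k : dil t (rshift d k) = (Num.sqrt t)^-1 ^+ 3.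
Proof. by rewrite /dil (unsplitK (inr k)). Qed.

Lemma dil_gt0 t i : 0 < t -> 0 < dil t i.
Proof. by move=> t0; rewrite /dil; case: fintype.split => _; rewrite ?exprn_gt0// invr_gt0 sqrtr_gt0. Qed.

Lemma dil_wt t i : 0 < t -> dil t i * wt t i = (Num.sqrt t)^-1.
Proof.
move=> t0; have s0 : 0 < Num.sqrt t by rewrite sqrtr_gt0.
case: (split_ordP i) => k ->; rewrite ?(dil_l, dil_r) ?(wt_l, wt_r) ?mulr1//.
by rewrite -[in X in _ * X](sqr_sqrtr (ltW t0)); field; rewrite gt_eqF.
Qed.

Lemma dil_mxE t (v : 'cV[R]_(d + d)) i : (dil_mx t *m v) i ord0 = dil t i * v i ord0.
Proof. by rewrite mul_diag_mx !mxE. Qed.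

Definition scaled_cov (a : V -> 'M[R]_d) t z' := dil_mx t *m frozen_cov a t z' *m dil_mx t.

Lemma scaled_covE a t z' i j :
  scaled_cov a t z' i j = dil t i * frozen_cov a t z' i j * dil t j.
Proof. by rewrite /scaled_cov mul_mx_diag mul_diag_mx !mxE. Qed.

Definition cov_integrand (a : V -> 'M[R]_d) t z' i j u : R :=
  wt (t - u) i * wt (t - u) j * a (backward_flow (t - u) z') (ind i) (ind j).

Lemma measurable_wt dT (T : measurableType dT) (f : T -> R) i :
  measurable_fun setT f -> measurable_fun setT (fun x => wt (f x) i).
Proof. by move=> mf; rewrite /wt; case: fintype.split. Qed.

Lemma measurable_backward_flow dT (T : measurableType dT) (f : T -> R) (g : T -> V) :
  measurable_fun setT f -> measurable_fun setT g ->
  measurable_fun setT (fun x => backward_flow (f x) (g x)).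
Proof.
move=> mf mg; apply: measurable_fun_pair => /=; first exact: measurableT_comp.
apply: measurable_fun_mxP => i j; rewrite (ord1 j).
under eq_fun do rewrite !mxE.
apply: measurable_funB; last apply: measurable_funM => //.
- apply: (measurableT_comp (measurable_mx_entry i ord0)); exact: measurableT_comp.
- apply: (measurableT_comp (measurable_mx_entry i ord0)); exact: measurableT_comp.
Qed.

Lemma measurable_cov_integrand a t z' i j : measurable_fun setT a ->
  measurable_fun setT (cov_integrand a t z' i j).
Proof.
move=> ma; have mt : measurable_fun setT (fun u : R => t - u) by exact: measurable_funB.
apply: measurable_funM; first by apply: measurable_funM; exact: measurable_wt.
apply: (measurableT_comp (measurable_mx_entry _ _)); apply: (measurableT_comp ma).
exact: measurable_backward_flow.
Qed.

Lemma wt_le t i u : 0 <= u <= t -> 0 <= wt (t - u) i <= wt t i.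
Proof.
by move=> /andP[u0 ut]; rewrite /wt; case: fintype.split => _; rewrite ?ler01 ?lexx// subr_ge0 ut gerBl.
Qed.

Lemma cov_integrand_le (a : V -> 'M[R]_d) t z' i j u (B : R) : 0 <= u <= t ->
  `|a (backward_flow (t - u) z') (ind i) (ind j)| <= B ->
  `|cov_integrand a t z' i j u| <= wt t i * wt t j * B.
Proof.
move=> ut aB; rewrite /cov_integrand !normrM.
have /andP[wi0 wi] := wt_le i ut; have /andP[wj0 wj] := wt_le j ut.
by rewrite (ger0_norm wi0) (ger0_norm wj0) ler_pM// ?mulr_ge0// ler_pM.
Qed.

(** By [dil_wt] the dilation and the weight combine to [t^(-1/2)] in both components; the two such
    factors cancel the length [t] of the interval, so the bound is free of [t]. *)
Lemma dil_cov_le t i j (x B : R) : 0 < t -> `|x| <= wt t i * wt t j * B * t ->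
  `|dil t i * x * dil t j| <= B.
Proof.
move=> t0 xB; have s0 : 0 < Num.sqrt t by rewrite sqrtr_gt0.
rewrite !normrM (gtr0_norm (dil_gt0 i t0)) (gtr0_norm (dil_gt0 j t0)).
apply: (@le_trans _ _ (dil t i * (wt t i * wt t j * B * t) * dil t j)).
  by rewrite ler_wpM2r ?(ltW (dil_gt0 _ t0))// ler_wpM2l ?(ltW (dil_gt0 _ t0)).
rewrite (_ : _ * dil t j = (dil t i * wt t i) * (dil t j * wt t j) * B * t); last by ring.
rewrite !dil_wt// -[X in _ * X](sqr_sqrtr (ltW t0)); apply: eqr_le.
by field; rewrite gt_eqF.
Qed.

Lemma scaled_cov_le (a : V -> 'M[R]_d) t z' (mu : R) i j : 0 < t -> measurable_fun setT a ->
  (forall z i j, `|a z i j| <= mu) -> `|scaled_cov a t z' i j| <= mu.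
Proof.
move=> t0 ma amu; rewrite scaled_covE; apply: dil_cov_le => //.
rewrite frozen_covE; apply: abs_itv_integral_le => //.
  exact: (measurable_cov_integrand _ _ _ _ ma).
by move=> u ut; apply: cov_integrand_le.
Qed.

Lemma scaled_cov_close (a a' : V -> 'M[R]_d) t z' (mu dl : R) i j : 0 < t ->
  measurable_fun setT a -> measurable_fun setT a' ->
  (forall z i j, close mu dl (a z i j) (a' z i j)) ->
  close mu dl (scaled_cov a t z' i j) (scaled_cov a' t z' i j).
Proof.
move=> t0 ma ma' aa'; split.
- by apply: scaled_cov_le => // z k l; case: (aa' z k l).
- by apply: scaled_cov_le => // z k l; case: (aa' z k l).
- rewrite !scaled_covE -mulrBl -mulrBr; apply: dil_cov_le => //.
  have bd (b : V -> 'M[R]_d) : (forall z i j, `|b z i j| <= mu) -> measurable_fun setT b ->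
      lebesgue_measure.-integrable `[0, t] (EFin \o cov_integrand b t z' i j).
    move=> bmu mb; apply: (@bounded_itv_integrable _ _ t0 _ (wt t i * wt t j * mu)).
      exact: measurable_cov_integrand.
    by move=> u ut; exact: cov_integrand_le.
  rewrite !frozen_covE -RintegralB//=; last 2 first.
  - by apply: bd => // z k l; case: (aa' z k l).
  - by apply: bd => // z k l; case: (aa' z k l).
  apply: abs_itv_integral_le => //.
    by apply: measurable_funB; exact: measurable_cov_integrand.
  move=> u ut; rewrite -mulrBr.
  have /andP[wi0 wi] := wt_le i ut; have /andP[wj0 wj] := wt_le j ut.
  rewrite !normrM (ger0_norm wi0) (ger0_norm wj0).
  by apply: ler_pM; rewrite ?mulr_ge0//; [rewrite ler_pM|case: (aa' (backward_flow (t - u) z') (ind i) (ind j))].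
Qed.

(** With [D] the dilation and [s = t - u], this is [B^* R_s^* D v], the vector at which the form of
    the scaled covariance evaluates [a]. *)
Definition cov_dir t (v : 'cV[R]_(d + d)) u : 'cV[R]_d :=
  \col_k ((Num.sqrt t)^-1 * v (lshift d k) ord0 +
          (t - u) * ((Num.sqrt t)^-1 ^+ 3 * v (rshift d k) ord0)).

Lemma qf_scaled_cov (a : V -> 'M[R]_d) t z' (v : 'cV[R]_(d + d)) (mu : R) : 0 < t -> measurable_fun setT a ->
  (forall z i j, `|a z i j| <= mu) ->
  let xi := cov_dir t v in
  qf (scaled_cov a t z') v v = \int[lebesgue_measure]_(u in `[0, t])
    dotv (a (backward_flow (t - u) z') *m xi u) (xi u) /\
  lebesgue_measure.-integrable `[0, t] (EFin \o (fun u =>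
    dotv (a (backward_flow (t - u) z') *m xi u) (xi u))).
Proof.
move=> t0 ma amu xi; set r := (Num.sqrt t)^-1.
have itc i j : lebesgue_measure.-integrable `[0, t] (EFin \o cov_integrand a t z' i j).
  apply: (@bounded_itv_integrable _ _ t0 _ (wt t i * wt t j * mu)).
    exact: measurable_cov_integrand.
  by move=> u ut; exact: cov_integrand_le.
pose g i j u := v i ord0 * dil t i * (dil t j * v j ord0) * cov_integrand a t z' i j u.
have itg i j : lebesgue_measure.-integrable `[0, t] (EFin \o g i j).
  rewrite (_ : _ \o _ = fun u => ((v i ord0 * dil t i * (dil t j * v j ord0))%:E *
    (cov_integrand a t z' i j u)%:E)%E); first by apply: integrableZl => //; exact: itc.
  by apply/funext => u; rewrite /= -EFinM.
have E u : dotv (a (backward_flow (t - u) z') *m xi u) (xi u) =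
    \sum_(p <- [seq (i, j) | i <- index_enum 'I_(d + d), j <- index_enum 'I_(d + d)]) g p.1 p.2 u.
  set b := a _.
  rewrite big_allpairs/= /dotv.
  have S (F : 'I_(d + d) -> R) : \sum_i F i = \sum_(k < d) (F (lshift d k) + F (rshift d k)).
    by rewrite big_split_ord big_split.
  rewrite S; apply: eq_bigr => k _; rewrite mxE mulr_suml !S -big_split/=.
  apply: eq_bigr => l _; rewrite /g /cov_integrand -/b !(wt_l, wt_r, ind_l, ind_r, dil_l, dil_r).
  by rewrite [xi u _ _]mxE [xi u _ _]mxE -/r; ring.
have itS : lebesgue_measure.-integrable `[0, t] (EFin \o (fun u =>
    dotv (a (backward_flow (t - u) z') *m xi u) (xi u))).
  by rewrite (funext E : (fun u => _) = _); exact: integrable_sumr.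
split=> //; rewrite (funext E : (fun u => _) = _) Rintegral_sum// big_allpairs/=.
apply: eq_bigr => i _; apply: eq_bigr => j _.
rewrite /g RintegralZl// scaled_covE frozen_covE; set I := \int[_]_(u in _) _.
by rewrite -[X in _ = _ * X]/I; ring.
Qed.

(* 1/20 is below the least eigenvalue of the matrix [1, 1/2; 1/2, 1/3] of the
   form [p^2 + p q + q^2 / 3], the integral of [(p + s q)^2] over [0, 1]. *)
Lemma scaled_cov_elliptic (a : V -> 'M[R]_d) t z' (Lam mu : R) : 0 < t -> 0 < Lam -> measurable_fun setT a ->
  (forall z i j, `|a z i j| <= mu) ->
  (forall z xi, Lam^-1 * mx_enorm xi ^+ 2 <= dotv (a z *m xi) xi) ->
  elliptic_mx (Lam^-1 / 20) mu (scaled_cov a t z').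
Proof.
move=> t0 Lam0 ma amu ell; split; last by move=> i j; exact: scaled_cov_le.
move=> v; have [-> it] := qf_scaled_cov z' v t0 ma amu.
set r := (Num.sqrt t)^-1; set xi := cov_dir t v.
pose A := \sum_(k < d) (r * v (lshift d k) ord0) ^+ 2.
pose B := \sum_(k < d) (r * v (lshift d k) ord0) * (r ^+ 3 * v (rshift d k) ord0).
pose C := \sum_(k < d) (r ^+ 3 * v (rshift d k) ord0) ^+ 2.
have xiE u : mx_enorm (xi u) ^+ 2 = A + 2 * B * (t - u) + C * (t - u) ^+ 2.
  rewrite cV_enorm_sqr /A /B /C mulr_sumr !mulr_suml -!big_split/=.
  by apply: eq_bigr => k _; rewrite mxE -/r; ring.
apply: (@le_trans _ _ (\int[lebesgue_measure]_(u in `[0, t])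
    (Lam^-1 * A + 2 * (Lam^-1 * B) * (t - u) + Lam^-1 * C * (t - u) ^+ 2))); last first.
  apply: le_Rintegral => //.
  - apply: continuous_compact_integrable; first exact: segment_compact.
    pose p : {poly R} := (Lam^-1 * A)%:P + (2 * (Lam^-1 * B))%:P * (t%:P - 'X)
      + (Lam^-1 * C)%:P * ((t%:P - 'X) * (t%:P - 'X)).
    rewrite (_ : (fun u => _) = horner p).
      by apply: continuous_subspaceT => x; exact: continuous_horner.
    apply/funext => u; rewrite /p !(hornerD, hornerM, hornerN, hornerC, hornerX); ring.
  - move=> u _; apply: le_trans (ell _ _); rewrite xiE.
    by apply: eqr_le; ring.
rewrite itv_integral_quadratic//.
rewrite (_ : _ + _ = Lam^-1 * (A * t + B * t ^+ 2 + C * t ^+ 3 / 3)); last by ring.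
rewrite [leLHS](_ : _ = Lam^-1 * (20^-1 * sqn v)); last by ring.
apply: ler_wpM2l; first by rewrite invr_ge0 ltW.
rewrite /sqn big_split_ord/= /A /B /C !mulr_suml -!big_split/= mulr_sumr.
apply: ler_sum => k _.
have r2 : r ^+ 2 * t = 1.
  by rewrite /r exprVn sqr_sqrtr ?(ltW t0)// mulVf// gt_eqF.
set x := v (lshift d k) ord0; set y := v (rshift d k) ord0.
rewrite [leRHS](_ : _ = (r ^+ 2 * t) * x ^+ 2 + (r ^+ 2 * t) ^+ 2 * (x * y) +
  (r ^+ 2 * t) ^+ 3 * y ^+ 2 / 3); last by ring.
rewrite r2 !expr1n !mul1r; move: (x : R) (y : R) => p q.
(* The form minus [(p^2 + q^2) / 20] equals [(19 p + 10 q)^2 / 380] plus a positive multiple of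
   [q^2]. *)
have := sqr_ge0 (19 * p + 10 * q); have := sqr_ge0 q; lra.
Qed.

End scaled_covariance.

Lemma mxBE (R : zmodType) m n (A B : 'M[R]_(m, n)) i j : (A - B) i j = A i j - B i j.
Proof. by rewrite !mxE. Qed.

Lemma mxZE (R : pzRingType) m n k (A : 'M[R]_(m, n)) i j : (k *: A) i j = k * A i j.
Proof. by rewrite mxE. Qed.

Section scaled_density.
Context {R : realType} {d : nat}.
Local Notation V := ('cV[R]_d * 'cV[R]_d)%type.
Local Notation kd := (@kolmogorov_density R d).

Lemma blZl n (N : 'M[R]_n) k u v : bl N (k *: u) v = k * bl N u v.
Proof. by rewrite /bl qfZl qfZr; ring. Qed.

Lemma blC n (N : 'M[R]_n) u v : bl N u v = bl N v u.
Proof. by rewrite /bl addrC. Qed.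

Lemma blZr n (N : 'M[R]_n) k u v : bl N u (k *: v) = k * bl N u v.
Proof. by rewrite blC blZl blC. Qed.

Lemma qf_dil t (N : 'M[R]_(d + d)) u v :
  qf (dil_mx t *m N *m dil_mx t) u v = qf N (dil_mx t *m u) (dil_mx t *m v).
Proof. by rewrite -!qfE trmx_mul /dil_mx tr_diag_mx !mulmxA. Qed.

Lemma bl_dil t (N : 'M[R]_(d + d)) u v :
  bl (dil_mx t *m N *m dil_mx t) u v = bl N (dil_mx t *m u) (dil_mx t *m v).
Proof. by rewrite /bl !qf_dil. Qed.

Lemma det_dil_mx t : \det (dil_mx t : 'M[R]_(d + d)) = (Num.sqrt t)^-1 ^+ (4 * d).
Proof.
rewrite det_diag big_split_ord/=.
under eq_bigr do rewrite mxE dil_l.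
under [X in _ * X]eq_bigr do rewrite mxE dil_r.
by rewrite !prodr_const card_ord -exprM -exprD -mulSn.
Qed.

Lemma dil_unit t : 0 < t -> (dil_mx t : 'M[R]_(d + d)) \in unitmx.
Proof.
move=> t0; rewrite unitmxE det_dil_mx unitfE expf_neq0// invr_neq0// gt_eqF//.
by rewrite sqrtr_gt0.
Qed.

Lemma det_frozen_cov (a : V -> 'M[R]_d) t z' : 0 < t ->
  \det (frozen_cov a t z') = t ^+ (4 * d) * \det (scaled_cov a t z').
Proof.
move=> t0; rewrite /scaled_cov !det_mulmx det_dil_mx.
rewrite -[in t ^+ _](sqr_sqrtr (ltW t0)) -exprM mulnC.
have s0 : Num.sqrt t != 0 by rewrite gt_eqF// sqrtr_gt0.
rewrite (_ : (_ * 2)%N = 4 * d + 4 * d)%N; last by rewrite mulnC mul2n addnn.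
rewrite exprD exprVn; set x := Num.sqrt t ^+ _.
by field; rewrite expf_neq0.
Qed.

Lemma inv_frozen_cov (a : V -> 'M[R]_d) t z' : 0 < t ->
  scaled_cov a t z' \in unitmx ->
  invmx (frozen_cov a t z') = dil_mx t *m invmx (scaled_cov a t z') *m dil_mx t.
Proof.
move=> t0 uM; have uD := dil_unit t0; set C := frozen_cov a t z'.
set M := scaled_cov a t z'; set D := dil_mx t.
have CX : C *m (D *m invmx M *m D) = 1%:M.
  have uM' : M \in unitmx := uM.
  have DCD : D *m C *m D = M by [].
  have h : D *m (C *m (D *m invmx M *m D)) = D.
    by clearbody C D M; rewrite !mulmxA DCD mulmxV// mul1mx.
  by rewrite -[LHS](mulKmx uD) h mulVmx.
have [uC _] := mulmx1_unit CX.
by rewrite -[RHS](mulKmx uC) CX mulmx1.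
Qed.

Definition dil_shift t (z z' : V) : 'cV[R]_(d + d) := dil_mx t *m frozen_shift t z z'.

(** The direction of an [x]-derivative after dilation, up to the factor [t^(-1/2)]: each derivative
    costs exactly that factor and leaves a direction with entries at most 1. *)
Definition diag_dir i : 'cV[R]_(d + d) := col_mx (delta_mx i ord0) (delta_mx i ord0).

Lemma diag_dir_le i k : `|diag_dir i k ord0| <= 1.
Proof.
rewrite /diag_dir; case: (split_ordP k) => j ->; rewrite ?(col_mxEu, col_mxEd) mxE.
- by rewrite normr_nat lern1 leq_b1.
- by rewrite normr_nat lern1 leq_b1.
Qed.

Lemma dil_resolvent_dir t i : 0 < t ->
  dil_mx t *m resolvent_dir t i = (Num.sqrt t)^-1 *: diag_dir i.
Proof.
move=> t0; apply/colP => k; rewrite dil_mxE [RHS]mxE /resolvent_dir /resolvent_mx /diag_dir.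
rewrite mul_block_col !(mulmx0, mul0mx, addr0, mul1mx) mul_scalar_mx.
case: (split_ordP k) => j ->; rewrite ?(dil_l, dil_r) ?(col_mxEu, col_mxEd)//.
by have := dil_wt (rshift d j) t0; rewrite wt_r dil_r mxZE mulrA => ->.
Qed.

Definition gauss_peak (t : R) : R := ((2 * pi) ^+ d * t ^+ (2 * d))^-1.

Lemma gauss_peak_gt0 t : 0 < t -> 0 < gauss_peak t.
Proof. by move=> t0; rewrite invr_gt0 mulr_gt0 ?exprn_gt0// mulr_gt0// pi_gt0. Qed.

Section formulas.
Variables (a : V -> 'M[R]_d) (t : R) (z z' : V).
Hypotheses (t0 : 0 < t) (uM : scaled_cov a t z' \in unitmx).
Local Notation M := (scaled_cov a t z').
Local Notation zeta := (dil_shift t z z').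
Local Notation r := (Num.sqrt t)^-1.

Lemma frozen_density_psi : frozen_density a t z z' = gauss_peak t * psi0 M zeta.
Proof.
rewrite frozen_densityE inv_frozen_cov// qf_dil det_frozen_cov// /psi0.
rewrite -mulNr; set e := expR _.
have -> : (2 * pi) ^+ (d + d) * (t ^+ (4 * d) * \det M) =
    ((2 * pi) ^+ d * t ^+ (2 * d)) ^+ 2 * \det M.
  rewrite mulrA; congr (_ * _); rewrite [RHS]exprMn -!exprM; congr (_ ^+ _ * _ ^+ _).
    by rewrite muln2 addnn.
  by rewrite mulnAC.
have p0 : 0 <= (2 * pi : R) ^+ d * t ^+ (2 * d).
  by rewrite mulr_ge0 ?exprn_ge0 ?(ltW t0)// mulr_ge0// pi_ge0.
rewrite sqrtrM ?sqr_ge0// sqrtr_sqr ger0_norm// invfM /gauss_peak.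
by ring.
Qed.

Lemma partial_frozen_density_psi i :
  partial_x i (frozen_density a t ^~ z') z =
  r * (gauss_peak t * psi1 M zeta (diag_dir i)).
Proof.
rewrite partial_frozen_density frozen_density_psi inv_frozen_cov// bl_dil.
by rewrite dil_resolvent_dir// -/zeta blZl /psi1; ring.
Qed.

Lemma partial2_frozen_density_psi i j :
  partial_x i (partial_x j (frozen_density a t ^~ z')) z =
  t^-1 * (gauss_peak t * psi2 M zeta (diag_dir i) (diag_dir j)).
Proof.
rewrite partial2_frozen_density frozen_density_psi inv_frozen_cov// !bl_dil.
rewrite !dil_resolvent_dir// -/zeta !blZl !blZr /psi2 [bl _ (diag_dir j) (diag_dir i)]blC.
have -> : t^-1 = r ^+ 2 by rewrite exprVn sqr_sqrtr// ltW.
by ring.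
Qed.

End formulas.

Lemma frozen_shiftE t (z z' : V) k :
  frozen_shift t z z' (lshift d k) ord0 = z'.1 k ord0 - z.1 k ord0 /\
  frozen_shift t z z' (rshift d k) ord0 = z'.2 k ord0 - z.2 k ord0 - t * z.1 k ord0.
Proof.
rewrite /frozen_shift /resolvent_mx mul_block_col !(mul0mx, addr0, mul1mx) mul_scalar_mx.
rewrite !mxBE !(col_mxEu, col_mxEd); split=> //.
by rewrite mxE mxZE; ring.
Qed.

Lemma dil_shiftE t (z z' : V) k :
  dil_shift t z z' (lshift d k) ord0 = (Num.sqrt t)^-1 * (z'.1 k ord0 - z.1 k ord0) /\
  dil_shift t z z' (rshift d k) ord0 =
    (Num.sqrt t)^-1 ^+ 3 * (z'.2 k ord0 - z.2 k ord0 - t * z.1 k ord0).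
Proof.
have [h1 h2] := frozen_shiftE t z z' k.
by rewrite /dil_shift !dil_mxE h1 h2 dil_l dil_r.
Qed.

Lemma kolmogorov_form_le t (z z' : V) : 0 < t ->
  kolmogorov_form t z z' <= 6 * sqn (dil_shift t z z').
Proof.
move=> t0; have s0 : 0 < Num.sqrt t by rewrite sqrtr_gt0.
rewrite /kolmogorov_form /sqn big_split_ord/= -big_split/= mulr_sumr !cV_enorm_sqr.
rewrite !mulr_suml mulr_sumr -big_split/=; apply: ler_sum => k _.
have [-> ->] := dil_shiftE t z z' k; rewrite !mxE.
set x := z.1 k _; set x' := z'.1 k _; set y := z.2 k _; set y' := z'.2 k _.
pose p := x' - x; pose w := y' - y - t * x.
rewrite -/p -/w [X in 6 * X](_ : _ = t^-1 * p ^+ 2 + (t ^+ 3)^-1 * w ^+ 2); last first.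
  by rewrite !(exprMn _ (_^-1)) (exprMn _ (_ ^+ 3)) -!exprM (exprM _ 2 3) !exprVn sqr_sqrtr ?(ltW t0).
rewrite (_ : y' - y - t / 2 * (x + x') = w - t / 2 * p); last first.
  by rewrite /w /p; field.
rewrite (_ : p ^+ 2 / (4 * t) + 3 * ((w - t / 2 * p) ^+ 2 / t ^+ 3) =
  (t ^+ 3)^-1 * (t ^+ 2 * p ^+ 2 / 4 + 3 * (w - t / 2 * p) ^+ 2)); last first.
  by field; rewrite gt_eqF.
rewrite (_ : 6 * (t^-1 * p ^+ 2 + (t ^+ 3)^-1 * w ^+ 2) =
  (t ^+ 3)^-1 * (6 * (t ^+ 2 * p ^+ 2 + w ^+ 2))); last first.
  by field; rewrite gt_eqF.
apply: ler_wpM2l; first by rewrite invr_ge0 exprn_ge0// ltW.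
rewrite (_ : t ^+ 2 * p ^+ 2 = (t * p) ^+ 2); last by rewrite exprMn.
rewrite (_ : t / 2 * p = (t * p) / 2); last by ring.
move: (t * p) w => u v; have := sqr_ge0 (v + u / 2); have := sqr_ge0 u; lra.
Qed.

Lemma gauss_le_kolmogorov c c0 t (z z' : V) : 0 < c -> c <= c0 / 6 -> 0 < t ->
  gauss_peak t * expR (- (c0 * sqn (dil_shift t z z'))) <=
  (c ^+ d * 3 `^ (d%:R / 2))^-1 * kd c t z z'.
Proof.
move=> c_gt0 cc0 t0; rewrite kolmogorov_densityE mulrA.
have -> : (c ^+ d * 3 `^ (d%:R / 2))^-1 * @kolmogorov_peak R d c t = gauss_peak t.
  rewrite /kolmogorov_peak /gauss_peak exprMn -exprM.
  have x0 : c ^+ d * 3 `^ (d%:R / 2) != 0.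
    by rewrite mulf_neq0 ?expf_neq0 ?gt_eqF// powR_gt0.
  by rewrite mulrA mulVf// mul1r.
apply: ler_wpM2l; first exact: ltW (gauss_peak_gt0 t0).
rewrite ler_expR mulNr lerN2.
apply: le_trans (ler_wpM2l (ltW c_gt0) (kolmogorov_form_le z z' t0)) _.
rewrite mulrA ler_wpM2r ?sqn_ge0//; lra.
Qed.

Lemma close_eq (A dl x x' y y' : R) : x = x' -> y = y' -> close A dl x' y' -> close A dl x y.
Proof. by move=> -> ->. Qed.

Lemma closeZ (k A dl x y : R) : 0 <= k -> close A dl x y -> close (k * A) dl (k * x) (k * y).
Proof.
move=> k0 [xA yA xyA]; split; rewrite -?mulrBr normrM (ger0_norm k0) -?mulrA;
  exact: ler_wpM2l.
Qed.

(** The 24 is made of the 1/2 in the Gaussian exponent, another 1/2 spent by [absorb_power], and the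
    6 of [kolmogorov_form_le]. The second derivatives are bounded with an extra weight [1 + sqn],
    reserved for the Hoelder increment of the diffusion matrix; hence the power 4 instead of 3. *)
Lemma frozen_density_close (Lam mu c : R) : 0 < Lam -> 0 < mu -> 0 < c ->
  c <= Lam^-1 / 20 / ((d + d)%:R ^+ 3 * mu ^+ 2) / 24 ->
  exists2 K, 0 <= K & forall dl (a a' : V -> 'M[R]_d) t z z', 0 <= dl -> 0 < t ->
    measurable_fun setT a -> measurable_fun setT a' ->
    (forall z i j, close mu dl (a z i j) (a' z i j)) ->
    (forall z xi, Lam^-1 * mx_enorm xi ^+ 2 <= dotv (a z *m xi) xi) ->
    (forall z xi, Lam^-1 * mx_enorm xi ^+ 2 <= dotv (a' z *m xi) xi) ->
    let A := K * kd c t z z' in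
    [/\ close A dl (frozen_density a t z z') (frozen_density a' t z z'),
        forall i, close ((Num.sqrt t)^-1 * A) dl
          (partial_x i (frozen_density a t ^~ z') z)
          (partial_x i (frozen_density a' t ^~ z') z) &
        forall i j, close (t^-1 * A) dl
          ((1 + sqn (dil_shift t z z')) *
             partial_x i (partial_x j (frozen_density a t ^~ z')) z)
          ((1 + sqn (dil_shift t z z')) *
             partial_x i (partial_x j (frozen_density a' t ^~ z')) z)].
Proof.
move=> Lam0 mu0 c_gt0 cle; set lam := Lam^-1 / 20 in cle *.
have lam0 : 0 < lam by rewrite divr_gt0// invr_gt0.
have [K0 K00 H] := @psi_close R (d + d) lam mu lam0 mu0.
set c0 := lam / _ in H cle *.
have c00 : 0 < c0 by lra.
have c02 : 0 < c0 / 2 by lra.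
have [K1 K10 absorb] := absorb_power 4 c02.
pose Kc : R := (c ^+ d * 3 `^ (d%:R / 2))^-1.
have Kc0 : 0 <= Kc by rewrite invr_ge0 mulr_ge0 ?powR_ge0// exprn_ge0// ltW.
exists (K0 * K1 * Kc); first by rewrite mulr_ge0// mulr_ge0.
move=> dl a a' t z z' dl0 t0 ma ma' aa' ell ell' A.
have amu w i j : `|a w i j| <= mu by case: (aa' w i j).
have amu' w i j : `|a' w i j| <= mu by case: (aa' w i j).
have eM := scaled_cov_elliptic z' t0 Lam0 ma amu ell.
have eM' := scaled_cov_elliptic z' t0 Lam0 ma' amu' ell'.
have uM := elliptic_unit lam0 (elliptic_lb eM).
have uM' := elliptic_unit lam0 (elliptic_lb eM').
have MM i j := scaled_cov_close z' i j t0 ma ma' aa'.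
have t1 : 0 <= (Num.sqrt t)^-1 by rewrite invr_ge0 sqrtr_ge0.
have t2 : 0 <= t^-1 by rewrite invr_ge0 ltW.
set v := dil_shift t z z'; pose rho := 1 + sqn v.
have rho1 : 1 <= rho by rewrite lerDl sqn_ge0.
have rho0 : 0 <= rho by exact: le_trans rho1.
pose E := expR (- (c0 / 2 * sqn v)).
have E0 : 0 <= E by exact: expR_ge0.
have gp := ltW (gauss_peak_gt0 t0).
have main : gauss_peak t * (K0 * rho ^+ 4 * E) <= A.
  rewrite [leLHS](_ : _ = K0 * (gauss_peak t * (rho ^+ 4 * E))); last by ring.
  rewrite /A [leRHS](_ : _ = K0 * (K1 * (Kc * kd c t z z'))); last by rewrite !mulrA.
  apply: ler_wpM2l => //.
  apply: le_trans (ler_wpM2l gp (absorb _ (sqn_ge0 v))) _.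
  rewrite mulrCA; apply: ler_wpM2l => //.
  by apply: gauss_le_kolmogorov => //; lra.
have main3 : gauss_peak t * (K0 * rho ^+ 3 * E) <= A.
  apply: le_trans main; apply: ler_wpM2l => //; apply: ler_wpM2r => //.
  by apply: ler_wpM2l => //; apply: ler_weXn2l.
have [hh _ _] := H dl _ _ v 0 0 dl0 eM eM' MM
  (fun k => ltac:(by rewrite mxE normr0)) (fun k => ltac:(by rewrite mxE normr0)).
split.
- apply: (close_eq (frozen_density_psi z t0 uM) (frozen_density_psi z t0 uM')).
  exact: (close_le dl0 main3 (closeZ gp hh)).
- move=> i.
  apply: (close_eq (partial_frozen_density_psi z t0 uM i) (partial_frozen_density_psi z t0 uM' i)).
  have [_ h1 _] := H dl _ _ v _ _ dl0 eM eM' MM (diag_dir_le i) (diag_dir_le i).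
  exact: (closeZ t1 (close_le dl0 main3 (closeZ gp h1))).
- move=> i j.
  have [_ _ h2] := H dl _ _ v _ _ dl0 eM eM' MM (diag_dir_le i) (diag_dir_le j).
  apply: (close_eq
    (etrans (congr1 (GRing.mul rho) (partial2_frozen_density_psi z t0 uM i j)) (mulrCA _ _ _))
    (etrans (congr1 (GRing.mul rho) (partial2_frozen_density_psi z t0 uM' i j)) (mulrCA _ _ _))).
  have main4 : rho * (gauss_peak t * (K0 * rho ^+ 3 * E)) <= A.
    apply: le_trans main; apply: eqr_le; ring.
  exact: (closeZ t2 (close_le dl0 main4 (closeZ rho0 (closeZ gp h2)))).
Qed.

End scaled_density.

(** * The parametrix kernel *)

Section kernel_bounds.
Context {R : realType} {d : nat}.
Local Notation V := ('cV[R]_d * 'cV[R]_d)%type.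
Local Notation kd := (@kolmogorov_density R d).

Lemma diffusion_mxE (sigma : V -> 'M[R]_d) z i j :
  diffusion_mx sigma z i j = \sum_k sigma z i k * sigma z j k.
Proof. by rewrite mxE; apply: eq_bigr => k _; rewrite mxE. Qed.

Lemma diffusion_close B dl (sigma sigma' : V -> 'M[R]_d) z i j : 0 <= dl ->
  (forall i j, close B dl (sigma z i j) (sigma' z i j)) ->
  close (d%:R * (2 * B * B)) dl (diffusion_mx sigma z i j) (diffusion_mx sigma' z i j).
Proof.
move=> dl0 h; rewrite !diffusion_mxE mulr_natl -[d in _ *+ d]card_ord -sumr_const.
by apply: close_sum => // k; exact: closeM.
Qed.

Lemma diffusion_increment_close B X dl (sigma sigma' : V -> 'M[R]_d) z w i j : 0 <= dl ->
  (forall z i j, close B dl (sigma z i j) (sigma' z i j)) ->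
  (forall i j, close X dl (sigma z i j - sigma w i j) (sigma' z i j - sigma' w i j)) ->
  close (d%:R * (4 * B * X)) dl ((diffusion_mx sigma z - diffusion_mx sigma w) i j)
    ((diffusion_mx sigma' z - diffusion_mx sigma' w) i j).
Proof.
move=> dl0 hB hX; rewrite !mxBE !diffusion_mxE -!sumrB.
rewrite mulr_natl -[d in _ *+ d]card_ord -sumr_const.
apply: close_sum => // k.
have E (s : V -> 'M[R]_d) : s z i k * s z j k - s w i k * s w j k =
    s z i k * (s z j k - s w j k) + (s z i k - s w i k) * s w j k by ring.
rewrite !E (_ : 4 * B * X = 2 * B * X + 2 * X * B); last by ring.
by apply: closeD; exact: closeM.
Qed.

Lemma mx_enorm_sqn n (v : 'cV[R]_n) : mx_enorm v = Num.sqrt (sqn v).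
Proof. by rewrite /sqn -cV_enorm_sqr sqrtr_sqr ger0_norm// sqrtr_ge0. Qed.

Lemma mx_enorm_le n (v : 'cV[R]_n) B : 0 <= B -> sqn v <= B ^+ 2 -> mx_enorm v <= B.
Proof.
by move=> B0 vB; rewrite mx_enorm_sqn -[leRHS]ger0_norm// -sqrtr_sqr ler_wsqrtr.
Qed.

(** In units of the scaled shift, the start differs from the backward flow of the end point by order
    [t^(1/2)] in velocity and [t^(3/2)] in position; the second is reduced to the first by
    [t <= T]. *)
Lemma flow_increment_le (t T gam : R) (z z' : V) : 0 < t <= T -> 0 < gam <= 1 ->
  (mx_enorm (z.1 - (backward_flow t z').1) + mx_enorm (z.2 - (backward_flow t z').2)) `^ gam <=
  (1 + 2 * T) * t `^ (gam / 2) * (1 + sqn (dil_shift t z z')).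
Proof.
move=> /andP[t0 tT] /andP[g0 g1]; set w := backward_flow t z'.
have T0 : 0 < T by exact: lt_le_trans tT.
set v := dil_shift t z z'; pose s := Num.sqrt (sqn v); pose rho := 1 + sqn v.
have q0 : 0 < Num.sqrt t by rewrite sqrtr_gt0.
have qt : Num.sqrt t ^+ 2 = t by rewrite sqr_sqrtr// ltW.
have s0 : 0 <= s by exact: sqrtr_ge0.
have sv : s ^+ 2 = sqn v by rewrite sqr_sqrtr// sqn_ge0.
have srho : s <= rho by rewrite /rho -sv; have := sqr_ge0 (s - 1); lra.
have rho1 : 1 <= rho by rewrite lerDl sqn_ge0.
have vE : sqn v = \sum_(k < d) (v (lshift d k) ord0 ^+ 2 + v (rshift d k) ord0 ^+ 2).
  by rewrite /sqn big_split_ord/= big_split.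
have h1 k : z.1 k ord0 - w.1 k ord0 = - (Num.sqrt t * v (lshift d k) ord0).
  rewrite /v; have [-> _] := dil_shiftE t z z' k; rewrite mulrA divff ?gt_eqF// /w /=.
  by ring.
have h2 k : z.2 k ord0 - w.2 k ord0 =
    t * Num.sqrt t * (v (lshift d k) ord0 - v (rshift d k) ord0).
  rewrite /v; have [-> ->] := dil_shiftE t z z' k; rewrite /w /= mxBE mxZE.
  have key (q a b c e T' : R) : q != 0 -> q ^+ 2 = T' -> b - (c - T' * e) =
      T' * q * (q^-1 * (e - a) - q^-1 ^+ 3 * (c - b - T' * a)).
    by move=> qn0 <-; field.
  by apply: key => //; rewrite gt_eqF.
have n1 : mx_enorm (z.1 - w.1) <= Num.sqrt t * rho.
  apply: (@le_trans _ _ (Num.sqrt t * s)); last by rewrite ler_wpM2l// ltW.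
  apply: mx_enorm_le; first by rewrite mulr_ge0// ltW.
  rewrite exprMn sv vE mulr_sumr; apply: ler_sum => k _.
  by rewrite mxBE h1 sqrrN exprMn ler_wpM2l ?sqr_ge0// lerDl sqr_ge0.
have n2 : mx_enorm (z.2 - w.2) <= Num.sqrt t * (2 * T * rho).
  apply: (@le_trans _ _ (Num.sqrt t * (2 * t * s))); last first.
    rewrite ler_wpM2l ?(ltW q0)// -!mulrA ler_wpM2l// ler_pM// ltW//.
  apply: mx_enorm_le; first by rewrite mulr_ge0 ?mulr_ge0// ltW.
  rewrite (_ : (Num.sqrt t * (2 * t * s)) ^+ 2 = (t * Num.sqrt t) ^+ 2 * (4 * s ^+ 2)); last by ring.
  rewrite sv vE !mulr_sumr; apply: ler_sum => k _.
  rewrite mxBE h2 exprMn ler_wpM2l ?sqr_ge0//.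
  move: (v (lshift d k) ord0) (v (rshift d k) ord0) => p q.
  have := sqr_ge0 (p + q); have := sqr_ge0 p; have := sqr_ge0 q; lra.
have L1 : 1 <= (1 + 2 * T) * rho.
  by apply: mulr_ege1 => //; rewrite lerDl mulr_ge0// ltW.
apply: (@le_trans _ _ ((Num.sqrt t * ((1 + 2 * T) * rho)) `^ gam)).
  apply: ge0_ler_powR; rewrite ?nnegrE ?(ltW g0)//.
  - by rewrite addr_ge0// sqrtr_ge0.
  - by rewrite mulr_ge0 ?(ltW q0)// (le_trans _ L1).
  - by apply: le_trans (lerD n1 n2) _; apply: eqr_le; ring.
rewrite powRM ?(ltW q0) ?(le_trans _ L1)// -powR12_sqrt ?(ltW t0)// -powRrM.
rewrite (_ : 2^-1 * gam = gam / 2); last by rewrite mulrC.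
rewrite [leRHS](_ : _ = t `^ (gam / 2) * ((1 + 2 * T) * rho)); last by rewrite -/rho; ring.
rewrite ler_wpM2l ?powR_ge0// -[leRHS]powRr1 ?(le_trans _ L1)//.
exact: ler_powR.
Qed.

Lemma powR_weaken (t T e th : R) : 0 < t <= T -> th <= e ->
  t `^ (e - 1) <= T `^ (e - th) * t `^ (th - 1).
Proof.
move=> /andP[t0 tT] the.
rewrite (_ : e - 1 = (e - th) + (th - 1)); last by ring.
rewrite powRD; last by rewrite (gt_eqF t0) implybT.
rewrite ler_wpM2r ?powR_ge0//; apply: ge0_ler_powR => //.
- by rewrite subr_ge0.
- by rewrite nnegrE ltW.
- by rewrite nnegrE ltW// (lt_le_trans t0).
Qed.

Lemma close_trace (A B : R) dl (M M' N N' : 'M[R]_d) : 0 <= dl ->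
  (forall i j, close A dl (M i j) (M' i j)) -> (forall i j, close B dl (N i j) (N' i j)) ->
  close (d%:R ^+ 2 * (2 * A * B)) dl (\tr (M *m N)) (\tr (M' *m N')).
Proof.
move=> dl0 hM hN; rewrite /mxtrace expr2 -mulrA mulr_natl -[d in _ *+ d]card_ord -sumr_const.
apply: close_sum => // i; rewrite !mxE mulr_natl -[d in _ *+ d]card_ord -sumr_const.
by apply: close_sum => // j; exact: closeM.
Qed.

Definition second_order (a : V -> 'M[R]_d) t z z' : R :=
  2^-1 * \tr ((a z - a (backward_flow t z')) *m
              hess_x (frozen_density a t ^~ z') z).

Definition first_order (b : V -> 'cV[R]_d) (a : V -> 'M[R]_d) t z z' : R :=
  dotv (b z) (grad_x (frozen_density a t ^~ z') z).

(** [u] and [u'] play the two drifts. Their difference is not of order [dl], so [close] does not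
    apply and it stays in the bound as a norm. *)
Lemma dotv_close (u u' v v' : 'cV[R]_d) (K1 A dl : R) : 0 <= dl ->
  (forall i, `|u i ord0| <= K1) -> (forall i, `|u' i ord0| <= K1) ->
  (forall i, close A dl (v i ord0) (v' i ord0)) ->
  `|dotv u v| <= d%:R * (K1 * A) /\
  `|dotv u v - dotv u' v'| <= d%:R * ((mx_enorm (u - u') + K1 * dl) * A).
Proof.
move=> dl0 bK bK' h; rewrite /dotv; split.
  rewrite (le_trans (ler_norm_sum _ _ _))// mulr_natl -[d in _ *+ d]card_ord -sumr_const.
  by apply: ler_sum => i _; rewrite normrM; case: (h i) => hi _ _; exact: ler_pM.
rewrite -sumrB (le_trans (ler_norm_sum _ _ _))// mulr_natl -[d in _ *+ d]card_ord -sumr_const.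
apply: ler_sum => i _; case: (h i) => xA xA' xx'.
rewrite (_ : _ - _ = (u i ord0 - u' i ord0) * v i ord0 + u' i ord0 * (v i ord0 - v' i ord0)); last by ring.
rewrite (le_trans (ler_normD _ _))// [leRHS]mulrDl !normrM lerD//.
  by apply: ler_pM => //; rewrite -mxBE mx_enorm_sqn; exact: norm_le_sqn.
by rewrite -mulrA [dl * A]mulrC ler_pM.
Qed.

Lemma first_order_bounds (b b' : V -> 'cV[R]_d) a a' (K1 A dl : R) t z z' :
  0 <= dl -> (forall i, `|b z i ord0| <= K1) -> (forall i, `|b' z i ord0| <= K1) ->
  (forall i, close A dl (partial_x i (frozen_density a t ^~ z') z)
                   (partial_x i (frozen_density a' t ^~ z') z)) ->
  `|first_order b a t z z'| <= d%:R * (K1 * A) /\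
  `|first_order b a t z z' - first_order b' a' t z z'| <=
    d%:R * ((mx_enorm (b z - b' z) + K1 * dl) * A).
Proof.
move=> dl0 bK bK' h; apply: (dotv_close dl0 bK bK') => i.
have E (f : V -> R) : grad_x f z i ord0 = partial_x i f z by rewrite mxE.
exact: (close_eq (E _) (E _) (h i)).
Qed.

(** The weight [rho] produced by the coefficient increment is divided out there and multiplied into
    the Hessian, which can bear it; the trace is unchanged. *)
Lemma second_order_close (a a' : V -> 'M[R]_d) (X A dl rho : R) t z z' :
  0 <= dl -> 0 < rho ->
  (forall i j, close (X * rho) dl ((a z - a (backward_flow t z')) i j)
    ((a' z - a' (backward_flow t z')) i j)) ->
  (forall i j, close A dl
    (rho * partial_x i (partial_x j (frozen_density a t ^~ z')) z)
    (rho * partial_x i (partial_x j (frozen_density a' t ^~ z')) z)) ->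
  close (d%:R ^+ 2 * (X * A)) dl (second_order a t z z') (second_order a' t z z').
Proof.
move=> dl0 rho0 ha hp.
have r0 : 0 <= rho^-1 by rewrite invr_ge0 ltW.
have hM i j : close X dl ((rho^-1 *: (a z - a (backward_flow t z'))) i j)
    ((rho^-1 *: (a' z - a' (backward_flow t z'))) i j).
  apply: (close_eq (mxZE _ _ _ _) (mxZE _ _ _ _)).
  have := closeZ r0 (ha i j); rewrite mulrCA mulVf ?gt_eqF// mulr1; exact.
have E (f : V -> R) i j : (rho *: hess_x f z) i j = rho * partial_x i (partial_x j f) z.
  by rewrite mxZE mxE.
have hN i j := close_eq (E _ i j) (E _ i j) (hp i j).
have F (b : V -> 'M[R]_d) : second_order b t z z' =
    2^-1 * \tr ((rho^-1 *: (b z - b (backward_flow t z'))) *m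
    (rho *: hess_x (frozen_density b t ^~ z') z)).
  rewrite -scalemxAl -scalemxAr scalerA mulVf ?gt_eqF// scale1r.
  by [].
apply: (close_eq (F a) (F a')).
have h2 : 0 <= 2^-1 :> R by [].
have := closeZ h2 (close_trace dl0 hM hN); apply: close_le => //.
by apply: eqr_le; field.
Qed.

Lemma parametrix_kernelE (b : V -> 'cV[R]_d) a t z z' :
  parametrix_kernel b a t z z' = second_order a t z z' + first_order b a t z z'.
Proof. by []. Qed.


Lemma measurable_diffusion (sigma : V -> 'M[R]_d) :
  measurable_fun setT sigma -> measurable_fun setT (diffusion_mx sigma).
Proof.
move=> ms; apply: measurable_fun_mxP => i j.
under eq_fun do rewrite diffusion_mxE.
apply: measurable_sum => k; apply: measurable_funM;
  exact: (measurableT_comp (measurable_mx_entry _ _)).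
Qed.

Lemma sqrt_powR (t : R) : 0 < t -> (Num.sqrt t)^-1 = t `^ (2^-1 - 1).
Proof.
move=> t0; rewrite -powR12_sqrt ?(ltW t0)// -powRN; congr (_ `^ _).
by field.
Qed.

Definition holder_increment (gam : R) (z w : V) : R :=
  (mx_enorm (z.1 - w.1) + mx_enorm (z.2 - w.2)) `^ gam.

(** [close A dl] bounds the difference by [A * dl], which requires [A >= 1] when the difference is
    merely at most [dl]; hence [K2 + 1] and [kap + 1]. The resulting entry bound for the diffusion
    matrices is [mu]. *)
Lemma parametrix_bounds (K1 K2 kap Lam gam T th c : R) :
  let mu := d%:R * (2 * (K2 + 1) * (K2 + 1)) in
  (0 < d)%N -> 0 <= K1 -> 0 <= K2 -> 0 <= kap -> 0 < Lam -> 0 < gam <= 1 -> 0 < T ->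
  th <= gam / 2 -> 0 < c -> c <= Lam^-1 / 20 / ((d + d)%:R ^+ 3 * mu ^+ 2) / 24 ->
  exists2 K, 0 < K & forall dl (b b' : V -> 'cV[R]_d) (sigma sigma' : V -> 'M[R]_d),
  0 <= dl -> measurable_fun setT sigma -> measurable_fun setT sigma' ->
  (forall z i, `|b z i ord0| <= K1) -> (forall z i, `|b' z i ord0| <= K1) ->
  (forall z i j, close (K2 + 1) dl (sigma z i j) (sigma' z i j)) ->
  (forall z w i j, close ((kap + 1) * holder_increment gam z w) dl
     (sigma z i j - sigma w i j) (sigma' z i j - sigma' w i j)) ->
  (forall z xi, Lam^-1 * mx_enorm xi ^+ 2 <= dotv (diffusion_mx sigma z *m xi) xi) ->
  (forall z xi, Lam^-1 * mx_enorm xi ^+ 2 <= dotv (diffusion_mx sigma' z *m xi) xi) ->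
  forall t z z', 0 < t <= T ->
  let G := kd c t z z' in
  close (K * G) dl (frozen_density (diffusion_mx sigma) t z z')
    (frozen_density (diffusion_mx sigma') t z z') /\
  [/\ `|parametrix_kernel b (diffusion_mx sigma) t z z'| <= K * t `^ (th - 1) * G,
      `|parametrix_kernel b' (diffusion_mx sigma') t z z'| <= K * t `^ (th - 1) * G &
      `|parametrix_kernel b (diffusion_mx sigma) t z z' -
        parametrix_kernel b' (diffusion_mx sigma') t z z'| <=
      K * (dl * t `^ (th - 1) + mx_enorm (b z - b' z) * t `^ (2^-1 - 1)) * G].
Proof.
move=> mu d0 K10 K20 kap0 Lam0 g01 T0 thg c0 cle.
have mu0 : 0 < mu by rewrite mulr_gt0 ?ltr0n// mulr_gt0 ?mulr_gt0// ltr_wpDl.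
have [Kp Kp0 HP] := frozen_density_close Lam0 mu0 c0 cle.
pose C2 : R := d%:R ^+ 2 * (d%:R * (4 * (K2 + 1) * ((kap + 1) * (1 + 2 * T)))) * Kp.
pose T2 := T `^ (gam / 2 - th); pose T1 := T `^ (2^-1 - th).
have C20 : 0 <= C2.
  have k1 : 0 <= kap + 1 by lra.
  have k2 : 0 <= K2 + 1 by lra.
  have k3 : 0 <= 1 + 2 * T by lra.
  by apply: mulr_ge0 => //; apply: mulr_ge0; rewrite ?exprn_ge0//; apply: mulr_ge0 => //;
    apply: mulr_ge0; rewrite ?mulr_ge0.
have T20 : 0 <= T2 by exact: powR_ge0.
have T10 : 0 <= T1 by exact: powR_ge0.
pose F1 : R := d%:R * Kp.
have F10 : 0 <= F1 by exact: mulr_ge0.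
pose K := Kp + C2 * T2 + F1 * K1 * T1 + F1 + 1.
have k2 : 0 <= C2 * T2 by exact: mulr_ge0.
have k3 : 0 <= F1 * K1 * T1 by apply: mulr_ge0 => //; exact: mulr_ge0.
have KA : Kp <= K by rewrite /K; lra.
have KB : C2 * T2 + F1 * K1 * T1 <= K by rewrite /K; lra.
have KC : F1 <= K by rewrite /K; lra.
have kap1 : 0 <= kap + 1 by lra.
have th2 : th <= 2^-1 by have /andP[_ g1] := g01; lra.
have K0 : 0 < K by rewrite /K; lra.
have KD : C2 * T2 <= K by rewrite /K; lra.
clearbody K; exists K => //.
move=> dl b b' sigma sigma' dl0 ms ms' bK bK' hs hi ell ell' t z z' tT G.
have /andP[t0 tT'] := tT.
have G0 : 0 <= G by exact: kolmogorov_density_ge0.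
have da w i j := diffusion_close i j dl0 (hs w).
have [hp hg hh] := HP dl _ _ t z z' dl0 t0 (measurable_diffusion ms)
  (measurable_diffusion ms') da ell ell'.
split.
  apply: (close_le dl0 _ hp); rewrite -/G; exact: (ler_wpM2r G0).
set rho := 1 + sqn (dil_shift t z z').
have rho0 : 0 < rho by rewrite ltr_pwDl// sqn_ge0.
pose X0 := (kap + 1) * (1 + 2 * T) * t `^ (gam / 2).
have hX i j : close (X0 * rho) dl (sigma z i j - sigma (backward_flow t z') i j)
    (sigma' z i j - sigma' (backward_flow t z') i j).
  apply: (close_le dl0 _ (hi _ _ _ _)).
  rewrite /X0 -2!(mulrA (kap + 1)); apply: (ler_wpM2l kap1).
  exact: flow_increment_le.
have hA i j := diffusion_increment_close i j dl0 hs hX.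
have S : close (C2 * T2 * t `^ (th - 1) * G) dl
    (second_order (diffusion_mx sigma) t z z') (second_order (diffusion_mx sigma') t z z').
  have hA' i j : close (d%:R * (4 * (K2 + 1) * X0) * rho) dl
      ((diffusion_mx sigma z - diffusion_mx sigma (backward_flow t z')) i j)
      ((diffusion_mx sigma' z - diffusion_mx sigma' (backward_flow t z')) i j).
    apply: (close_le dl0 _ (hA i j)); apply: eqr_le; ring.
  apply: (close_le dl0 _ (second_order_close dl0 rho0 hA' hh)); rewrite -/G.
  (* The Hoelder gain [t^(gam/2)] meets the [t^-1] of the Hessian and makes the singularity
     integrable. *)
  have tg : t `^ (gam / 2) * t^-1 = t `^ (gam / 2 - 1).
    by rewrite powRD ?powR_inv1 ?(ltW t0)// (gt_eqF t0) implybT.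
  rewrite [leLHS](_ : _ = C2 * (t `^ (gam / 2) * t^-1) * G); last first.
    by rewrite /C2 /X0; move: (t `^ _) => x; ring.
  rewrite tg -(mulrA C2 T2); apply: (ler_wpM2r G0); apply: (ler_wpM2l C20).
  exact: powR_weaken.
have st := sqrt_powR t0.
have tw := powR_weaken tT th2; rewrite -/T1 in tw.
have bo u : 0 <= u -> F1 * (K1 * u) * t `^ (2^-1 - 1) * G <= F1 * K1 * T1 * u * t `^ (th - 1) * G.
  move=> u0; apply: (ler_wpM2r G0).
  rewrite [leRHS](_ : _ = F1 * (K1 * u) * (T1 * t `^ (th - 1))); last by ring.
  by apply: ler_wpM2l => //; apply: mulr_ge0 => //; exact: mulr_ge0.
have p0 : 0 <= t `^ (th - 1) by exact: powR_ge0.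
have p1 : 0 <= t `^ (2^-1 - 1) by exact: powR_ge0.
have pG : 0 <= t `^ (th - 1) * G by exact: mulr_ge0.
have e1 := first_order_bounds dl0 (bK z) (bK' z) hg.
have e2 : `|first_order b' (diffusion_mx sigma') t z z'| <=
    d%:R * (K1 * ((Num.sqrt t)^-1 * (Kp * G))).
  have hg' i : close ((Num.sqrt t)^-1 * (Kp * G)) dl
      (partial_x i (frozen_density (diffusion_mx sigma') t ^~ z') z)
      (partial_x i (frozen_density (diffusion_mx sigma') t ^~ z') z).
    by case: (hg i) => _ h _; exact: close_cst.
  by case: (first_order_bounds dl0 (bK' z) (bK' z) hg').
case: e1 => e1 e3.
have fin (x : R) : `|x| <= C2 * T2 * t `^ (th - 1) * G -> forall y : R,
    `|y| <= d%:R * (K1 * ((Num.sqrt t)^-1 * (Kp * G))) ->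
    `|x + y| <= K * t `^ (th - 1) * G.
  move=> hx y hy; rewrite (le_trans (ler_normD _ _))//.
  have := bo 1 ler01; rewrite !mulr1 => bo1.
  have hy' : `|y| <= F1 * K1 * T1 * t `^ (th - 1) * G.
    apply: le_trans hy _; apply: le_trans _ bo1; rewrite st /F1.
    by apply: eqr_le; ring.
  apply: le_trans (lerD hx hy') _.
  rewrite [leLHS](_ : _ = (C2 * T2 + F1 * K1 * T1) * (t `^ (th - 1) * G)); last by ring.
  rewrite [leRHS](_ : _ = K * (t `^ (th - 1) * G)); last by ring.
  exact: (ler_wpM2r pG).
case: S => S1 S2 S3.
split; rewrite ?parametrix_kernelE.
- exact: fin S1 _ e1.
- exact: fin S2 _ e2.
- set x := second_order _ _ _ _; set x' := second_order _ _ _ _.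
  set y := first_order _ _ _ _ _; set y' := first_order _ _ _ _ _.
  rewrite (_ : x + y - (x' + y') = (x - x') + (y - y')); last by ring.
  rewrite (le_trans (ler_normD _ _))//.
  apply: le_trans (lerD S3 e3) _; rewrite -/G.
  set D := mx_enorm _; have D0 : 0 <= D by exact: sqrtr_ge0.
  rewrite st.
  apply: (@le_trans _ _ (C2 * T2 * t `^ (th - 1) * G * dl +
    (F1 * D * t `^ (2^-1 - 1) * G + F1 * K1 * T1 * dl * t `^ (th - 1) * G))).
    rewrite lerD2l; apply: le_trans (lerD (lexx _) (bo dl dl0)).
    by apply: eqr_le; rewrite /F1; ring.
  rewrite [leLHS](_ : _ = (C2 * T2 + F1 * K1 * T1) * (dl * (t `^ (th - 1) * G)) +
    F1 * (D * (t `^ (2^-1 - 1) * G))); last by ring.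
  rewrite [leRHS](_ : _ = K * (dl * (t `^ (th - 1) * G)) + K * (D * (t `^ (2^-1 - 1) * G))); last by ring.
  have q1 : 0 <= dl * (t `^ (th - 1) * G) by exact: mulr_ge0.
  have q2 : 0 <= D * (t `^ (2^-1 - 1) * G) by apply: mulr_ge0 => //; exact: mulr_ge0.
  by apply: lerD; [exact: (ler_wpM2r q1)|exact: (ler_wpM2r q2)].
Qed.

End kernel_bounds.

(** * Joint measurability of the kernels *)

Section measurable_kernels.
Context {R : realType} {d : nat}.
Local Notation V := ('cV[R]_d * 'cV[R]_d)%type.

Section pointwise.
Context {dT : measure_display} {T : measurableType dT}.

Lemma measurable_det n (f : T -> 'M[R]_n) :
  (forall i j, measurable_fun setT (fun x => f x i j)) ->
  measurable_fun setT (fun x => \det (f x)).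
Proof.
move=> mf; apply: measurable_sum => s; apply: measurable_funM => //.
by apply: measurable_prod => i _; exact: mf.
Qed.

Lemma measurable_invmx n (f : T -> 'M[R]_n) i j :
  (forall i j, measurable_fun setT (fun x => f x i j)) ->
  measurable_fun setT (fun x => invmx (f x) i j).
Proof.
move=> mf; have md := measurable_det mf.
(* Cramer's formula, except that [invmx] returns a singular matrix unchanged. *)
have E x : invmx (f x) i j = if \det (f x) == 0 then f x i j else
    (\det (f x))^-1 * cofactor (f x) j i.
  by rewrite /invmx unitmxE unitfE; case: eqP => //= _; rewrite mxE mxE.
rewrite (funext E); apply: measurable_fun_ifT => //.
  by apply: measurable_fun_eqr => //; exact: measurable_cst.
apply: measurable_funM; first exact: (measurableT_comp measurable_inv).
apply: measurable_funM => //; apply: measurable_det => k l.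
rewrite (_ : (fun x => _) = fun x => f x (lift j k) (lift i l)); first exact: mf.
by apply/funext => x; rewrite !mxE.
Qed.

Lemma measurable_qf n (f : T -> 'M[R]_n) (u v : T -> 'cV[R]_n) :
  (forall i j, measurable_fun setT (fun x => f x i j)) ->
  (forall i, measurable_fun setT (fun x => u x i ord0)) ->
  (forall i, measurable_fun setT (fun x => v x i ord0)) ->
  measurable_fun setT (fun x => qf (f x) (u x) (v x)).
Proof.
move=> mf mu mv; apply: measurable_sum => i; apply: measurable_sum => j.
by apply: measurable_funM => //; exact: measurable_funM.
Qed.

Lemma measurable_bl n (f : T -> 'M[R]_n) (u v : T -> 'cV[R]_n) :
  (forall i j, measurable_fun setT (fun x => f x i j)) ->
  (forall i, measurable_fun setT (fun x => u x i ord0)) ->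
  (forall i, measurable_fun setT (fun x => v x i ord0)) ->
  measurable_fun setT (fun x => bl (f x) (u x) (v x)).
Proof.
move=> mf mu mv; apply: measurable_funM; last exact: measurable_cst.
by apply: measurable_funD; exact: measurable_qf.
Qed.

Variables (a : V -> 'M[R]_d) (tt : T -> R) (z z' : T -> V).
Hypotheses (ma : measurable_fun setT a) (mt : measurable_fun setT tt).
Hypotheses (mz : measurable_fun setT z) (mz' : measurable_fun setT z').

Lemma measurable_frozen_cov i j :
  measurable_fun setT (fun x => frozen_cov a (tt x) (z' x) i j).
Proof.
pose I (p : T * R) := cov_integrand a (tt p.1) (z' p.1) i j p.2.
have -> : (fun x => frozen_cov a (tt x) (z' x) i j) =
  (fun x => \int[lebesgue_measure]_u (if (0 <= u) && (u <= tt x) then I (x, u) else 0)).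
  apply/funext => x; rewrite frozen_covE Rintegral_mkcond; congr Rintegral.
  by apply/funext => u; rewrite /patch mem_setE in_itv.
have mt1 : measurable_fun setT (fun p : T * R => tt p.1).
  exact: (measurableT_comp mt).
have mtu : measurable_fun setT (fun p : T * R => tt p.1 - p.2) by exact: measurable_funB.
have mz1 : measurable_fun setT (fun p : T * R => z' p.1) by exact: (measurableT_comp mz').
apply: (@measurable_Rintegral R _ _ _ _ lebesgue_measure
  (fun x u => if (0 <= u) && (u <= tt x) then I (x, u) else 0)).
apply: measurable_fun_ifT; last exact: measurable_cst.
- by apply: measurable_and; apply: measurable_fun_ler.
- apply: measurable_funM; first by apply: measurable_funM; exact: measurable_wt.
  apply: (measurableT_comp (measurable_mx_entry _ _)); apply: (measurableT_comp ma).
  exact: measurable_backward_flow.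
Qed.

Lemma measurable_coord1 k : measurable_fun setT (fun x => (z x).1 k ord0).
Proof. exact: (measurableT_comp (measurable_mx_entry k ord0) (measurable_fst_comp mz)). Qed.

Lemma measurable_coord2 k : measurable_fun setT (fun x => (z x).2 k ord0).
Proof. exact: (measurableT_comp (measurable_mx_entry k ord0) (measurable_snd_comp mz)). Qed.

End pointwise.

Section pointwise2.
Context {dT : measure_display} {T : measurableType dT}.
Variables (a : V -> 'M[R]_d) (tt : T -> R) (z z' : T -> V).
Hypotheses (ma : measurable_fun setT a) (mt : measurable_fun setT tt).
Hypotheses (mz : measurable_fun setT z) (mz' : measurable_fun setT z').

Lemma measurable_frozen_shift i :
  measurable_fun setT (fun x => frozen_shift (tt x) (z x) (z' x) i ord0).
Proof.
case: (split_ordP i) => k ->.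
  under eq_fun do rewrite (frozen_shiftE _ _ _ k).1.
  by apply: measurable_funB; exact: measurable_coord1.
under eq_fun do rewrite (frozen_shiftE _ _ _ k).2.
apply: measurable_funB; first by apply: measurable_funB; exact: measurable_coord2.
by apply: measurable_funM => //; exact: measurable_coord1.
Qed.

Lemma measurable_resolvent_dir i k :
  measurable_fun setT (fun x => (resolvent_dir (tt x) i : 'cV[R]_(d + d)) k ord0).
Proof.
rewrite /resolvent_dir /resolvent_mx.
under eq_fun do rewrite mul_block_col !(mulmx0, mul0mx, addr0, mul1mx) mul_scalar_mx.
case: (split_ordP k) => j ->.
  by under eq_fun do rewrite col_mxEu; exact: measurable_cst.
under eq_fun do rewrite col_mxEd mxZE.
by apply: measurable_funM => //; exact: measurable_cst.
Qed.

Lemma measurable_frozen_density :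
  measurable_fun setT (fun x => frozen_density a (tt x) (z x) (z' x)).
Proof.
under eq_fun do rewrite frozen_densityE.
have mC := measurable_frozen_cov ma mt mz'.
apply: measurable_funM.
  apply: (measurableT_comp (@measurable_expR _)); apply: measurable_funM => //.
  apply: measurable_funN; apply: measurable_qf => i.
  - by move=> j; exact: measurable_invmx.
  - exact: measurable_frozen_shift.
  - exact: measurable_frozen_shift.
apply: (measurableT_comp measurable_inv); apply: (measurableT_comp measurable_sqrt); apply: measurable_funM => //.
exact: measurable_det.
Qed.

Lemma measurable_bl_shift i : measurable_fun setT (fun x =>
  bl (invmx (frozen_cov a (tt x) (z' x))) (resolvent_dir (tt x) i)
    (frozen_shift (tt x) (z x) (z' x))).
Proof.
apply: measurable_bl => [k l|k|k].
- by apply: measurable_invmx; exact: measurable_frozen_cov.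
- exact: measurable_resolvent_dir.
- exact: measurable_frozen_shift.
Qed.

Lemma measurable_bl_dir i j : measurable_fun setT (fun x =>
  bl (invmx (frozen_cov a (tt x) (z' x))) (resolvent_dir (tt x) i)
    (resolvent_dir (tt x) j)).
Proof.
apply: measurable_bl => [k l|k|k].
- by apply: measurable_invmx; exact: measurable_frozen_cov.
- exact: measurable_resolvent_dir.
- exact: measurable_resolvent_dir.
Qed.

(** The derivatives are replaced by their closed formulas, so no limit of difference quotients has
    to be measured. *)
Lemma measurable_parametrix_kernel b : measurable_fun setT b ->
  measurable_fun setT (fun x => parametrix_kernel b a (tt x) (z x) (z' x)).
Proof.
move=> mb; have mp := measurable_frozen_density.
apply: measurable_funD.
  apply: measurable_funM => //; apply: measurable_sum => i.
  under eq_fun do rewrite mxE; apply: measurable_sum => j.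
  apply: measurable_funM.
    under eq_fun do rewrite mxBE.
    apply: measurable_funB; apply: (measurableT_comp (measurable_mx_entry _ _));
      apply: (measurableT_comp ma) => //.
    exact: measurable_backward_flow.
  under eq_fun do rewrite mxE partial2_frozen_density.
  apply: measurable_funM => //; apply: measurable_funB; last exact: measurable_bl_dir.
  by apply: measurable_funM; exact: measurable_bl_shift.
apply: measurable_sum => i; apply: measurable_funM.
  by apply: (measurableT_comp (measurable_mx_entry _ _)); exact: (measurableT_comp mb).
under eq_fun do rewrite mxE partial_frozen_density.
by apply: measurable_funM => //; exact: measurable_bl_shift.
Qed.

End pointwise2.

Lemma measurable_kernel_frozen_density (a : V -> 'M[R]_d) :
  measurable_fun setT a -> measurable_kernel (frozen_density a).
Proof. by move=> ma; apply: measurable_frozen_density => //; kmeas. Qed.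

Lemma measurable_kernel_parametrix_kernel (b : V -> 'cV[R]_d) (a : V -> 'M[R]_d) :
  measurable_fun setT b -> measurable_fun setT a ->
  measurable_kernel (parametrix_kernel b a).
Proof. by move=> mb ma; apply: measurable_parametrix_kernel => //; kmeas. Qed.

End measurable_kernels.

(** * Stability of the density *)

Section stability.
Context {R : realType} {d : nat}.
Local Notation V := ('cV[R]_d * 'cV[R]_d)%type.
Local Notation kd := (@kolmogorov_density R d).

Lemma drift_exponent_lt (q : \bar R) : ((4 * d)%:R%:E < q)%E ->
  @drift_exponent R d q < 2^-1.
Proof.
case: q => [r| |]//=; rewrite ?invr_gt0// lte_fin => dr.
have r0 : 0 < r by exact: le_lt_trans dr.
rewrite ltr_pdivrMr// mulrC ltr_pdivlMr//.
by rewrite -natrM mulnAC.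
Qed.

Lemma measurable_mx_enorm n : measurable_fun setT (@mx_enorm R n 1).
Proof.
rewrite (_ : @mx_enorm R n 1 = fun v : 'cV[R]_n => Num.sqrt (sqn v)); last first.
  by apply/funext => v; rewrite mx_enorm_sqn.
apply: (measurableT_comp measurable_sqrt); apply: measurable_sum => i.
rewrite (_ : (fun x => _) = fun x : 'cV[R]_n => x i ord0 * x i ord0); last first.
  by apply/funext => x; rewrite expr2.
by apply: measurable_funM; exact: measurable_mx_entry.
Qed.

Lemma parametrix_density_difference (K1 K2 kap Lam gam T c : R) (q : \bar R) :
  let mu := d%:R * (2 * (K2 + 1) * (K2 + 1)) in
  (0 < d)%N -> 0 <= K1 -> 0 <= K2 -> 0 <= kap -> 0 < Lam -> 0 < gam <= 1 -> 0 < T ->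
  0 < c -> c <= Lam^-1 / 20 / ((d + d)%:R ^+ 3 * mu ^+ 2) / 24 ->
  ((4 * d)%:R%:E < q)%E ->
  exists2 K, 0 <= K & forall dl N (b b' : V -> 'cV[R]_d) (sigma sigma' : V -> 'M[R]_d),
  0 <= dl -> 0 <= N -> measurable_fun setT b -> measurable_fun setT b' ->
  measurable_fun setT sigma -> measurable_fun setT sigma' ->
  (forall z i, `|b z i ord0| <= K1) -> (forall z i, `|b' z i ord0| <= K1) ->
  (forall z i j, close (K2 + 1) dl (sigma z i j) (sigma' z i j)) ->
  (forall z w i j, close ((kap + 1) * holder_increment gam z w) dl
     (sigma z i j - sigma w i j) (sigma' z i j - sigma' w i j)) ->
  (forall z xi, Lam^-1 * mx_enorm xi ^+ 2 <= dotv (diffusion_mx sigma z *m xi) xi) ->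
  (forall z xi, Lam^-1 * mx_enorm xi ^+ 2 <= dotv (diffusion_mx sigma' z *m xi) xi) ->
  (Lq_enorm q (fun w => b w - b' w)%R <= N%:E)%E ->
  forall t z z', 0 < t <= T ->
  `|parametrix_density b sigma t z z' - parametrix_density b' sigma' t z z'| <=
    K * (dl + N) * kd c t z z'.
Proof.
move=> mu d0 K10 K20 kap0 Lam0 g01 T0 c0 cle hq.
have [g0 g1] : 0 < gam /\ gam <= 1 by move/andP : g01.
(* [gam / 2] is what the second order part allows and [1/2 - 2 d / q] what the drift allows; the
   latter is positive because [q > 4 d]. *)
pose th := Num.min (gam / 2) (2^-1 - @drift_exponent R d q).
have th0 : 0 < th by rewrite lt_min divr_gt0//= subr_gt0 drift_exponent_lt.
have thg : th <= gam / 2 by rewrite ge_min lexx.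
have thq : th <= 2^-1 - @drift_exponent R d q by rewrite ge_min lexx orbT.
have th1 : th <= 1 by apply: le_trans thg _; lra.
clearbody th.
have [Kb Kb0 HK] := parametrix_bounds d0 K10 K20 kap0 Lam0 g01 T0 thg c0 cle.
have [Cd Cd0 HC] := drift_smoothing c0 d0 hq T0 th0 thq.
pose K := Kb + Cd.
have K0 : 0 < K by rewrite addr_gt0.
have KbK : Kb <= K by rewrite lerDl ltW.
have CdK : Cd <= K by rewrite lerDr ltW.
have e0 : 0 < (4 * K)^-1 by rewrite invr_gt0 mulr_gt0.
have th01 : 0 < th <= 1 by rewrite th0.
(* [l] is fixed after [K], since the smallness required of the time integrals is [(4 * K)^-1]. *)
have [l l0 lap] := small_laplace th01 T0 e0.
pose Kf := 2 * (K + 2 * ((K ^+ 2 + 2 * K * stability_const T K th) * expR (l * T) * (T `^ th / th))).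
(* The absolute value makes the constant nonnegative without inspecting [stability_const]. *)
exists `|Kf| => //.
move=> dl N b b' sigma sigma' dl0 N0 mb mb' ms ms' bK bK' hs hi ell ell' bN t z z' tT.
have [BP BH] : (forall t z w, 0 < t <= T ->
    close (Kb * kd c t z w) dl (frozen_density (diffusion_mx sigma) t z w)
    (frozen_density (diffusion_mx sigma') t z w)) /\ (forall t z w, 0 < t <= T ->
  [/\ `|parametrix_kernel b (diffusion_mx sigma) t z w| <= Kb * t `^ (th - 1) * kd c t z w,
      `|parametrix_kernel b' (diffusion_mx sigma') t z w| <= Kb * t `^ (th - 1) * kd c t z w &
      `|parametrix_kernel b (diffusion_mx sigma) t z w -
        parametrix_kernel b' (diffusion_mx sigma') t z w| <=
      Kb * (dl * t `^ (th - 1) + mx_enorm (b z - b' z) * t `^ (2^-1 - 1)) * kd c t z w]).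
  by split=> s x y sT; case: (HK dl b b' sigma sigma' dl0 ms ms' bK bK' hs hi ell ell' s x y sT).
have G0 s (x y : V) : 0 <= kd c s x y by exact: kolmogorov_density_ge0.
(* The series estimate knows a single error size; both the diffusion error [dl] and the drift error
   [N] are enlarged to their sum. *)
have Dl0 : 0 <= dl + N by exact: addr_ge0.
have dlD : dl <= dl + N by rewrite lerDl.
have ND : N <= dl + N by rewrite lerDr.
have db0 w : 0 <= mx_enorm (b w - b' w) by exact: sqrtr_ge0.
have p0 s e : 0 <= s `^ e :> R by exact: powR_ge0.
have mono s e (x y : V) : Kb * s `^ e * kd c s x y <= K * s `^ e * kd c s x y.
  by apply: (ler_wpM2r (G0 _ _ _)); exact: (ler_wpM2r (p0 _ _)).
have mdb : measurable_fun setT (fun w => mx_enorm (b w - b' w)).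
  apply: (@measurableT_comp _ _ _ _ _ _ (@mx_enorm R d 1) _ (fun w => b w - b' w)).
    exact: measurable_mx_enorm.
  apply: measurable_fun_mxP => i j.
  under eq_fun do rewrite mxBE.
  by apply: measurable_funB; exact: (measurableT_comp (measurable_mx_entry _ _)).
have mG : measurable_kernel (@kolmogorov_density R d c).
  by apply: measurable_kolmogorov_density; kmeas.
have GG s r (x y : V) : 0 < s -> 0 < r ->
    (\int[leb2]_w (kd c s x w * kd c r w y)%:E =
     (kd c (s + r) x y)%:E)%E.
  move=> s0 r0; have sr : s < s + r by rewrite ltrDl.
  by have := kolmogorov_density_semigroup x y c0 s0 sr; rewrite addrAC subrr add0r.
have bP s (x y : V) : 0 < s <= T ->
    `|frozen_density (diffusion_mx sigma) s x y| <= K * kd c s x y.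
  move=> /(BP _ x y)[h _ _]; apply: le_trans h _; exact: (ler_wpM2r (G0 _ _ _)).
have bP' s (x y : V) : 0 < s <= T ->
    `|frozen_density (diffusion_mx sigma') s x y| <= K * kd c s x y.
  move=> /(BP _ x y)[_ h _]; apply: le_trans h _; exact: (ler_wpM2r (G0 _ _ _)).
have dP s (x y : V) : 0 < s <= T ->
    `|frozen_density (diffusion_mx sigma) s x y - frozen_density (diffusion_mx sigma') s x y| <=
    K * (dl + N) * kd c s x y.
  move=> /(BP _ x y)[_ _ h]; apply: le_trans h _; rewrite mulrAC.
  apply: (ler_wpM2r (G0 _ _ _)); exact: (ler_pM (ltW Kb0) dl0 KbK dlD).
have bH s (x y : V) : 0 < s <= T -> `|parametrix_kernel b (diffusion_mx sigma) s x y| <=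
    K * s `^ (th - 1) * kd c s x y.
  by move=> /(BH _ x y)[h _ _]; exact: le_trans h (mono _ _ _ _).
have bH' s (x y : V) : 0 < s <= T -> `|parametrix_kernel b' (diffusion_mx sigma') s x y| <=
    K * s `^ (th - 1) * kd c s x y.
  by move=> /(BH _ x y)[_ h _]; exact: le_trans h (mono _ _ _ _).
have dH s (x y : V) : 0 < s <= T -> `|parametrix_kernel b (diffusion_mx sigma) s x y -
    parametrix_kernel b' (diffusion_mx sigma') s x y| <=
    K * ((dl + N) * s `^ (th - 1) + mx_enorm (b x - b' x) * s `^ (2^-1 - 1)) *
    kd c s x y.
  move=> /(BH _ x y)[_ _ h]; apply: le_trans h _; apply: (ler_wpM2r (G0 _ _ _)).
  apply: ler_pM => //; first exact: ltW.
    by apply: addr_ge0; exact: mulr_ge0.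
  by rewrite lerD2r; exact: (ler_wpM2r (p0 _ _)).
have drift s r (x y : V) : 0 < s -> 0 < r -> s + r <= T ->
    (\int[leb2]_w (mx_enorm (b w - b' w) * r `^ (2^-1 - 1) *
      (kd c s x w * kd c r w y))%:E <=
    (K * (dl + N) * (s `^ (th - 1) + r `^ (th - 1)) * kd c (s + r) x y)%:E)%E.
  move=> s0 r0 srT; apply: le_trans (HC _ _ mdb db0 bN s r x y s0 r0 srT) _.
  rewrite lee_fin; apply: (ler_wpM2r (G0 _ _ _)).
  apply: ler_wpM2r; first exact: addr_ge0.
  exact: (ler_pM (ltW Cd0) N0 CdK ND).
have ma := measurable_diffusion ms; have ma' := measurable_diffusion ms'.
have main := @parametrix_series_difference R d (kd c) mG G0 GG T K th l
  T0 K0 th01 l0 lap _ _ _ _ _ _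
  (measurable_kernel_frozen_density ma) (measurable_kernel_frozen_density ma')
  (measurable_kernel_parametrix_kernel mb ma) (measurable_kernel_parametrix_kernel mb' ma')
  mdb db0 Dl0 bP bP' bH bH' dP dH drift _ _ (fun r => erefl) (fun r => erefl) t z z' tT.
have E b0 s0 : parametrix_density b0 s0 t z z' = limn (series (fun r =>
   (if r is k.+1 then time_space_conv (frozen_density (diffusion_mx s0))
      (iter k (time_space_conv (parametrix_kernel b0 (diffusion_mx s0)))
        (parametrix_kernel b0 (diffusion_mx s0)))
    else frozen_density (diffusion_mx s0)) t z z')) by [].
rewrite (E b sigma) (E b' sigma'); apply: le_trans main _.
apply: (ler_wpM2r (G0 _ _ _)); apply: (ler_wpM2r Dl0); exact: ler_norm.
Qed.

(** * From the norms of the statement to entrywise bounds *)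

Lemma mx_entry_enorm m n (A : 'M[R]_(m, n)) i j : `|A i j| <= mx_enorm A.
Proof.
rewrite -sqrtr_sqr /mx_enorm ler_wsqrtr// (bigD1 i)//= (bigD1 j)//=.
rewrite -addrA lerDl addr_ge0//; first by apply: sumr_ge0 => k _; exact: sqr_ge0.
by apply: sumr_ge0 => k _; apply: sumr_ge0 => l _; exact: sqr_ge0.
Qed.

Lemma sup_enorm_ge0 m n (f : V -> 'M[R]_(m, n)) : (0 <= sup_enorm f)%E.
Proof.
apply: (@le_trans _ _ (mx_enorm (f 0))%:E); first by rewrite lee_fin sqrtr_ge0.
by apply: ereal_sup_ubound; exists 0.
Qed.

Lemma sup_enorm_le m n (f : V -> 'M[R]_(m, n)) (K : R) z :
  (sup_enorm f <= K%:E)%E -> mx_enorm (f z) <= K.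
Proof. by move=> fK; rewrite -lee_fin (le_trans _ fK)//; apply: ereal_sup_ubound; exists z. Qed.

Lemma pair_enorm_gt0 (z w : V) : z != w -> 0 < pair_enorm (z.1 - w.1, z.2 - w.2).
Proof.
move=> zw; rewrite lt_neqAle sqrtr_ge0 andbT eq_sym; apply: contra zw => /eqP h.
have {}h : mx_enorm (z.1 - w.1) ^+ 2 + mx_enorm (z.2 - w.2) ^+ 2 <= 0.
  by rewrite -sqrtr_eq0; apply/eqP.
have e (u : 'cV[R]_d) : mx_enorm u ^+ 2 <= 0 -> u = 0.
  by rewrite cV_enorm_sqr => /sqn_eq0.
have s1 := sqr_ge0 (mx_enorm (z.1 - w.1)); have s2 := sqr_ge0 (mx_enorm (z.2 - w.2)).
have /e/eqP : mx_enorm (z.1 - w.1) ^+ 2 <= 0 by lra.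
have /e/eqP : mx_enorm (z.2 - w.2) ^+ 2 <= 0 by lra.
by rewrite !subr_eq0 => /eqP h2 /eqP h1; rewrite (surjective_pairing z) h1 h2 -surjective_pairing.
Qed.

Lemma pair_enorm_le (z : V) : pair_enorm z <= mx_enorm z.1 + mx_enorm z.2.
Proof.
have h1 : 0 <= mx_enorm z.1 by exact: sqrtr_ge0.
have h2 : 0 <= mx_enorm z.2 by exact: sqrtr_ge0.
rewrite -[leRHS]ger0_norm ?addr_ge0// -sqrtr_sqr ler_wsqrtr//.
by rewrite sqrrD; have := mulr_ge0 h1 h2; lra.
Qed.

Section holder.
Variables (m n : nat) (gam : R) (f : V -> 'M[R]_(m, n)).
Hypothesis d0 : (0 < d)%N.

(** A supremum over the empty set would be [-oo]; positivity of [d] supplies two distinct points. *)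
Lemma holder_quotient_ge0 : (0 <= ereal_sup [set r | exists z z' : V, z != z' /\
     r = (mx_enorm (f z - f z') /
          pair_enorm (z.1 - z'.1, z.2 - z'.2) `^ gam)%:E])%E.
Proof.
pose z : V := (const_mx 1, 0).
have z0 : z != 0.
  apply/eqP => /(congr1 (fun w : V => w.1 (Ordinal d0) ord0)).
  by rewrite !mxE => /eqP; rewrite oner_eq0.
apply: (@le_trans _ _ (mx_enorm (f z - f 0) /
          pair_enorm (z.1 - (0 : V).1, z.2 - (0 : V).2) `^ gam)%:E).
  by rewrite lee_fin divr_ge0 ?sqrtr_ge0// powR_ge0.
by apply: ereal_sup_ubound; exists z, 0.
Qed.

Lemma holder_norm_ge0 : (0 <= holder_norm gam f)%E.
Proof. by rewrite adde_ge0// ?sup_enorm_ge0// holder_quotient_ge0. Qed.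

Lemma holder_norm_sup (K : R) z : (holder_norm gam f <= K%:E)%E -> mx_enorm (f z) <= K.
Proof.
move=> fK; apply: sup_enorm_le; apply: le_trans fK.
by rewrite leeDl// holder_quotient_ge0.
Qed.

(** The norm divides by the Euclidean distance, the increment uses the sum of the two component
    norms, which is larger. *)
Lemma holder_norm_increment (K : R) z w : 0 < gam -> (holder_norm gam f <= K%:E)%E ->
  mx_enorm (f z - f w) <= K * holder_increment gam z w.
Proof.
move=> g0 fK; have K0 : 0 <= K by rewrite -lee_fin (le_trans holder_norm_ge0).
have [->|zw] := eqVneq z w.
  rewrite subrr (_ : mx_enorm 0 = 0) ?mulr_ge0 ?powR_ge0//.
  rewrite /mx_enorm big1 ?sqrtr0// => i _; rewrite big1// => j _.
  by rewrite mxE expr0n.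
have p0 := pair_enorm_gt0 zw.
apply: (@le_trans _ _ (K * pair_enorm (z.1 - w.1, z.2 - w.2) `^ gam)); last first.
  rewrite ler_wpM2l//; apply: ge0_ler_powR; rewrite ?nnegrE ?(ltW g0) ?(ltW p0)//.
    by rewrite addr_ge0// sqrtr_ge0.
  exact: pair_enorm_le.
rewrite -ler_pdivrMr ?powR_gt0// -lee_fin (le_trans _ fK)//.
apply: (@le_trans _ _ (ereal_sup [set r | exists z z' : V, z != z' /\
     r = (mx_enorm (f z - f z') /
          pair_enorm (z.1 - z'.1, z.2 - z'.2) `^ gam)%:E])).
  by apply: ereal_sup_ubound; exists z, w.
by rewrite leeDr// sup_enorm_ge0.
Qed.

End holder.

End stability.

Theorem theorem1 (R : realType) (d : nat) (hd : (0 < d)%N) :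
  (forall K1 K2 Lambda kappa gamma : R,
   exists c : R, 0 < c <= 1 /\
   forall (T : R) (q : \bar R), 0 < T -> ((4 * d)%:R%:E < q)%E ->
   exists C : R, 1 <= C /\
   forall (b b_eps : 'cV[R]_d * 'cV[R]_d -> 'cV[R]_d)
     (sigma sigma_eps : 'cV[R]_d * 'cV[R]_d -> 'M[R]_d),
   assumption_A K1 K2 Lambda kappa gamma b b_eps sigma sigma_eps ->
   forall p p_eps :
     R -> 'cV[R]_d * 'cV[R]_d -> 'cV[R]_d * 'cV[R]_d -> R,
   transition_density T b sigma p ->
   transition_density T b_eps sigma_eps p_eps ->
   (forall t z z', 0 < t <= T -> p t z z' = parametrix_density b sigma t z z') ->
   (forall t z z', 0 < t <= T ->
      p_eps t z z' = parametrix_density b_eps sigma_eps t z z') ->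
   forall (t : R) (z z' : 'cV[R]_d * 'cV[R]_d), 0 < t <= T ->
     (`|p t z z' - p_eps t z z'|%:E <=
      C%:E *
      (holder_norm gamma (fun w => sigma w - sigma_eps w)%R
        + Lq_enorm q (fun w => b w - b_eps w)%R) *
      (kolmogorov_density c t z z')%:E)%E)
  /\
  (forall c T : R, 0 < c -> 0 < T ->
   forall (s t : R) (z z' : 'cV[R]_d * 'cV[R]_d), 0 < s -> s < t -> t <= T ->
     (\int[leb2]_w
        (kolmogorov_density c s z w * kolmogorov_density c (t - s) w z')%:E)%E
     = (kolmogorov_density c t z z')%:E).
Proof.
split; last by move=> c T c0 T0 s t z z' s0 st tT; exact: kolmogorov_density_semigroup.
move=> K1 K2 Lambda kappa gamma.
(* [c] is chosen before (A) is available, when the constants are arbitrary reals; the maximum and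
   the absolute values give them usable signs, and their bounds remain valid under (A). *)
pose Lam := Num.max 1 Lambda.
have Lam0 : 0 < Lam by rewrite lt_max ltr01.
have k10 := normr_ge0 K1; have k20 := normr_ge0 K2; have kap0 := normr_ge0 kappa.
pose mu := d%:R * (2 * (`|K2| + 1) * (`|K2| + 1)).
have mu0 : 0 < mu by rewrite mulr_gt0 ?ltr0n// mulr_gt0 ?mulr_gt0// ltr_wpDl.
pose c1 := Lam^-1 / 20 / ((d + d)%:R ^+ 3 * mu ^+ 2) / 24.
have c10 : 0 < c1.
  rewrite divr_gt0// divr_gt0//; first by rewrite divr_gt0// invr_gt0.
  by rewrite mulr_gt0 ?exprn_gt0// ltr0n addn_gt0 hd.
pose c := Num.min 1 c1.
have c0 : 0 < c by rewrite lt_min ltr01.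
exists c; split; first by rewrite c0 ge_min lexx.
move=> T q T0 hq.
(* [C] is also chosen before (A); if [gamma] is out of range, (A) is contradictory and any [C] will
   do. *)
have [g01|ng] := boolP (0 < gamma <= 1); last first.
  exists 1; split=> // b b_eps sigma sigma_eps hA.
  by have := A_gamma hA; rewrite (negbTE ng).
have cc1 : c <= c1 by rewrite ge_min lexx orbT.
have [K K0 HK] := parametrix_density_difference hd k10 k20 kap0 Lam0 g01 T0 c0 cc1 hq.
exists (1 + K); split; first by rewrite lerDl.
move=> b b_eps sigma sigma_eps hA p p_eps _ _ pE peE t z z' tT.
have [[mb mbe ms mse] hb hs L1 ell elle _ hol] := hA.
have LamE : Lam = Lambda by rewrite /Lam; apply/max_idPr.
rewrite pE// peE//.
have t0 : 0 < t by case/andP: tT.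
have G0 : 0 < kolmogorov_density c t z z'.
  by apply: kolmogorov_density_gt0 => //; rewrite gt_eqF.
set hn := holder_norm _ _; set ln := Lq_enorm _ _.
have hn0 : (0 <= hn)%E by exact: holder_norm_ge0.
have ln0 : (0 <= ln)%E by exact: Lnorm_ge0.
have C0 : 0 < 1 + K by rewrite ltr_wpDr.
(* An infinite error makes the right side infinite, the constant and the kernel being positive;
   otherwise both norms are real numbers. *)
have [Soo|Sfin] := eqVneq (hn + ln)%E +oo%E.
  by rewrite Soo gt0_muley ?lte_fin// gt0_mulye ?lte_fin// leey.
have hnfin : hn \is a fin_num.
  rewrite ge0_fin_numE// ltey; apply: contra Sfin => /eqP ->.
  by rewrite addye// -ltNye (lt_le_trans _ ln0)// ltNy0.
have lnfin : ln \is a fin_num.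
  rewrite ge0_fin_numE// ltey; apply: contra Sfin => /eqP ->.
  by rewrite addey// -ltNye (lt_le_trans _ hn0)// ltNy0.
pose dl := fine hn; pose N := fine ln.
have hnE : hn = dl%:E by rewrite fineK.
have lnE : ln = N%:E by rewrite fineK.
have dl0 : 0 <= dl by exact: fine_ge0.
have N0 : 0 <= N by exact: fine_ge0.
have hdl : (hn <= dl%:E)%E by rewrite hnE.
have bd m n (f g : 'cV[R]_d * 'cV[R]_d -> 'M[R]_(m, n)) k :
    (sup_enorm f + sup_enorm g <= k%:E)%E -> forall w,
    mx_enorm (f w) <= `|k| /\ mx_enorm (g w) <= `|k|.
  move=> fg w; split; apply: le_trans (ler_norm k); apply: sup_enorm_le;
    apply: le_trans fg; first by rewrite leeDl// sup_enorm_ge0.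
  by rewrite leeDr// sup_enorm_ge0.
have hb1 := bd _ _ _ _ _ hb; have hs1 := bd _ _ _ _ _ hs.
have g0 : 0 < gamma by case/andP: g01.
have hc w i j : close (`|K2| + 1) dl (sigma w i j) (sigma_eps w i j).
  have [s1 s2] := hs1 w; split.
  - by rewrite (le_trans (mx_entry_enorm _ _ _))// (le_trans s1)// lerDl.
  - by rewrite (le_trans (mx_entry_enorm _ _ _))// (le_trans s2)// lerDl.
  - rewrite -mxBE (le_trans (mx_entry_enorm _ _ _))//.
    apply: (@le_trans _ _ dl); last by rewrite ler_peMl// lerDr.
    exact: (holder_norm_sup hd w hdl).
have hi v w i j : close ((`|kappa| + 1) * holder_increment gamma v w) dl
    (sigma v i j - sigma w i j) (sigma_eps v i j - sigma_eps w i j).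
  have X0 : 0 <= holder_increment gamma v w by exact: powR_ge0.
  have kX : kappa * holder_increment gamma v w <= (`|kappa| + 1) * holder_increment gamma v w.
    by rewrite ler_wpM2r// (le_trans (ler_norm _))// lerDl.
  have hvw := hol v w; rewrite -/(holder_increment gamma v w) in hvw.
  have e1 : 0 <= mx_enorm (sigma v - sigma w) by exact: sqrtr_ge0.
  have e2 : 0 <= mx_enorm (sigma_eps v - sigma_eps w) by exact: sqrtr_ge0.
  split.
  - rewrite -mxBE (le_trans (mx_entry_enorm _ _ _))// (le_trans _ kX)//.
    by rewrite (le_trans _ hvw)// lerDl.
  - rewrite -mxBE (le_trans (mx_entry_enorm _ _ _))// (le_trans _ kX)//.
    by rewrite (le_trans _ hvw)// lerDr.
  (* The difference of the increments is the increment of [sigma - sigma_eps], which the Hoelder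
     norm controls. *)
  - rewrite (_ : _ - _ = ((sigma v - sigma_eps v) - (sigma w - sigma_eps w)) i j); last first.
      by rewrite !mxBE; ring.
    rewrite (le_trans (mx_entry_enorm _ _ _))//.
    apply: (@le_trans _ _ (dl * holder_increment gamma v w)).
      exact: (holder_norm_increment hd v w g0 hdl).
    rewrite mulrC [X in _ <= X * _]mulrC -mulrA ler_wpM2l// ler_peMl// lerDr.
    exact: normr_ge0.
have := HK dl N b b_eps sigma sigma_eps dl0 N0 mb mbe ms mse
  (fun w i => le_trans (mx_entry_enorm _ _ _) (hb1 w).1)
  (fun w i => le_trans (mx_entry_enorm _ _ _) (hb1 w).2) hc hi.
rewrite LamE => /(_ (fun w xi => (andP (ell w xi)).1) (fun w xi => (andP (elle w xi)).1)).
have lnN : (Lq_enorm q (fun w => b w - b_eps w)%R <= N%:E)%E by rewrite -/ln lnE.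
move=> /(_ lnN t z z' tT) main.
rewrite hnE lnE -EFinD -!EFinM lee_fin; apply: le_trans main _.
apply: ler_wpM2r; first exact: ltW.
by apply: ler_wpM2r; [exact: addr_ge0|rewrite lerDr].
Qed.
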